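(* There is a bijection $$\coprod_{n\ge0}(\mathbb C/\mathbb Z)^n/\Sigma_n\longrightarrow\mathcal M(S^1),$$ where $\mathbb Z$ denotes the subgroup $\{2k\pi i:k\text{ an integer}\}$ of $\mathbb C$ and the symmetric group $\Sigma_n$ acts on $(\mathbb C/\mathbb Z)^n$ by reordering. This bijection is a semi-ring homomorphism with respect to the operations on $\coprod_n(\mathbb C/\mathbb Z)^n/\Sigma_n$ given by concatenation (addition) and $$(a_1,\dots,a_n)*(b_1,\dots,b_m)=(a_1+b_1,\dots,a_i+b_j,\dots,a_n+b_m)$$ (the $nm$-tuple of all sums $a_i+b_j$, as multiplication).
   Context: Let $M=S^1=\mathbb R/\mathbb Z$ below. Loop space. $LM=C^\infty(S^1,M)$; infinite sums of complex-valued forms of distinct even (odd) degrees are allowed in $\Omega^{even}(LM)$ ($\Omega^{odd}(LM)$). $\iota$ is contraction with the vector field $\gamma\mapsto\gamma'$. $\Omega_{S^1}(LM)=\Omega^{even}_{S^1}(LM)\oplus\Omega^{odd}_{S^1}(LM)$ denotes the forms in $\ker(d\iota+\iota d)$, with differential $d+\iota$. A form in $\Omega^{odd}_{S^1}(LM)$ is $(d+\iota)$-exact if it is in $(d+\iota)\Omega^{even}_{S^1}(LM)$. Bismut-Chern-Simons form. Let $\nabla_s$, $s\in[0,1]$, be a path of connections on a complex vector bundle $E\to M$, (piecewise) smooth in $s$. Let $\{U_i\}$ be an open cover of $M$ with trivializations of $E|_{U_i}$, transition functions $g_{ij}$, in which $\nabla_s$ is given by matrices of 1-forms $A_{s,i}$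 with curvature $R_{s,i}=dA_{s,i}+A_{s,i}\wedge A_{s,i}$ (which vanishes since $\dim M=1$), $A_{s,j}=g_{ij}^{-1}A_{s,i}g_{ij}+g_{ij}^{-1}dg_{ij}$, and $A'_{s,i}=\partial A_{s,i}/\partial s$. For $\mathcal U=(U_{i_1},\dots,U_{i_p})$ let $\mathcal N(p,\mathcal U)=\{\gamma\in LM:\gamma([\frac{r-1}p,\frac rp])\subset U_{i_r},\ r=1,\dots,p\}$; these sets cover $LM$. $\omega(t)$ is the pullback of $\omega$ under $\gamma\mapsto\gamma(t)$, and $\iota A(t)$ is the function $\gamma\mapsto A(\gamma'(t))$. Then $BCS(\nabla_s)=\sum_{k\ge0}BCS_{2k+1}(\nabla_s)\in\Omega^{odd}_{S^1}(LM)$, where $BCS_{2k+1}$ is given on $\mathcal N(p,\mathcal U)$ by $$Tr\Big(\int_0^1\sum_{n_1,\dots,n_p\ge0}\ \sum_{J\subset S,\,|J|=k,\ (q,m)\in S\setminus J} g_{i_p,i_1}(\gamma(0))\wedge I_1\wedge g_{i_1,i_2}(\gamma(\tfrac1p))\wedge\cdots\wedge g_{i_{p-1},i_p}(\gamma(\tfrac{p-1}p))\wedge I_p\ ds\Big),$$ $$I_r=\int_{\frac{r-1}p\le t_1\le\dots\le t_{n_r}\le\frac rp}X_r^1(t_1)\cdots X_r^{n_r}(t_{n_r})\,dt_1\cdots dt_{n_r},$$ $S=\{(r,j):1\le r\le p,\ 1\le j\le n_r\}$, $X_r^j=R_{s,i_r}$ if $(r,j)\in J$, $X_r^j=A'_{s,i_r}$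 if $(r,j)=(q,m)$, and $X_r^j=\iota A_{s,i_r}$ otherwise. It is independent of all choices. Monoid. Connections $\nabla_0,\nabla_1$ on $E$ are $BCS$-equivalent if $BCS(\nabla_s)$ is $(d+\iota)$-exact for some path from $\nabla_0$ to $\nabla_1$. $(E,\nabla)$ and $(\bar E,\bar\nabla)$ are isomorphic if there is a bundle isomorphism $\phi:\bar E\to E$ over $id_M$ with $\phi^*\nabla=\bar\nabla$. $\mathcal M(M)$ is the set of isomorphism classes of $BCS$-equivalence classes $\{(E,\nabla)\}$ of finite rank complex vector bundles with connection over $M$; it is a commutative semi-ring under direct sum and tensor product $(E\otimes\bar E,\nabla\otimes Id+Id\otimes\bar\nabla)$. (Its Grothendieck ring is the loop differential K-theory $L\widehat K^0(M)$.) *)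

(* Defs.v *)
From HB Require Import structures.
From Stdlib Require List.
From Stdlib Require Import Relations.
From mathcomp Require Import all_boot all_order all_algebra generic_quotient.
From mathcomp Require Import all_classical all_reals all_analysis.
From mathcomp Require Import complex mxtens ring.
Import numFieldNormedType.Exports.
Import Order.TTheory GRing.Theory Num.Theory.

Set Implicit Arguments.
Unset Strict Implicit.
Unset Printing Implicit Defensive.

Local Open Scope classical_set_scope.
Local Open Scope complex_scope.
Local Open Scope ring_scope.

(* Conventions.  The circle is S^1 = R/Z, and everything on it is written on
   the universal cover R: an open set of S^1 is a 1-periodic open set of R, a
   function on it is a 1-periodic function, and a smooth map S^1 -> S^1 is
   given by its lifts R -> R, which are unique up to an additive integer.
   TS^1 is trivialized by d/dx, so a 1-form is a(x) dx. *)

Section Smooth.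
Context {R : realType} {V : normedModType R}.

Definition iterD (vs : seq V) (f : V -> R) : V -> R :=
  foldl (fun h v => 'D_v h) f vs.

(* C^infinity on an open set U; values outside U are irrelevant. *)
Definition smooth (U : set V) (f : V -> R) : Prop :=
  forall (vs : seq V) (x : V), U x ->
    {for x, continuous (iterD vs f)} /\
    (forall v, derivable (iterD vs f) x v).

Lemma iterD_eq (U : set V) (f g : V -> R) vs : open U ->
  (forall x, U x -> f x = g x) -> forall x, U x -> iterD vs f x = iterD vs g x.
Proof.
move=> oU; elim: vs f g => [|v vs IH] f g fg x Ux /=; first exact: fg.
apply: IH => // y Uy /=; apply: near_eq_derive.
have : nbhs y U by exact: open_nbhs_nbhs.
by apply: filterS => z /fg.
Qed.

Lemma smooth_eq (U : set V) (f g : V -> R) : open U ->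
  (forall x, U x -> f x = g x) -> smooth U f -> smooth U g.
Proof.
move=> oU fg sf vs x Ux; have [cf df] := sf vs x Ux.
have fgn : {near x, iterD vs f =1 iterD vs g}.
  have : nbhs x U by exact: open_nbhs_nbhs.
  by apply: filterS => z; exact: (iterD_eq _ oU fg).
split=> [|v]; last exact: near_eq_derivable fgn (df v).
rewrite /prop_for /continuous_at -(iterD_eq vs oU fg Ux).
by apply: cvg_trans cf; apply: near_eq_cvg.
Qed.

Lemma smooth_sub (U W : set V) f : W `<=` U -> smooth U f -> smooth W f.
Proof. by move=> WU sf vs x /WU; exact: sf. Qed.

Lemma smooth_cst (U : set V) c : smooth U (fun=> c).
Proof.
have cstD vs : exists d, iterD vs (fun=> c) = cst d.
  elim: vs c => [|v vs IH] d /=; first by exists d.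
  have -> : 'D_v (fun=> d) = (fun=> 0) :> (V -> R).
    by apply/funext => x; rewrite (derive_cst d).
  exact: IH.
move=> vs x _; have [d ->] := cstD vs.
by split=> [|v]; [exact: cvg_cst | exact: derivable_cst].
Qed.

Lemma smoothDr (U : set V) f v : smooth U f -> smooth U ('D_v f).
Proof. by move=> sf vs x Ux; exact: (sf (v :: vs)). Qed.

Lemma smooth_derivable (U : set V) f x v : smooth U f -> U x -> derivable f x v.
Proof. by move=> sf /(sf [::])[]. Qed.

Lemma iterDD (U : set V) f g vs : open U -> smooth U f -> smooth U g ->
  forall x, U x ->
    iterD vs (fun x => f x + g x) x = iterD vs f x + iterD vs g x.
Proof.
move=> oU; elim: vs f g => // v vs IH f g sf sg x Ux /=.
rewrite -(IH _ _ (smoothDr v sf) (smoothDr v sg) _ Ux).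
apply: (iterD_eq _ oU) => // y Uy /=.
by rewrite -deriveD//; [exact: smooth_derivable sf _|exact: smooth_derivable sg _].
Qed.

Lemma smoothD (U : set V) f g : open U -> smooth U f -> smooth U g ->
  smooth U (fun x => f x + g x).
Proof.
move=> oU sf sg vs x Ux; have [cf df] := sf vs x Ux; have [cg dg] := sg vs x Ux.
have fgn : {near x, iterD vs f + iterD vs g =1 iterD vs (fun x => f x + g x)}.
  have : nbhs x U by exact: open_nbhs_nbhs.
  by apply: filterS => z Uz; rewrite (iterDD vs oU).
split=> [|v]; last by apply: near_eq_derivable fgn _; exact: derivableD.
rewrite /prop_for /continuous_at (iterDD vs oU)//.
by apply: cvg_trans (cvgD cf cg); apply: near_eq_cvg.
Qed.

Inductive prodsum (U : set V) : (V -> R) -> Prop :=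
| Prodsum_mul f g h of smooth U f & smooth U g &
    (forall x, U x -> f x * g x = h x) : prodsum U h
| Prodsum_add f g h of prodsum U f & prodsum U g &
    (forall x, U x -> f x + g x = h x) : prodsum U h.

Lemma prodsum_reg (U : set V) h x : open U -> prodsum U h -> U x ->
  {for x, continuous h} /\ (forall v, derivable h x v).
Proof.
move=> oU + Ux; elim=> [f g {}h sf sg fgh|f g {}h _ [cf df] _ [cg dg] fgh].
- have [/= cf df] := sf [::] x Ux; have [/= cg dg] := sg [::] x Ux.
  have fgn : {near x, f * g =1 h}.
    have : nbhs x U by exact: open_nbhs_nbhs.
    by apply: filterS => z /fgh.
  split=> [|v]; last by apply: near_eq_derivable fgn _; exact: derivableM.
  rewrite /prop_for /continuous_at -fgh//.
  by apply: cvg_trans (cvgM cf cg); apply: near_eq_cvg.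
- have fgn : {near x, f + g =1 h}.
    have : nbhs x U by exact: open_nbhs_nbhs.
    by apply: filterS => z /fgh.
  split=> [|v]; last by apply: near_eq_derivable fgn _; exact: derivableD.
  rewrite /prop_for /continuous_at -fgh//.
  by apply: cvg_trans (cvgD cf cg); apply: near_eq_cvg.
Qed.

Lemma prodsumDr (U : set V) h v : open U -> prodsum U h -> prodsum U ('D_v h).
Proof.
move=> oU; elim=> [f g {}h sf sg fgh|f g {}h pf pDf pg pDg fgh].
- apply: (@Prodsum_add U (fun x => f x * 'D_v g x) (fun x => g x * 'D_v f x)).
  + by apply: (Prodsum_mul sf (smoothDr v sg)).
  + by apply: (Prodsum_mul sg (smoothDr v sf)).
  + move=> x Ux; have fgn : {near x, f * g =1 h}.
      have : nbhs x U by exact: open_nbhs_nbhs.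
      by apply: filterS => z /fgh.
    rewrite -(near_eq_derive v fgn) deriveM//.
      exact: smooth_derivable sf Ux.
    exact: smooth_derivable sg Ux.
- apply: (Prodsum_add pDf pDg) => x Ux.
  have fgn : {near x, f + g =1 h}.
    have : nbhs x U by exact: open_nbhs_nbhs.
    by apply: filterS => z /fgh.
  by rewrite -(near_eq_derive v fgn) deriveD//; apply (prodsum_reg oU).
Qed.

Lemma smoothM (U : set V) f g : open U -> smooth U f -> smooth U g ->
  smooth U (fun x => f x * g x).
Proof.
move=> oU sf sg vs x Ux; apply: (prodsum_reg oU) => //.
have : prodsum U (fun x => f x * g x) by exact: (Prodsum_mul sf sg).
elim: vs (fun x => f x * g x) => //= v vs IH h ph.
by apply: IH; exact: prodsumDr.
Qed.

End Smooth.

Section ComplexCalculus.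
Context {R : realType}.
Local Notation C := R[i].

Definition clift {T : Type} (L : (T -> R) -> R) (F : T -> C) : C :=
  L (fun x => complex.Re (F x)) +i* L (fun x => complex.Im (F x)).

Definition mxlift {T : Type} {m n} (L : (T -> R) -> R) (F : T -> 'M[C]_(m, n)) :
    'M[C]_(m, n) :=
  \matrix_(i, j) clift L (fun x => F x i j).

Definition cderiv (f : R -> C) (x : R) : C := clift (fun u : R -> R => derive1 u x) f.

Definition mxderiv {m n} (F : R -> 'M[C]_(m, n)) (x : R) : 'M[C]_(m, n) :=
  mxlift (fun u : R -> R => derive1 u x) F.

Definition mxint {m n} (a b : R) (F : R -> 'M[C]_(m, n)) : 'M[C]_(m, n) :=
  mxlift (fun u : R -> R => Rintegral lebesgue_measure `[a, b] u) F.

Definition mxlim {m n} (F : nat -> 'M[C]_(m, n)) : 'M[C]_(m, n) :=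
  mxlift (fun u : nat -> R => lim (u @ \oo)) F.

Definition csmooth {V : normedModType R} (U : set V) (f : V -> C) : Prop :=
  smooth U (fun x => complex.Re (f x)) /\ smooth U (fun x => complex.Im (f x)).

Definition mxsmooth {V : normedModType R} {m n} (U : set V)
    (F : V -> 'M[C]_(m, n)) : Prop :=
  forall i j, csmooth U (fun x => F x i j).

Lemma csmooth_sub {V : normedModType R} (U W : set V) f :
  W `<=` U -> csmooth U f -> csmooth W f.
Proof. by move=> WU [? ?]; split; exact: smooth_sub WU _. Qed.

Lemma mxsmooth_sub {V : normedModType R} m n (U W : set V)
    (F : V -> 'M[C]_(m, n)) : W `<=` U -> mxsmooth U F -> mxsmooth W F.
Proof. by move=> WU sF i j; exact: csmooth_sub WU _. Qed.

Lemma csmooth_cst {V : normedModType R} (U : set V) c : csmooth U (fun=> c).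
Proof. by split; exact: smooth_cst. Qed.

Lemma csmoothD {V : normedModType R} (U : set V) f g :
  open U -> csmooth U f -> csmooth U g -> csmooth U (fun x => f x + g x).
Proof.
move=> oU [fr fi] [gr gi].
have Re_add (z w : C) : complex.Re (z + w) = complex.Re z + complex.Re w.
  by case: z w => [? ?] [? ?].
have Im_add (z w : C) : complex.Im (z + w) = complex.Im z + complex.Im w.
  by case: z w => [? ?] [? ?].
split.
- by under eq_fun do rewrite Re_add; exact: smoothD.
- by under eq_fun do rewrite Im_add; exact: smoothD.
Qed.

Lemma ReM (z w : C) : complex.Re (z * w) =
  complex.Re z * complex.Re w + -1 * (complex.Im z * complex.Im w).
Proof. by case: z w => [? ?] [? ?] /=; rewrite mulN1r. Qed.

Lemma ImM (z w : C) : complex.Im (z * w) =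
  complex.Re z * complex.Im w + complex.Im z * complex.Re w.
Proof. by case: z w => [? ?] [? ?]. Qed.

Lemma csmoothM {V : normedModType R} (U : set V) f g :
  open U -> csmooth U f -> csmooth U g -> csmooth U (fun x => f x * g x).
Proof.
move=> oU [fr fi] [gr gi]; split.
- under eq_fun do rewrite ReM.
  apply: (smoothD oU (smoothM oU fr gr)).
  have s1 : smooth U (fun=> -1 : R) := @smooth_cst R V U (-1).
  exact: (smoothM oU s1 (smoothM oU fi gi)).
- under eq_fun do rewrite ImM.
  exact: (smoothD oU (smoothM oU fr gi) (smoothM oU fi gr)).
Qed.

Lemma cderiv_cst (c : C) x : cderiv (fun=> c) x = 0.
Proof. by rewrite /cderiv /clift !derive1E !derive_cst. Qed.

Lemma cderivM (U : set R) (f g : R -> C) x :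
  csmooth U f -> csmooth U g -> U x ->
  cderiv (fun y => f y * g y) x = cderiv f x * g x + f x * cderiv g x.
Proof.
move=> [fr fi] [gr gi] Ux.
have dfr := @smooth_derivable R R U _ x 1 fr Ux; have dfi := @smooth_derivable R R U _ x 1 fi Ux.
have dgr := @smooth_derivable R R U _ x 1 gr Ux; have dgi := @smooth_derivable R R U _ x 1 gi Ux.
have dM (u v : R -> R) : derivable u x 1 -> derivable v x 1 ->
    derivable (fun y => u y * v y) x 1 /\
    'D_1 (fun y => u y * v y) x = u x * 'D_1 v x + v x * 'D_1 u x.
  by move=> du dv; split; [exact: (derivableM du dv) | exact: (deriveM du dv)].
have dN (u : R -> R) : derivable u x 1 -> derivable (fun y => -1 * u y) x 1 /\
    'D_1 (fun y => -1 * u y) x = - 'D_1 u x.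
  move=> du; have [? ->] := dM (cst (-1)) u (derivable_cst _ _ _) du.
  by rewrite derive_cst mulr0 addr0 mulN1r; split.
have dD (u v : R -> R) : derivable u x 1 -> derivable v x 1 ->
    'D_1 (fun y => u y + v y) x = 'D_1 u x + 'D_1 v x.
  by move=> du dv; exact: (deriveD du dv).
rewrite /cderiv /clift !derive1E.
under eq_fun do rewrite ReM.
under [in X in _ +i* X]eq_fun do rewrite ImM.
have [d1 e1] := dM _ _ dfr dgr; have [d2 e2] := dM _ _ dfi dgi.
have [d3 e3] := dM _ _ dfr dgi; have [d4 e4] := dM _ _ dfi dgr.
have [d5 e5] := dN _ d2.
rewrite (dD _ _ d1 d5) (dD _ _ d3 d4) e1 e5 e2 e3 e4.
case: (f x) (g x) => [fx fy] [gx gy] /=.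
by simpc; apply/eqP; rewrite eq_complex /=; apply/andP; split; apply/eqP; ring.
Qed.

Lemma invmx_uniq n (A B : 'M[C]_n) : A *m B = 1%:M -> invmx A = B.
Proof.
move=> AB; have [uA _] := mulmx1_unit AB.
by rewrite -[LHS]mulmx1 -AB mulKmx.
Qed.

Lemma mxsmooth_block {V : normedModType R} n1 n2 (U : set V)
    (A : V -> 'M[C]_n1) (B : V -> 'M[C]_n2) :
  mxsmooth U A -> mxsmooth U B ->
  mxsmooth U (fun x => block_mx (A x) 0 0 (B x)).
Proof.
move=> sA sB i j; rewrite -(splitK i) -(splitK j).
case: (fintype.split i) => a; case: (fintype.split j) => b /=.
- by under eq_fun do rewrite block_mxEul; exact: sA.
- by under eq_fun do rewrite block_mxEur mxE; exact: csmooth_cst.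
- by under eq_fun do rewrite block_mxEdl mxE; exact: csmooth_cst.
- by under eq_fun do rewrite block_mxEdr; exact: sB.
Qed.

Lemma mxderiv_block n1 n2 (A : R -> 'M[C]_n1) (B : R -> 'M[C]_n2) x :
  mxderiv (fun y => block_mx (A y) 0 0 (B y)) x =
  block_mx (mxderiv A x) 0 0 (mxderiv B x).
Proof.
apply/matrixP => i j; rewrite [LHS]mxE -(splitK i) -(splitK j).
case: (fintype.split i) => a; case: (fintype.split j) => b /=.
- rewrite block_mxEul mxE; congr clift; apply/funext => y.
  by rewrite block_mxEul.
- rewrite block_mxEur mxE -(cderiv_cst 0 x); congr clift; apply/funext => y.
  by rewrite block_mxEur mxE.
- rewrite block_mxEdl mxE -(cderiv_cst 0 x); congr clift; apply/funext => y.
  by rewrite block_mxEdl mxE.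
- rewrite block_mxEdr mxE; congr clift; apply/funext => y.
  by rewrite block_mxEdr.
Qed.

Lemma mxsmoothD {V : normedModType R} m n (U : set V) (A B : V -> 'M[C]_(m, n)) :
  open U -> mxsmooth U A -> mxsmooth U B -> mxsmooth U (fun x => A x + B x).
Proof.
by move=> oU sA sB i j; under eq_fun do rewrite mxE; exact: csmoothD.
Qed.

Lemma mxsmooth_tens {V : normedModType R} n1 n2 (U : set V)
    (A : V -> 'M[C]_n1) (B : V -> 'M[C]_n2) :
  open U -> mxsmooth U A -> mxsmooth U B -> mxsmooth U (fun x => A x *t B x).
Proof.
by move=> oU sA sB i j; under eq_fun do rewrite mxE; exact: csmoothM.
Qed.

Lemma mxsmooth_cst {V : normedModType R} m n (U : set V) (A : 'M[C]_(m, n)) :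
  mxsmooth U (fun=> A).
Proof. by move=> i j; exact: csmooth_cst. Qed.

Lemma mxderiv_tens n1 n2 (U : set R) (A : R -> 'M[C]_n1) (B : R -> 'M[C]_n2) x :
  mxsmooth U A -> mxsmooth U B -> U x ->
  mxderiv (fun y => A y *t B y) x = mxderiv A x *t B x + A x *t mxderiv B x.
Proof.
move=> sA sB Ux; apply/matrixP => i j; rewrite !mxE.
rewrite -(cderivM (sA _ _) (sB _ _) Ux); congr clift; apply/funext => y.
by rewrite mxE.
Qed.

Lemma tensmxDl m n p q (A A' : 'M[C]_(m, n)) (B : 'M[C]_(p, q)) :
  (A + A') *t B = A *t B + A' *t B.
Proof. by apply/matrixP => i j; rewrite !mxE mulrDl. Qed.

Lemma tensmxDr m n p q (A : 'M[C]_(m, n)) (B B' : 'M[C]_(p, q)) :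
  A *t (B + B') = A *t B + A *t B'.
Proof. by apply/matrixP => i j; rewrite !mxE mulrDr. Qed.

Lemma tensmx11 m n : 1%:M *t 1%:M = 1%:M :> 'M[C]_(m * n).
Proof.
apply/matrixP => i j.
case: (mxtens_indexP i) => i0 i1; case: (mxtens_indexP j) => j0 j1.
rewrite tensmxE !mxE -natrM mulnb (can_eq (@mxtens_indexK _ _)) xpair_eqE.
by [].
Qed.

Lemma tens_gauge m n (P G G' A : 'M[C]_m) (Q H H' B : 'M[C]_n) :
  P *m G = 1%:M -> Q *m H = 1%:M ->
  (P *m A *m G + P *m G') *t 1%:M + 1%:M *t (Q *m B *m H + Q *m H') =
  (P *t Q) *m (A *t 1%:M + 1%:M *t B) *m (G *t H) +
  (P *t Q) *m (G' *t H + G *t H').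
Proof.
move=> PG QH; rewrite !(mulmxDr, mulmxDl, tensmx_mul) !(tensmxDl, tensmxDr).
by rewrite !mulmx1 PG QH [RHS]addrACA.
Qed.

End ComplexCalculus.

Section Bundles.
Context {R : realType}.
Local Notation C := R[i].

Definition circle_open (U : set R) : Prop :=
  open U /\ (forall x, U (x + 1) <-> U x).

Definition periodic_on {T : Type} (U : set R) (f : R -> T) : Prop :=
  forall x, U x -> f (x + 1) = f x.

(* A complex vector bundle over S^1 (connected, so of constant rank) given by
   its transition functions.  In the fibre over x the coordinates of a vector
   satisfy u_i = g_ij(x) u_j. *)
Record vbundle : Type := VBundle {
  vb_idx : Type;
  vb_rank : nat;
  vb_U : vb_idx -> set R;
  vb_g : vb_idx -> vb_idx -> R -> 'M[C]_vb_rank;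
  vb_open : forall i, circle_open (vb_U i);
  vb_cover : forall x, exists i, vb_U i x;
  vb_periodic : forall i j, periodic_on (vb_U i `&` vb_U j) (vb_g i j);
  vb_smooth : forall i j, mxsmooth (vb_U i `&` vb_U j) (vb_g i j);
  vb_unit : forall i x, vb_U i x -> vb_g i i x = 1%:M;
  vb_cocycle : forall i j k x, vb_U i x -> vb_U j x -> vb_U k x ->
    vb_g i j x *m vb_g j k x = vb_g i k x }.

(* d + A_i in the i-th trivialization, with A_i = cn_A i x dx. *)
Record conn (E : vbundle) : Type := Conn {
  cn_A : vb_idx E -> R -> 'M[C]_(vb_rank E);
  cn_periodic : forall i, periodic_on (vb_U i) (cn_A i);
  cn_smooth : forall i, mxsmooth (vb_U i) (cn_A i);
  cn_gauge : forall i j x, vb_U i x -> vb_U j x ->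
    cn_A j x = invmx (vb_g i j x) *m cn_A i x *m vb_g i j x +
               invmx (vb_g i j x) *m mxderiv (vb_g i j) x }.

Definition conn_eq (E : vbundle) (a b : conn E) : Prop :=
  forall i x, vb_U i x -> cn_A a i x = cn_A b i x.

Lemma circle_openI (U W : set R) :
  circle_open U -> circle_open W -> circle_open (U `&` W).
Proof.
move=> [oU pU] [oW pW]; split; first exact: openI.
by move=> x; split=> -[/pU ? /pW ?]; split.
Qed.

Lemma vb_gK (E : vbundle) (i j : vb_idx E) x : vb_U i x -> vb_U j x ->
  vb_g i j x *m vb_g j i x = 1%:M.
Proof. by move=> Ui Uj; rewrite vb_cocycle// vb_unit. Qed.

Lemma vb_inv (E : vbundle) (i j : vb_idx E) x : vb_U i x -> vb_U j x ->
  invmx (vb_g i j x) = vb_g j i x.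
Proof. by move=> Ui Uj; apply: invmx_uniq; exact: vb_gK. Qed.

Program Definition dsum (E F : vbundle) : vbundle := {|
  vb_idx := (vb_idx E * vb_idx F)%type;
  vb_rank := (vb_rank E + vb_rank F)%N;
  vb_U := fun i => vb_U i.1 `&` vb_U i.2;
  vb_g := fun i j x => block_mx (vb_g i.1 j.1 x) 0 0 (vb_g i.2 j.2 x) |}.
Next Obligation. by move=> E F [i k]; apply: circle_openI; exact: vb_open. Qed.
Next Obligation.
by move=> E F x; have [i ?] := vb_cover E x; have [j ?] := vb_cover F x; exists (i, j).
Qed.
Next Obligation.
by move=> E F [i k] [j l] x /= [[? ?] [? ?]]; rewrite !vb_periodic.
Qed.
Next Obligation.
move=> E F [i k] [j l] /=; apply: mxsmooth_block.
- by apply: mxsmooth_sub (vb_smooth i j) => x [[? ?] [? ?]].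
- by apply: mxsmooth_sub (vb_smooth k l) => x [[? ?] [? ?]].
Qed.
Next Obligation.
by move=> E F [i k] x /= [? ?]; rewrite !vb_unit// -scalar_mx_block.
Qed.
Next Obligation.
move=> E F [i i'] [j j'] [k k'] x /= [? ?] [? ?] [? ?].
by rewrite mulmx_block !(mulmx0, mul0mx, addr0, add0r) !vb_cocycle.
Qed.

Program Definition dsum_conn (E F : vbundle) (a : conn E) (b : conn F) :
    conn (dsum E F) := {|
  cn_A := fun i x => block_mx (cn_A a i.1 x) 0 0 (cn_A b i.2 x) |}.
Next Obligation. by move=> E F a b [i k] x /= [? ?]; rewrite !cn_periodic. Qed.
Next Obligation.
move=> E F a b [i k] /=; apply: mxsmooth_block.
- by apply: mxsmooth_sub (cn_smooth a i) => x [].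
- by apply: mxsmooth_sub (cn_smooth b k) => x [].
Qed.
Next Obligation.
move=> E F a b [i i'] [j j'] x /= [Ui Ui'] [Uj Uj'].
rewrite (@invmx_uniq _ _ _ (block_mx (vb_g j i x) 0 0 (vb_g j' i' x))); last first.
  by rewrite mulmx_block !(mulmx0, mul0mx, addr0, add0r) !vb_gK// -scalar_mx_block.
rewrite mxderiv_block !mulmx_block !(mulmx0, mul0mx, addr0, add0r).
rewrite add_block_mx !addr0 (cn_gauge a Ui Uj) (cn_gauge b Ui' Uj').
by rewrite !vb_inv.
Qed.

Program Definition tens (E F : vbundle) : vbundle := {|
  vb_idx := (vb_idx E * vb_idx F)%type;
  vb_rank := (vb_rank E * vb_rank F)%N;
  vb_U := fun i => vb_U i.1 `&` vb_U i.2;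
  vb_g := fun i j x => vb_g i.1 j.1 x *t vb_g i.2 j.2 x |}.
Next Obligation. by move=> E F [i k]; apply: circle_openI; exact: vb_open. Qed.
Next Obligation.
by move=> E F x; have [i ?] := vb_cover E x; have [j ?] := vb_cover F x; exists (i, j).
Qed.
Next Obligation.
by move=> E F [i k] [j l] x /= [[? ?] [? ?]]; rewrite !vb_periodic.
Qed.
Next Obligation.
move=> E F [i k] [j l] /=; apply: mxsmooth_tens.
- by do !apply: openI; apply vb_open.
- by apply: mxsmooth_sub (vb_smooth i j) => x [[? ?] [? ?]].
- by apply: mxsmooth_sub (vb_smooth k l) => x [[? ?] [? ?]].
Qed.
Next Obligation.
by move=> E F [i k] x /= [? ?]; rewrite !vb_unit// tensmx11.
Qed.
Next Obligation.
move=> E F [i i'] [j j'] [k k'] x /= [? ?] [? ?] [? ?].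
by rewrite tensmx_mul !vb_cocycle.
Qed.

Program Definition tens_conn (E F : vbundle) (a : conn E) (b : conn F) :
    conn (tens E F) := {|
  cn_A := fun i x => cn_A a i.1 x *t 1%:M + 1%:M *t cn_A b i.2 x |}.
Next Obligation. by move=> E F a b [i k] x /= [? ?]; rewrite !cn_periodic. Qed.
Next Obligation.
move=> E F a b [i k] /=.
have oU : open (vb_U i `&` vb_U k) by apply: openI; apply vb_open.
have sa : mxsmooth (vb_U i `&` vb_U k) (cn_A a i).
  by apply: mxsmooth_sub (cn_smooth a i) => x [].
have sb : mxsmooth (vb_U i `&` vb_U k) (cn_A b k).
  by apply: mxsmooth_sub (cn_smooth b k) => x [].
apply: (mxsmoothD oU).
- exact: (mxsmooth_tens oU sa (mxsmooth_cst _ _)).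
- exact: (mxsmooth_tens oU (mxsmooth_cst _ _) sb).
Qed.
Next Obligation.
move=> E F a b [i i'] [j j'] x /= [Ui Ui'] [Uj Uj'].
have gK := vb_gK Uj Ui; have hK := vb_gK Uj' Ui'.
rewrite (@invmx_uniq _ _ _ (vb_g j i x *t vb_g j' i' x)); last first.
  by rewrite tensmx_mul !vb_gK// tensmx11.
rewrite (cn_gauge a Ui Uj) (cn_gauge b Ui' Uj') (vb_inv Ui Uj) (vb_inv Ui' Uj').
rewrite (@mxderiv_tens _ _ _ ((vb_U i `&` vb_U j) `&` (vb_U i' `&` vb_U j')))//.
- exact: tens_gauge.
- by apply: mxsmooth_sub (vb_smooth i j) => y [].
- by apply: mxsmooth_sub (vb_smooth i' j') => y [].
Qed.

Program Definition trivial_vb (n : nat) : vbundle := {|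
  vb_idx := unit;
  vb_rank := n;
  vb_U := fun=> setT;
  vb_g := fun _ _ _ => 1%:M |}.
Next Obligation. by move=> n i; split; [exact: openT | ]. Qed.
Next Obligation. by move=> n x; exists tt. Qed.
Next Obligation. by []. Qed.
Next Obligation. by move=> n i j; exact: mxsmooth_cst. Qed.
Next Obligation. by []. Qed.
Next Obligation. by move=> *; rewrite mulmx1. Qed.

Program Definition trivial_conn (n : nat) : conn (trivial_vb n) := {|
  cn_A := fun _ _ => 0 |}.
Next Obligation. by []. Qed.
Next Obligation. by move=> n i; exact: mxsmooth_cst. Qed.
Next Obligation.
move=> n i j x ? ? /=; rewrite mulmx0 mul0mx add0r.
rewrite (_ : mxderiv _ _ = 0) ?mulmx0//.
by apply/matrixP => k l; rewrite [LHS]mxE [RHS]mxE; exact: cderiv_cst.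
Qed.

Definition vbc : Type := {E : vbundle & conn E}.

(* A bundle isomorphism phi : F -> E over the identity with phi^*a = b:
   u_i = h_ij v_j in coordinates. *)
Definition vbc_iso (E F : vbc) : Prop :=
  let: existT E a := E in let: existT F b := F in
  exists (h : vb_idx E -> vb_idx F -> R -> 'M[C]_(vb_rank E, vb_rank F))
         (h' : vb_idx E -> vb_idx F -> R -> 'M[C]_(vb_rank F, vb_rank E)),
  [/\ forall i j, periodic_on (vb_U i `&` vb_U j) (h i j),
      forall i j, mxsmooth (vb_U i `&` vb_U j) (h i j),
      forall i j x, vb_U i x -> vb_U j x ->
        h i j x *m h' i j x = 1%:M /\ h' i j x *m h i j x = 1%:M,
      forall i k j l x, vb_U i x -> vb_U k x -> vb_U j x -> vb_U l x ->
        h i j x = vb_g i k x *m h k l x *m vb_g l j x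
    & forall i j x, vb_U i x -> vb_U j x ->
        cn_A b j x = h' i j x *m cn_A a i x *m h i j x +
                     h' i j x *m mxderiv (h i j) x].

(* Piecewise smooth in s: [0, 1] is cut into finitely many closed intervals,
   on each of which A_{s,i}(x) is the restriction of a function smooth in
   (s, x) in R x U_i.  Values for s outside [0, 1] are irrelevant. *)
Definition piecewise_smooth (E : vbundle) (a : R -> conn E) : Prop :=
  exists ss : seq R,
  [/\ path <%R 0 ss, last 0 ss = 1
    & forall k, (k < size ss)%N ->
      exists B : vb_idx E -> R * R -> 'M[C]_(vb_rank E),
        (forall i, mxsmooth [set sx : R * R | vb_U i sx.2] (B i)) /\
        (forall i s x, nth 0 (0 :: ss) k <= s <= nth 0 ss k -> vb_U i x ->
           cn_A (a s) i x = B i (s, x))].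

End Bundles.

Arguments vbundle : clear implicits.
Arguments vbc : clear implicits.
Arguments trivial_vb : clear implicits.
Arguments trivial_conn : clear implicits.

Section LoopSpace.
Context {R : realType}.
Local Notation C := R[i].
Local Notation vect := (R -> R).

(* The lifts of a smooth map S^1 -> S^1. *)
Definition loop (g : R -> R) : Prop :=
  smooth setT g /\ exists k : int, forall t, g (t + 1) = g t + k%:~R.

(* T_gamma LM = sections of gamma^* TS^1 = C^infinity(S^1, R). *)
Definition tangent (v : vect) : Prop :=
  smooth setT v /\ forall t, v (t + 1) = v t.

Definition shift (e : R) (g : R -> R) (v : vect) : R -> R :=
  fun t => g t + e * v t.

(* A possibly infinite sum of forms of distinct degrees: the value at gamma on
   a list of k tangent vectors is that of the component of degree k. *)
Definition lform : Type := (R -> R) -> seq vect -> C.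

Definition multilinear (w : lform) : Prop :=
  forall g s1 s2 u v (c : R), loop g -> List.Forall tangent s1 -> List.Forall tangent s2 ->
    tangent u -> tangent v ->
    w g (s1 ++ (fun t => c * u t + v t) :: s2) =
      c%:C * w g (s1 ++ u :: s2) + w g (s1 ++ v :: s2).

Definition alternate (w : lform) : Prop :=
  forall g s1 s2 s3 v, loop g -> List.Forall tangent s1 -> List.Forall tangent s2 ->
    List.Forall tangent s3 -> tangent v ->
    w g (s1 ++ v :: s2 ++ v :: s3) = 0.

(* Directional derivative; the direction becomes the first argument. *)
Definition ldir (w : lform) : lform := fun g vs =>
  if vs is h :: vs' then cderiv (fun e => w (shift e g h) vs') 0 else 0.

(* Basic neighbourhoods of the Frechet topology of C^infinity. *)
Definition close (k : nat) (dl : R) (f g : R -> R) : Prop :=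
  forall j t, (j <= k)%N -> `|derive1n j f t - derive1n j g t| < dl.

(* Smoothness in the sense of calculus in Frechet spaces: all iterated
   directional derivatives exist and are jointly continuous. *)
Definition lsmooth (w : lform) : Prop :=
  forall m g vs, loop g -> List.Forall tangent vs ->
    (forall h, tangent h ->
       derivable (fun e : R => complex.Re (iter m ldir w (shift e g h) vs)) 0 1 /\
       derivable (fun e : R => complex.Im (iter m ldir w (shift e g h) vs)) 0 1) /\
    (forall e : R, 0 < e -> exists k (dl : R), 0 < dl /\
       forall g' vs', loop g' -> List.Forall tangent vs' -> size vs' = size vs ->
         close k dl g' g ->
         (forall r, (r < size vs)%N ->
            close k dl (nth (fun=> 0) vs' r) (nth (fun=> 0) vs r)) ->
         `|iter m ldir w g' vs' - iter m ldir w g vs| < e%:C).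

(* An element of Omega(LM); the first clause says that it does not depend on
   the lift of the loop. *)
Definition is_lform (w : lform) : Prop :=
  [/\ forall g vs, loop g -> List.Forall tangent vs -> w (fun t => g t + 1) vs = w g vs,
      multilinear w, alternate w & lsmooth w].

Definition even_form (w : lform) : Prop :=
  forall g vs, loop g -> List.Forall tangent vs -> odd (size vs) -> w g vs = 0.

(* sum_r (-1)^r v_r(w(v_0, .., omit v_r, ..)): constant vector fields commute,
   so there are no bracket terms. *)
Definition dform (w : lform) : lform := fun g vs =>
  \sum_(r < size vs)
    (-1) ^+ r * ldir w g (nth (fun=> 0) vs r :: take r vs ++ drop r.+1 vs).

Definition iota_form (w : lform) : lform := fun g vs => w g (derive1 g :: vs).

Definition invariant_form (w : lform) : Prop :=
  forall g vs, loop g -> List.Forall tangent vs ->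
    dform (iota_form w) g vs + iota_form (dform w) g vs = 0.

(* b is in (d + iota) Omega^even_{S^1}(LM). *)
Definition dexact (b : lform) : Prop :=
  exists w, [/\ is_lform w, even_form w, invariant_form w
    & forall g vs, loop g -> List.Forall tangent vs ->
        b g vs = dform w g vs + iota_form w g vs].

End LoopSpace.

Arguments lform : clear implicits.

(* Matrix-valued alternating forms on T, as functions on lists of vectors. *)
Section MatrixForms.
Context {R : realType} {n : nat}.
Local Notation C := R[i].
Local Notation mform T := (seq T -> 'M[C]_n).

Definition form0 {T} (A : 'M[C]_n) : mform T :=
  fun vs => if vs is [::] then A else 0.

(* iota_v(al /\ be) = iota_v al /\ be + (-1)^|al| al /\ iota_v be. *)
Fixpoint wedge {T} (al be : mform T) (vs : seq T) {struct vs} : 'M[C]_n :=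
  if vs is v :: vs' then
    wedge (fun us => al (v :: us)) be vs' +
    wedge (fun us => (-1) ^+ size us *: al us) (fun us => be (v :: us)) vs'
  else al [::] *m be [::].

(* The 1-form a(x) dx on S^1 at x. *)
Definition form1 (a : R -> 'M[C]_n) (x : R) : mform R :=
  fun us => if us is [:: u] then u%:C *: a x else 0.

Definition dform1 (a : R -> 'M[C]_n) (x : R) : mform R :=
  fun us => if us is [:: u; v] then
    u%:C *: mxderiv (fun y => form1 a y [:: v]) x -
    v%:C *: mxderiv (fun y => form1 a y [:: u]) x else 0.

Definition curv (a : R -> 'M[C]_n) (x : R) : mform R :=
  fun us => dform1 a x us + wedge (form1 a x) (form1 a x) us.

(* w(t), the pullback of w under gamma |-> gamma(t), at the loop g. *)
Definition ev_pull (w : R -> mform R) (t : R) (g : R -> R) : mform (R -> R) :=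
  fun vs => w (g t) [seq v t | v : R -> R <- vs].

(* int_{a <= t_1 <= ... <= t_k <= b} F(t_1, .., t_k) dt_1 ... dt_k *)
Fixpoint simplex_int (k : nat) (a b : R) (F : seq R -> 'M[C]_n) : 'M[C]_n :=
  if k is k'.+1 then
    mxint a b (fun t => simplex_int k' t b (fun ts => F (t :: ts)))
  else F [::].

End MatrixForms.

Section BCS.
Context {R : realType} (E : vbundle R) (a : R -> conn E).
Local Notation C := R[i].
Local Notation n := (vb_rank E).
Local Notation mform := (seq (R -> R) -> 'M[C]_n).

(* The indices r = 1, .., p and j = 1, .., n_r of the text start at 0 here. *)
Variables (p' : nat) (i : 'I_p'.+1 -> vb_idx E).
Local Notation p := p'.+1.

(* N(p, U) with U = (U_(i 0), .., U_(i (p-1))). *)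
Definition inN (g : R -> R) : Prop :=
  forall (r : 'I_p) t, r%:R / p%:R <= t <= r.+1%:R / p%:R -> vb_U (i r) (g t).

(* S for (n_1, .., n_p); the n_r are bounded by N, see [BCS_integrand]. *)
Definition Sset (N : nat) (nn : {ffun 'I_p -> 'I_N}) : {set 'I_p * 'I_N} :=
  finset (fun x : 'I_p * 'I_N => (x.2 < nn x.1)%N).

Definition BCS_X (s : R) (N : nat) (J : {set 'I_p * 'I_N}) (qm rj : 'I_p * 'I_N)
    (t : R) (g : R -> R) : mform :=
  let A := fun s x => cn_A (a s) (i rj.1) x in
  if rj \in J then ev_pull (curv (A s)) t g
  else if rj == qm then ev_pull (form1 (fun x => mxderiv (A^~ x) s)) t g
  else fun vs => ev_pull (form1 (A s)) t g (derive1 g :: vs).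

Definition BCS_I (s : R) (N : nat) (nn : {ffun 'I_p -> 'I_N})
    (J : {set 'I_p * 'I_N}) (qm : 'I_p * 'I_N) (r : 'I_p) (g : R -> R) : mform :=
  fun vs => simplex_int (nn r) (r%:R / p%:R) (r.+1%:R / p%:R) (fun ts =>
    (\big[wedge/form0 1%:M]_(j < N | (j < nn r)%N) BCS_X s J qm (r, j) ts`_j g) vs).

(* g_{i_p,i_1}(gamma(0)) /\ I_1 /\ ... /\ g_{i_{p-1},i_p}(gamma((p-1)/p)) /\ I_p;
   [ord_pred] is the cyclic predecessor. *)
Definition BCS_term (s : R) (N : nat) (nn : {ffun 'I_p -> 'I_N})
    (J : {set 'I_p * 'I_N}) (qm : 'I_p * 'I_N) (g : R -> R) : mform :=
  \big[wedge/form0 1%:M]_(r < p)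
    wedge (form0 (vb_g (i (ord_pred r)) (i r) (g (r%:R / p%:R))))
          (BCS_I s nn J qm r g).

(* The sum over all n_1, .., n_p >= 0 is the limit of the sums over
   n_1, .., n_p < N (the series converges absolutely). *)
Definition BCS_integrand (k : nat) (g : R -> R) (vs : seq (R -> R)) (s : R) :
    'M[C]_n :=
  mxlim (fun N => \sum_(nn : {ffun 'I_p -> 'I_N})
    \sum_(J : {set 'I_p * 'I_N} | (J \subset Sset nn) && (#|J| == k))
      \sum_(qm in Sset nn :\: J) BCS_term s nn J qm g vs).

(* The total form: BCS_(2k+1) on 2k+1 vectors. *)
Definition BCS_local (g : R -> R) (vs : seq (R -> R)) : C :=
  if odd (size vs) then
    \tr (mxint 0 1 (BCS_integrand (size vs)./2 g vs))
  else 0.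

End BCS.

(* b is the form BCS(nabla_s): it is given on each N(p, U) by the local
   formula.  The N(p, U) cover LM. *)
Definition is_BCS {R : realType} (E : vbundle R) (a : R -> conn E) (b : lform R) : Prop :=
  forall (p' : nat) (i : 'I_p'.+1 -> vb_idx E) (g : R -> R) (vs : seq (R -> R)),
    loop g -> List.Forall tangent vs -> inN i g -> b g vs = BCS_local a i g vs.

Definition BCS_equiv {R : realType} (E : vbundle R) (a0 a1 : conn E) : Prop :=
  exists (a : R -> conn E) (b : lform R),
    [/\ piecewise_smooth a, conn_eq (a 0) a0, conn_eq (a 1) a1, is_BCS a b
      & dexact b].

Section Monoid.
Context {R : realType}.

Inductive vbc_step : vbc R -> vbc R -> Prop :=
| Step_iso E F of vbc_iso E F : vbc_step E F
| Step_BCS (E : vbundle R) (a b : conn E) of BCS_equiv a b :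
    vbc_step (existT _ E a) (existT _ E b).

(* BCS-equivalence is an equivalence relation compatible with isomorphisms, so
   isomorphism classes of BCS-equivalence classes are the classes of the
   equivalence relation generated by both. *)
Definition vbc_equiv : vbc R -> vbc R -> Prop :=
  clos_refl_sym_trans (vbc R) vbc_step.

Definition vbc_class (E : vbc R) : set (vbc R) := [set F | vbc_equiv E F].

Definition MS1 : Type := {P : set (vbc R) | exists E, P = vbc_class E}.

Definition vbc_add (E F : vbc R) : vbc R :=
  existT _ (dsum (projT1 E) (projT1 F)) (dsum_conn (projT2 E) (projT2 F)).

Definition vbc_mul (E F : vbc R) : vbc R :=
  existT _ (tens (projT1 E) (projT1 F)) (tens_conn (projT2 E) (projT2 F)).

(* For classes P and Q, all that is equivalent to op E F for some E in P and F
   in Q: the class of op E F, since op is well defined on classes. *)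
Definition class_op (op : vbc R -> vbc R -> vbc R) (P Q : set (vbc R)) : set (vbc R) :=
  [set G | exists E F, [/\ P E, Q F & vbc_equiv (op E F) G]].

Definition class_add := class_op vbc_add.
Definition class_mul := class_op vbc_mul.
Definition class0 : set (vbc R) := vbc_class (existT _ _ (trivial_conn R 0)).
Definition class1 : set (vbc R) := vbc_class (existT _ _ (trivial_conn R 1)).

End Monoid.

Arguments MS1 : clear implicits.
Arguments class0 : clear implicits.
Arguments class1 : clear implicits.

Section UnorderedTuples.
Context (R : realType).

(* The subgroup {2 k pi i : k an integer} of C. *)
Definition periods : {pred R[i]} :=
  [pred z | `[< exists k : int, z = 0 +i* (2 * k%:~R * pi) >]].

Lemma periods_zmod_closed : zmod_closed periods.
Proof.
split; first by apply/asboolP; exists 0; rewrite mulr0 mul0r.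
move=> _ _ /asboolP[k ->] /asboolP[l ->]; apply/asboolP; exists (k - l).
by rewrite intrB; simpc; congr (_ +i* _); rewrite ?subr0//; ring.
Qed.

HB.instance Definition _ := GRing.isZmodClosed.Build R[i] periods periods_zmod_closed.

Definition CmodZ : Type := Quotient.quot periods.
HB.instance Definition _ := GRing.Zmodule.on CmodZ.

(* [seq CmodZ] is the disjoint union over n of the n-tuples, and two sequences
   are [perm_eq] iff they have the same length n and differ by a reordering in
   Sigma_n (see [tuple_permP]). *)
Definition perm_equiv : equiv_rel (seq CmodZ) :=
  EquivRel perm_eq (@perm_refl _) (@perm_sym _) (@perm_trans _).

Local Open Scope quotient_scope.

Definition utuples : Type := {eq_quot perm_equiv}.

Definition utuple (s : seq CmodZ) : utuples := \pi_({eq_quot perm_equiv}) s.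

End UnorderedTuples.

(* Main.v *)
(* On the circle the curvature vanishes and a connection d + A is determined, up
   to isomorphism, by its monodromy H up to conjugation.

   BCS-equivalent connections have the same traces tr H^k.  At the loop
   t |-> k t, the transport is the sum of the iterated integrals of A, and its
   derivative in s is the upper right block of the transport of
   [[A_s, A'_s], [0, A_s]]; so the degree 1 part of BCS, contracted with the
   velocity, is tr H_1^k - tr H_0^k.  A (d + iota)-exact form vanishes there,
   because the invariance under rotation makes the degree 0 part constant along
   the rotation of the loop.

   Conversely, H is triangular in some basis, and a gauge transformation whose
   entries are exponential polynomials turns the connection into a triangular
   one with constant diagonal l_1, .., l_n, where the exp(l_i) are the
   eigenvalues of H.  Along the segment from it to its diagonal part every term
   of BCS has a strictly triangular factor A', so BCS = 0.  Hence (E, nabla) is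
   equivalent to the sum of the line bundles d + l_i dx.

   The power sums tr H^k determine the multiset of the exp(l_i), which is a
   multiset in C^* = C/Z, and direct sums and tensor products act on the
   eigenvalues of the monodromy by concatenation and by products. *)
Require Import Defs.
From mathcomp Require Import all_boot all_order all_algebra generic_quotient.
From mathcomp Require Import all_classical all_reals all_analysis.
From mathcomp Require Import measurable_realfun complex mxtens ring lra.
Import numFieldNormedType.Exports.
Import Order.TTheory GRing.Theory Num.Theory.

Set Implicit Arguments.
Unset Strict Implicit.
Unset Printing Implicit Defensive.

Local Open Scope classical_set_scope.
Local Open Scope complex_scope.
Local Open Scope ring_scope.

(** Only the degree 1 part of BCS enters the trace argument. Its truncation to [n_1, .., n_p < N] is
    exactly the derivative in s of a truncated transport product: A' acts as a square-zero
    perturbation, and the choice of [(q, m)] in the formula is Leibniz' rule. Each truncation is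
    therefore integrated over s by the fundamental theorem, and dominated convergence passes to the
    limit. In this way the parallel transport itself is never differentiated in s, and flat frames
    may be chosen for each s separately, although the path is only piecewise smooth.

    In the other direction, a gauge making the connection constant would call for a logarithm of the
    matrix H. Asking only for a triangular matrix with constant diagonal reduces this to scalar
    logarithms of the eigenvalues and to equations [z (x + 1) - z x = f x], which exponential
    polynomials solve.

    Equivalence being generated by two kinds of steps, all comparisons go through one invariant, the
    eigenvalue multiset encoded by power sums: each step preserves it, and it is complete because
    every bundle is joined to its diagonal form. *)

(** * Matrix-valued functions: entrywise regularity and derivatives *)

Section MatrixFunctions.
Context {R : realType}.
Local Notation C := R[i].

Lemma complexReD (z w : C) : complex.Re (z + w) = complex.Re z + complex.Re w.
Proof. by case: z w => [? ?] [? ?]. Qed.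

Lemma complexImD (z w : C) : complex.Im (z + w) = complex.Im z + complex.Im w.
Proof. by case: z w => [? ?] [? ?]. Qed.

Section Closure.
Context {T : Type} (Q : (T -> R) -> Prop).
Hypothesis Qcst : forall c, Q (fun=> c).
Hypothesis QD : forall f g, Q f -> Q g -> Q (fun x => f x + g x).
Hypothesis QM : forall f g, Q f -> Q g -> Q (fun x => f x * g x).

(** The property [Q] of real functions is kept abstract because smoothness and continuity obey the
    same closure rules; [call] and [mxall] impose it on real and imaginary parts. *)
Definition call (f : T -> C) : Prop :=
  Q (fun x => complex.Re (f x)) /\ Q (fun x => complex.Im (f x)).

Definition mxall {m n} (F : T -> 'M[C]_(m, n)) : Prop :=
  forall i j, call (fun x => F x i j).

Lemma call_cst c : call (fun=> c).
Proof. by split. Qed.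

Lemma callD f g : call f -> call g -> call (fun x => f x + g x).
Proof.
move=> [fr fi] [gr gi]; split.
- by under eq_fun do rewrite complexReD; exact: QD.
- by under eq_fun do rewrite complexImD; exact: QD.
Qed.

Lemma callM f g : call f -> call g -> call (fun x => f x * g x).
Proof.
move=> [fr fi] [gr gi]; split.
- under eq_fun do rewrite Defs.ReM.
  by apply: QD; [|apply: (QM (Qcst (-1)))]; exact: QM.
- by under eq_fun do rewrite Defs.ImM; apply: QD; exact: QM.
Qed.

Lemma call_sum I (r : seq I) P (f : I -> T -> C) :
  (forall i, call (f i)) -> call (fun x => \sum_(i <- r | P i) f i x).
Proof.
move=> cf; elim: r => [|i r IH].
  by under eq_fun do rewrite big_nil; exact: call_cst.
under eq_fun do rewrite big_cons.
by case: (P i) => //; exact: callD.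
Qed.

Lemma mxallD m n (F G : T -> 'M[C]_(m, n)) :
  mxall F -> mxall G -> mxall (fun x => F x + G x).
Proof. by move=> qF qG i j; under eq_fun do rewrite mxE; exact: callD. Qed.

Lemma mxallM m n p (F : T -> 'M[C]_(m, n)) (G : T -> 'M[C]_(n, p)) :
  mxall F -> mxall G -> mxall (fun x => F x *m G x).
Proof.
move=> qF qG i j; under eq_fun do rewrite mxE.
by apply: call_sum => k; exact: callM.
Qed.

Lemma mxallZ m n (f : T -> C) (G : T -> 'M[C]_(m, n)) :
  call f -> mxall G -> mxall (fun x => f x *: G x).
Proof. by move=> qf qG i j; under eq_fun do rewrite mxE; exact: callM. Qed.

Lemma mxallN m n (F : T -> 'M[C]_(m, n)) : mxall F -> mxall (fun x => - F x).
Proof.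
move=> qF; under eq_fun do rewrite -scaleN1r.
by apply: mxallZ => //; exact: call_cst.
Qed.

Lemma mxall_sum I (r : seq I) P m n (F : I -> T -> 'M[C]_(m, n)) :
  (forall i, mxall (F i)) -> mxall (fun x => \sum_(i <- r | P i) F i x).
Proof.
move=> qF i j; under eq_fun do rewrite summxE.
by apply: call_sum => k; exact: qF.
Qed.

Lemma mxall_block m1 m2 n1 n2 (A : T -> 'M[C]_(m1, n1)) (B : T -> 'M[C]_(m1, n2))
    (D : T -> 'M[C]_(m2, n1)) (E : T -> 'M[C]_(m2, n2)) :
  mxall (fun x => block_mx (A x) (B x) (D x) (E x)) <->
  [/\ mxall A, mxall B, mxall D & mxall E].
Proof.
split=> [q|[qA qB qD qE] i j].
  split=> i j.
  - by have := q (lshift _ i) (lshift _ j); under eq_fun do rewrite block_mxEul.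
  - by have := q (lshift _ i) (rshift _ j); under eq_fun do rewrite block_mxEur.
  - by have := q (rshift _ i) (lshift _ j); under eq_fun do rewrite block_mxEdl.
  - by have := q (rshift _ i) (rshift _ j); under eq_fun do rewrite block_mxEdr.
rewrite -(splitK i) -(splitK j).
case: (fintype.split i) => a; case: (fintype.split j) => b /=.
- by under eq_fun do rewrite block_mxEul.
- by under eq_fun do rewrite block_mxEur.
- by under eq_fun do rewrite block_mxEdl.
- by under eq_fun do rewrite block_mxEdr.
Qed.

End Closure.

(** A relation, unlike [cderiv]: it also asserts that the derivative exists, while [cderiv] takes
    some value at every point. *)
Definition cder (f : R -> C) (d : C) (x : R) : Prop :=
  is_derive x (1 : R) (fun y => complex.Re (f y)) (complex.Re d) /\
  is_derive x (1 : R) (fun y => complex.Im (f y)) (complex.Im d).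

Definition mxder {m n} (F : R -> 'M[C]_(m, n)) (D : 'M[C]_(m, n)) (x : R) : Prop :=
  forall i j, cder (fun y => F y i j) (D i j) x.

Lemma cder_derivE f d x : cder f d x -> cderiv f x = d.
Proof.
by case: d => a b [[_ fr] [_ fi]]; rewrite /cderiv /clift !derive1E fr fi.
Qed.

Lemma mxder_derivE m n (F : R -> 'M[C]_(m, n)) D x : mxder F D x -> mxderiv F x = D.
Proof.
by move=> dF; apply/matrixP => i j; rewrite mxE; exact: (cder_derivE (dF i j)).
Qed.

Lemma cder_cst c x : cder (fun=> c) 0 x.
Proof. by split; exact: is_derive_cst. Qed.

Lemma cderD f g d e x : cder f d x -> cder g e x -> cder (fun y => f y + g y) (d + e) x.
Proof.
move=> [fr fi] [gr gi]; split.
- by under eq_fun do rewrite complexReD; rewrite complexReD; exact: is_deriveD.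
- by under eq_fun do rewrite complexImD; rewrite complexImD; exact: is_deriveD.
Qed.

Lemma cderM f g d e x : cder f d x -> cder g e x ->
  cder (fun y => f y * g y) (d * g x + f x * e) x.
Proof.
have DM (u v : R -> R) a b : is_derive x (1 : R) u a -> is_derive x (1 : R) v b ->
    is_derive x (1 : R) (fun y => u y * v y) (a * v x + u x * b).
  move=> du dv; have := is_deriveM du dv.
  by rewrite /GRing.scale /= [_ * a]mulrC addrC.
move=> [fr fi] [gr gi]; split.
- under eq_fun do rewrite Defs.ReM.
  have := is_deriveD (DM _ _ _ _ fr gr)
    (DM _ _ _ _ (is_derive_cst (-1 : R) x 1) (DM _ _ _ _ fi gi)).
  rewrite [X in is_derive _ _ _ X](_ : _ = complex.Re (d * g x + f x * e)) //.
  by case: d e {fr fi gr gi} (f x) (g x) => [? ?] [? ?] [? ?] [? ?] /=; ring.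
- under eq_fun do rewrite Defs.ImM.
  have := is_deriveD (DM _ _ _ _ fr gi) (DM _ _ _ _ fi gr).
  rewrite [X in is_derive _ _ _ X](_ : _ = complex.Im (d * g x + f x * e)) //.
  by case: d e {fr fi gr gi} (f x) (g x) => [? ?] [? ?] [? ?] [? ?] /=; ring.
Qed.

Lemma cder_sum I (r : seq I) P (f : I -> R -> C) (d : I -> C) x :
  (forall i, cder (f i) (d i) x) ->
  cder (fun y => \sum_(i <- r | P i) f i y) (\sum_(i <- r | P i) d i) x.
Proof.
move=> df; elim: r => [|i r IH].
  by under eq_fun do rewrite big_nil; rewrite big_nil; exact: cder_cst.
under eq_fun do rewrite big_cons; rewrite big_cons.
by case: (P i) => //; exact: cderD.
Qed.

Lemma mxder_cst m n (A : 'M[C]_(m, n)) x : mxder (fun=> A) 0 x.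
Proof. by move=> i j; rewrite mxE; exact: cder_cst. Qed.

Lemma mxderD m n (F G : R -> 'M[C]_(m, n)) D E x :
  mxder F D x -> mxder G E x -> mxder (fun y => F y + G y) (D + E) x.
Proof. by move=> dF dG i j; under eq_fun do rewrite mxE; rewrite mxE; exact: cderD. Qed.

Lemma mxderM m n p (F : R -> 'M[C]_(m, n)) (G : R -> 'M[C]_(n, p)) D E x :
  mxder F D x -> mxder G E x ->
  mxder (fun y => F y *m G y) (D *m G x + F x *m E) x.
Proof.
move=> dF dG i j; under eq_fun do rewrite mxE; rewrite !mxE -big_split /=.
by apply: cder_sum => k; exact: cderM.
Qed.

Lemma mxderMl m n p (A : 'M[C]_(m, n)) (G : R -> 'M[C]_(n, p)) E x :
  mxder G E x -> mxder (fun y => A *m G y) (A *m E) x.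
Proof. by move=> /(mxderM (mxder_cst A x)); rewrite mul0mx add0r. Qed.

Lemma mxderMr m n p (F : R -> 'M[C]_(m, n)) (A : 'M[C]_(n, p)) D x :
  mxder F D x -> mxder (fun y => F y *m A) (D *m A) x.
Proof. by move=> /mxderM/(_ (mxder_cst A x)); rewrite mulmx0 addr0. Qed.

Lemma mxderZ m n (f : R -> C) d (F : R -> 'M[C]_(m, n)) D x :
  cder f d x -> mxder F D x ->
  mxder (fun y => f y *: F y) (d *: F x + f x *: D) x.
Proof.
by move=> df dF i j; under eq_fun do rewrite mxE; rewrite !mxE; exact: cderM.
Qed.

Lemma mxder_trmx m n (F : R -> 'M[C]_(m, n)) D x :
  mxder F D x -> mxder (fun y => (F y)^T) D^T x.
Proof. by move=> dF i j; under eq_fun do rewrite mxE; rewrite mxE. Qed.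

Lemma mxder_near m n (F G : R -> 'M[C]_(m, n)) D x :
  (\forall y \near x, F y = G y) -> mxder F D x -> mxder G D x.
Proof.
move=> FG dF i j; have [dr di] := dF i j.
split; [apply: near_eq_is_derive dr|apply: near_eq_is_derive di].
  by apply: filterS FG => y ->.
by apply: filterS FG => y ->.
Qed.

Lemma mxder_continuous m n (F : R -> 'M[C]_(m, n)) D x : mxder F D x ->
  mxall (fun u : R -> R => {for x, continuous u}) F.
Proof.
move=> dF i j; have [[dr _] [di _]] := dF i j.
by split; apply: differentiable_continuous; exact/derivable1_diffP.
Qed.

Lemma cder_shift (f : R -> C) d c x : cder f d (x + c) -> cder (fun y => f (y + c)) d x.
Proof.
have sh (u : R -> R) a : is_derive (x + c) (1 : R) u a ->
    is_derive x (1 : R) (fun y => u (y + c)) a.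
  move=> du; have := @is_derive1_comp _ u (fun y => y + c) x a 1.
  rewrite mulr1; apply => //.
  by have := is_deriveD (is_derive_id x (1 : R)) (is_derive_cst c x 1); rewrite addr0.
by move=> [fr fi]; split; exact: sh.
Qed.

Lemma mxder_shift m n (F : R -> 'M[C]_(m, n)) D c x :
  mxder F D (x + c) -> mxder (fun y => F (y + c)) D x.
Proof. by move=> dF i j; exact: (@cder_shift (fun y => F y i j)). Qed.

Lemma csmooth_cder (U : set R) f x : csmooth U f -> U x -> cder f (cderiv f x) x.
Proof.
move=> [fr fi] Ux; split; rewrite /= derive1E; apply/derivableP.
  exact: smooth_derivable fr Ux.
exact: smooth_derivable fi Ux.
Qed.

Lemma mxsmooth_mxder m n (U : set R) (F : R -> 'M[C]_(m, n)) x :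
  mxsmooth U F -> U x -> mxder F (mxderiv F x) x.
Proof. by move=> sF Ux i j; rewrite mxE; exact: csmooth_cder Ux. Qed.

Lemma mxsmooth_mul {V : normedModType R} m n p (U : set V)
    (F : V -> 'M[C]_(m, n)) (G : V -> 'M[C]_(n, p)) :
  open U -> mxsmooth U F -> mxsmooth U G -> mxsmooth U (fun x => F x *m G x).
Proof.
move=> oU; apply: (@mxallM _ (smooth U)).
- exact: smooth_cst.
- by move=> f g; exact: smoothD.
- by move=> f g; exact: smoothM.
Qed.

Lemma mxsmoothZ {V : normedModType R} m n (U : set V) (f : V -> C)
    (F : V -> 'M[C]_(m, n)) : open U -> csmooth U f -> mxsmooth U F ->
  mxsmooth U (fun x => f x *: F x).
Proof. by move=> oU sf sF i j; under eq_fun do rewrite mxE; exact: csmoothM. Qed.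

(** On the line the derivative along v is v times the derivative along 1. So a class of
    differentiable functions stable under [f |-> v * f'] contains, up to equality on [U], all the
    iterated derivatives that [smooth] asks for. It serves affine functions, solutions of linear
    equations and exponential polynomials. *)
Lemma smooth_class (U : set R) (K : (R -> R) -> Prop) :
  open U ->
  (forall f x, K f -> U x -> derivable f x 1) ->
  (forall f v, K f -> exists2 g, K g & forall x, U x -> v * 'D_1 f x = g x) ->
  forall f, K f -> smooth U f.
Proof.
move=> oU Kd KD f Kf vs.
have [g Kg gE] : exists2 g, K g & forall x, U x -> Defs.iterD vs f x = g x.
  elim: vs f Kf => [|v vs IH] f Kf /=; first by exists f.
  have [g Kg gE] := KD f v Kf; have [h Kh hE] := IH g Kg; exists h => // x Ux.
  rewrite -hE //; apply: (iterD_eq vs oU) => // y Uy.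
  have /derivable1_diffP df := Kd f y Kf Uy.
  by rewrite -gE // !deriveE // -[v in LHS]mulr1 linearZ.
move=> x Ux.
have nE : {near x, g =1 Defs.iterD vs f}.
  have : nbhs x U by exact: open_nbhs_nbhs.
  by apply: filterS => z Uz; rewrite gE.
have dg : derivable g x 1 by exact: Kd.
have /derivable1_diffP/differentiable_continuous cg := dg.
split=> [|v]; last first.
  apply: near_eq_derivable nE _.
  by apply: diff_derivable; exact/derivable1_diffP.
rewrite /prop_for /continuous_at gE//.
by apply: cvg_trans cg; apply: near_eq_cvg.
Qed.

End MatrixFunctions.

(** * Integrals over segments: parameters, limits and the fundamental theorem *)

Section RealIntegrals.
Context {R : realType}.
Local Notation mu := (@lebesgue_measure R).
Implicit Types (f : R -> R) (a b c x M s : R).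

Lemma integrable_continuous f a b : continuous f ->
  mu.-integrable `[a, b] (EFin \o f).
Proof.
move=> cf; apply: continuous_compact_integrable; first exact: segment_compact.
exact: continuous_subspaceT.
Qed.

Lemma Rintegral_segment_cst a b M : a <= b ->
  Rintegral mu `[a, b] (fun=> M) = M * (b - a).
Proof.
move=> ab; rewrite Rintegral_cst//= lebesgue_measure_itv/= lte_fin.
by case: ltgtP ab => //= ->; rewrite subrr.
Qed.

Lemma Rintegral_segment0 f a b : b <= a -> Rintegral mu `[a, b] f = 0.
Proof.
rewrite le_eqVlt => /predU1P[->|ba]; first by rewrite set_itv1 Rintegral_set1.
by rewrite set_itv_ge ?bnd_simp -?ltNge // Rintegral_set0.
Qed.

Lemma eq_Rintegral_segment f g a b : (forall x, a <= x <= b -> f x = g x) ->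
  Rintegral mu `[a, b] f = Rintegral mu `[a, b] g.
Proof.
by move=> fg; apply: eq_Rintegral => x; rewrite inE /= in_itv /=; exact: fg.
Qed.

Lemma le_Rintegral_segment f g a b : continuous f -> continuous g ->
  (forall x, a <= x <= b -> f x <= g x) ->
  Rintegral mu `[a, b] f <= Rintegral mu `[a, b] g.
Proof.
by move=> cf cg fg; apply: le_Rintegral => //; exact: integrable_continuous.
Qed.

Lemma normr_Rintegral_segment f g a b : continuous f -> continuous g ->
  (forall x, a <= x <= b -> `|f x| <= g x) ->
  `|Rintegral mu `[a, b] f| <= Rintegral mu `[a, b] g.
Proof.
move=> cf cg fg; apply: (le_trans (le_normr_Rintegral _ _)) => //.
  exact: integrable_continuous.
apply: le_Rintegral_segment => //.
by move=> x; apply: (continuous_comp (cf x)); exact: norm_continuous.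
Qed.

Lemma Rintegral_segment_split f a b c : continuous f -> a <= c -> c <= b ->
  Rintegral mu `[a, b] f = Rintegral mu `[a, c] f + Rintegral mu `[c, b] f.
Proof.
move=> cf ac cb.
have := @Rintegral_itvB _ f (BLeft a) (BRight b) c (integrable_continuous _ _ cf).
rewrite !bnd_simp => /(_ ac cb) E; rewrite -[X in _ + X]Rintegral_itv_obnd_cbnd.
  by rewrite -E addrC subrK.
apply: (integrableS _ _ _ (@integrable_continuous f c b cf)) => //.
by move=> x /=; rewrite !in_itv /= => /andP[/ltW -> ->].
Qed.

Lemma Rintegral_segment_bound f a b M : continuous f -> a <= b ->
  (forall x, a <= x <= b -> `|f x| <= M) ->
  `|Rintegral mu `[a, b] f| <= M * (b - a).
Proof.
move=> cf ab fM; rewrite -Rintegral_segment_cst//.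
by apply: normr_Rintegral_segment => // x; exact: cst_continuous.
Qed.

Lemma Rintegral_segment_lip f a a' b M : continuous f -> a <= a' -> 0 <= M ->
  (forall x, a <= x <= b -> `|f x| <= M) ->
  `|Rintegral mu `[a, b] f - Rintegral mu `[a', b] f| <= M * (a' - a).
Proof.
move=> cf aa' M0 fM; have [ba|ab] := ltP b a.
  rewrite !Rintegral_segment0 ?(le_trans (ltW ba))// ?(ltW ba)// subrr normr0.
  by rewrite mulr_ge0 // subr_ge0.
have [ba'|a'b] := leP b a'.
  rewrite [X in _ - X]Rintegral_segment0// subr0.
  apply: (le_trans (Rintegral_segment_bound cf ab fM)).
  by rewrite ler_wpM2l // lerB.
rewrite (Rintegral_segment_split cf aa' (ltW a'b)) addrK.
apply: Rintegral_segment_bound => // x /andP[ax xa].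
by apply: fM; rewrite ax (le_trans xa)// ltW.
Qed.

Lemma continuous_section (f : R * R -> R) s : continuous f -> continuous (fun t => f (s, t)).
Proof.
move=> cf t; apply: (@cvg_comp _ _ _ (pair s) f (nbhs t) (nbhs (s, t))); last exact: cf.
move=> A [[B D] /= [nB nD] BD]; apply: filterS nD => y Dy; apply: BD.
by split=> //=; exact: nbhs_singleton.
Qed.

(** Tube lemma: continuity at [(s0, t0)] gives the estimate on a product neighbourhood, and
    compactness of the segment makes it uniform in t. *)
Lemma near_segment (f : R * R -> R) s0 a b e : continuous f -> 0 < e ->
  \forall s \near s0, forall t, a <= t <= b -> `|f (s, t) - f (s0, t)| < e.
Proof.
move=> cf e0.
have := @segment_compact R a b; rewrite compact_near_coveringP.
move=> /(_ R (nbhs s0) (fun s t => `|f (s, t) - f (s0, t)| < e) _) H.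
have : \forall s \near s0, `[a, b] `<=` (fun t => `|f (s, t) - f (s0, t)| < e).
  apply: H => t0 _.
  have e2 : 0 < e / 2 by rewrite divr_gt0.
  have /cvgrPdist_lt/(_ _ e2) nf := cf (s0, t0).
  have nf0 : \forall t \near t0, `|f (s0, t0) - f (s0, t)| < e / 2.
    by have /cvgrPdist_lt/(_ _ e2) := @continuous_section f s0 cf t0.
  case: nf => -[A B] /= [nA nB] AB.
  exists (B `&` [set t | `|f (s0, t0) - f (s0, t)| < e / 2], A) => /=.
    by split=> //; exact: filterI.
  move=> -[t s] /= [[Bt f0t] As].
  have fst : `|f (s0, t0) - f (s, t)| < e / 2 by apply: (AB (s, t)).
  rewrite -(subrKA (f (s0, t0))) (le_lt_trans (ler_normD _ _))//.
  by rewrite [e]splitr distrC ltrD.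
by apply: filterS => s sf t tab; apply: sf; rewrite /= in_itv.
Qed.

Lemma near_segment_bounded (f : R * R -> R) s0 a b : continuous f ->
  exists M, \forall s \near s0, forall t, a <= t <= b -> `|f (s, t)| <= M.
Proof.
move=> cf.
have cf0 := @continuous_section f s0 cf.
have [M fM] : exists M, forall t, a <= t <= b -> `|f (s0, t)| <= M.
  have [ab|ba] := leP a b; last first.
    by exists 0 => t /andP[at_ tb]; move: (le_trans at_ tb); rewrite leNgt ba.
  have cn : {within `[a, b], continuous (fun t => `|f (s0, t)|)}.
    apply: continuous_subspaceT => t; apply: (continuous_comp (cf0 t)).
    exact: norm_continuous.
  have [c _ cM] := EVT_max ab cn.
  by exists `|f (s0, c)| => t tab; apply: cM; rewrite in_itv.
exists (M + 1); have := @near_segment f s0 a b 1 cf ltr01.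
apply: filterS => s fs t tab.
rewrite -[f (s, t)](subrK (f (s0, t))) (le_trans (ler_normD _ _))// addrC.
by rewrite lerD// ?fM// ltW// fs.
Qed.

Lemma segment_bounded (f : R * R -> R) s0 s1 a b : continuous f ->
  exists M, forall s t, s0 <= s <= s1 -> a <= t <= b -> `|f (s, t)| <= M.
Proof.
move=> cf.
have := @segment_compact R s0 s1; rewrite compact_near_coveringP.
move=> /(_ R (pinfty_nbhs R) (fun M s => forall t, a <= t <= b -> `|f (s, t)| <= M) _) H.
have [] : \forall M \near +oo, `[s0, s1] `<=` (fun s => forall t, a <= t <= b -> `|f (s, t)| <= M).
  apply: H => s _; have [M fM] := @near_segment_bounded f s a b cf.
  exists ([set s' | forall t, a <= t <= b -> `|f (s', t)| <= M], [set N | M <= N]) => /=.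
    by split=> //; exists M; split=> [|x /ltW]; rewrite ?num_real.
  by move=> -[s' N] /= [sM MN] t tab; apply: le_trans MN; exact: sM.
move=> M [_ HM]; exists (M + 1) => s t sS tab; apply: (HM (M + 1)) => //.
by rewrite ltrDl.
Qed.

(** The parameter and the lower end vary together. Moving s costs at most [d * (b - a0)], moving the
    end costs at most [N] times the displacement, and each is made at most [e / 2]. *)
Lemma continuous_Rintegral (f : R * R -> R) b : continuous f ->
  continuous (fun p : R * R => Rintegral mu `[p.2, b] (fun t => f (p.1, t))).
Proof.
move=> cf [s0 a0]; apply/cvgrPdist_le => /= e e0.
have cs s := @continuous_section f s cf.
(* The bound starts at [a0 - 1] because the moving end may lie to the left of [a0]; it is kept
   within distance 1 below. *)
have [M fM] := @near_segment_bounded f s0 (a0 - 1) b cf.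
pose N := `|M| + 1.
have N0 : 0 < N by rewrite ltr_wpDl.
pose d := e / 2 / (`|b - a0| + 1).
have d0 : 0 < d by rewrite !divr_gt0 // ltr_wpDl.
have fd := @near_segment f s0 a0 b d cf d0.
have na : \forall a \near a0, `|a0 - a| < Num.min 1 (e / 2 / N).
  have m0 : 0 < Num.min 1 (e / 2 / N) by rewrite lt_min ltr01 !divr_gt0.
  by have /cvgrPdist_lt/(_ _ m0) := @cvg_id _ (nbhs a0).
exists ([set s | (forall t, a0 - 1 <= t <= b -> `|f (s, t)| <= M) /\
   (forall t, a0 <= t <= b -> `|f (s, t) - f (s0, t)| < d)],
   [set a | `|a0 - a| < Num.min 1 (e / 2 / N)]) => /=.
  by split=> //; exact: filterI.
move=> [s a] /= [[sM sd]]; rewrite lt_min => /andP[a1 aN].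
have Na : `|a0 - a| * N <= e / 2 by rewrite -ler_pdivlMr // ltW.
rewrite -(subrKA (Rintegral mu `[a0, b] (fun t => f (s, t)))).
rewrite (le_trans (ler_normD _ _))// [leRHS]splitr lerD//.
  have [ab|ba] := leP b a0.
    by rewrite !Rintegral_segment0 ?subrr ?normr0// divr_ge0 // ltW.
  have cB : continuous (fun t => f (s0, t) - f (s, t)).
    by move=> t; apply: cvgB; exact: cs.
  rewrite -RintegralB//; try exact: integrable_continuous.
  apply: (le_trans (@Rintegral_segment_bound _ _ _ d cB (ltW ba) _)).
    by move=> t /sd /ltW; rewrite distrC.
  rewrite /d mulrAC ler_pdivrMr ?ltr_wpDl// ler_wpM2l ?divr_ge0 ?(ltW e0)//.
  by rewrite (le_trans (ler_norm _))// lerDl.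
have fsN x : a0 - 1 <= x <= b -> `|f (s, x)| <= N.
  by move=> /sM/le_trans; apply; rewrite (le_trans (ler_norm _))// lerDl.
move: a1; rewrite ltr_distl => /andP[a1 a2].
apply: le_trans Na; rewrite mulrC; have [aa|aa] := leP a0 a.
  rewrite [`|a0 - a|]distrC [`|a - a0|]ger0_norm ?subr_ge0//.
  apply: Rintegral_segment_lip => //; first exact: ltW.
  move=> x /andP[x1 x2]; apply: fsN; rewrite x2 andbT (le_trans _ x1)//.
  by rewrite gerBl.
rewrite distrC [leRHS](_ : _ = N * (a0 - a)); last by rewrite ger0_norm ?subr_ge0 ?ltW.
apply: Rintegral_segment_lip => //; try exact: ltW.
move=> x /andP[x1 x2]; apply: fsN; rewrite x2 andbT (le_trans _ x1)//.
by rewrite lerBlDr ltW.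
Qed.

Lemma is_derive_Rintegral_lower f b x : continuous f -> x < b ->
  is_derive x 1 (fun a => Rintegral mu `[a, b] f) (- f x).
Proof.
move=> cf xb.
have [df Df] := @continuous_FTC1_closed _ f (x - 1) x b xb
  (@integrable_continuous f (x - 1) b cf) (ltac:(by rewrite gtrBl)) (cf x).
have dF : is_derive x 1 (fun a => Rintegral mu `[x - 1, a] f) (f x).
  by rewrite -Df derive1E; apply: derivableP.
have := is_deriveB (is_derive_cst (Rintegral mu `[x - 1, b] f) x 1) dF.
rewrite sub0r; apply: near_eq_is_derive.
near=> a; rewrite -[LHS]/(Rintegral mu `[x - 1, b] f - Rintegral mu `[x - 1, a] f).
have xa : x - 1 <= a by apply: ltW; near: a; apply: lt_nbhsr; rewrite gtrBl.
have ab : a <= b by apply: ltW; near: a; exact: lt_nbhsl.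
by rewrite (Rintegral_segment_split cf xa ab) addrAC subrr add0r.
Unshelve. all: by end_near. Qed.

(** Leibniz' rule under the integral sign. The dominating function is a constant, a bound of [f'] on
    the compact rectangle over [[s - 1, s + 1]]. *)
Lemma is_derive_Rintegral_param (f f' : R * R -> R) a b s :
  continuous f -> continuous f' ->
  (forall s t, is_derive s 1 (fun s => f (s, t)) (f' (s, t))) ->
  is_derive s 1 (fun s => Rintegral mu `[a, b] (fun t => f (s, t)))
    (Rintegral mu `[a, b] (fun t => f' (s, t))).
Proof.
move=> cf cf' df.
have [M fM] := @segment_bounded f' (s - 1) (s + 1) a b cf'.
have Is : s \in `]s - 1, s + 1[ by rewrite in_itv /= gtrBl ltrDl ltr01.
pose G t := if t \in `[a, b] then `|M| else 0.
have dE s' t : partial1of2 (fun s t => f (s, t)) s' t = f' (s', t).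
  by rewrite partial1of2E; apply: derive_val.
have int s' : mu.-integrable `[a, b] (EFin \o (fun t => f (s', t))).
  by apply: integrable_continuous; exact: continuous_section.
have der s' t : derivable (fun s => f (s, t)) s' 1 by exact: ex_derive.
have iM : mu.-integrable `[a, b] (EFin \o cst `|M|).
  by apply: integrable_continuous; exact: cst_continuous.
have G_ub x y : `]s - 1, s + 1[%classic x -> `[a, b]%classic y ->
    `|partial1of2 (fun s t => f (s, t)) x y| <= cst `|M| y.
  rewrite /= !in_itv /= => /andP[x1 x2] yab; rewrite dE.
  by rewrite (le_trans _ (ler_norm _))// fM // !ltW.
split.
  by apply: (@derivable_under_integral _ _ _ mu (fun s t => f (s, t)) `[a, b] _ s (s-1) (s+1) _ _ _ (cst `|M|)) => //.
rewrite -derive1E.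
rewrite (@differentiation_under_integral _ _ _ mu (fun s t => f (s, t)) `[a, b] _ s (s-1) (s+1) _ _ _ (cst `|M|)) //.
by apply: eq_Rintegral => t _; exact: dE.
Qed.

Lemma Rintegral_FTC (F f : R -> R) a b : a <= b ->
  (forall x, a <= x <= b -> {for x, continuous f}) ->
  (forall x, a <= x <= b -> is_derive x 1 F (f x)) ->
  Rintegral mu `[a, b] f = F b - F a.
Proof.
rewrite le_eqVlt => /predU1P[->|ab] cf dF.
  by rewrite Rintegral_segment0 ?subrr.
have cF x : a <= x <= b -> {for x, continuous F}.
  move=> /dF dFx; apply: differentiable_continuous.
  by apply/derivable1_diffP; exact: ex_derive.
rewrite /Rintegral (@continuous_FTC2 _ f F)//=.
- by apply: continuous_in_subspaceT => x; rewrite inE /= in_itv; exact: cf.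
- split=> [x||].
  + by rewrite in_itv /= => /andP[/ltW ax /ltW xb]; have := dF x; rewrite ax xb => /(_ isT) [].
  + by apply: cvg_at_right_filter; apply: cF; rewrite lexx ltW.
  + by apply: cvg_at_left_filter; apply: cF; rewrite lexx ltW.
- move=> x; rewrite in_itv /= => /andP[/ltW ax /ltW xb].
  by have := dF x; rewrite ax xb => /(_ isT) [_]; rewrite derive1E.
Qed.

(** The two ends are negligible for the measure, so convergence inside suffices. This is what a
    piece of a piecewise smooth path offers: at a breakpoint the derivative in s of the whole path
    may differ from that of the piece. *)
Lemma bounded_cvg_Rintegral (f_ : nat -> R -> R) f a b M :
  (forall n, continuous (f_ n)) ->
  (forall n t, a <= t <= b -> `|f_ n t| <= M) ->
  (forall t, a < t < b -> f_ ^~ t @ \oo --> f t) ->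
  mu.-integrable `[a, b] (EFin \o f) /\
  (fun n => Rintegral mu `[a, b] (f_ n)) @ \oo --> Rintegral mu `[a, b] f.
Proof.
move=> cf fM ff.
have mf n : measurable_fun setT (f_ n) by exact: continuous_measurable_fun.
have mfo : measurable_fun `]a, b[ f.
  apply: (@measurable_fun_cvg _ _ _ _ f_) => [n|x /=].
    exact: measurable_funTS.
  by rewrite in_itv /=; exact: ff.
have mfc : measurable_fun `[a, b] f by apply/measurable_fun_itv_bndo_bndcP/measurable_fun_itv_obnd_cbndP.
have [||||||] := @dominated_convergence _ _ _ mu `[a, b] _ (fun n => EFin \o f_ n)
  (EFin \o f) (EFin \o cst M).
- by [].
- by move=> n; apply/measurable_EFinP; apply: measurable_funTS; exact: mf.
- exact/measurable_EFinP.
- exists [set a; b]; split.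
  + by apply: measurableU; exact: measurable_set1.
  + by apply: null_set_setU => //; exact: lebesgue_measure_set1.
  + move=> t /= /not_implyP[]; rewrite in_itv /= => tab nft.
    apply: contrapT => /not_orP[/eqP ta /eqP tb]; apply: nft.
    apply: cvg_EFin; first exact: nearW.
    by apply: ff; rewrite !lt_neqAle eq_sym ta tb.
- by apply: integrable_continuous; exact: cst_continuous.
- by apply: aeW => t n /=; rewrite in_itv /= lee_fin; exact: fM.
move=> intf _ cv; split=> //; apply: fine_cvg.
by rewrite fineK ?integrable_fin_num.
Qed.

End RealIntegrals.

(** * Entrywise norms and convergence of matrices *)

Section MatrixNorm.
Context {R : realType}.
Local Notation C := R[i].

(** The l1 norm of the plane: real-valued, submultiplicative, and above both [|Re z|] and [|Im z|].
    The entrywise sum [mxabs] inherits this, but gives the identity matrix norm n, whence the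
    factors [mxabs 1%:M] in later bounds. *)
Definition cabs (z : C) : R := `|complex.Re z| + `|complex.Im z|.

Definition mxabs {m n} (A : 'M[C]_(m, n)) : R := \sum_i \sum_j cabs (A i j).

Lemma cabs_ge0 z : 0 <= cabs z.
Proof. exact: addr_ge0. Qed.

Lemma cabs0 : cabs 0 = 0.
Proof. by rewrite /cabs /= normr0 addr0. Qed.

Lemma cabsD z w : cabs (z + w) <= cabs z + cabs w.
Proof.
by rewrite /cabs complexReD complexImD addrACA lerD // ler_normD.
Qed.

Lemma cabsM z w : cabs (z * w) <= cabs z * cabs w.
Proof.
rewrite /cabs Defs.ReM Defs.ImM mulrDl !mulrDr -!normrM.
rewrite [leRHS](_ : _ = `|complex.Re z * complex.Re w| + `|complex.Im z * complex.Im w| +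
  (`|complex.Re z * complex.Im w| + `|complex.Im z * complex.Re w|)); last by ring.
by rewrite mulN1r lerD ?ler_normB ?ler_normD.
Qed.

Lemma cabs_sum I (r : seq I) P (f : I -> C) :
  cabs (\sum_(i <- r | P i) f i) <= \sum_(i <- r | P i) cabs (f i).
Proof.
elim/big_rec2: _ => [|i x y _ H]; first by rewrite cabs0.
by apply: le_trans (cabsD _ _) _; rewrite lerD2l.
Qed.

Lemma mxabs_ge0 m n (A : 'M[C]_(m, n)) : 0 <= mxabs A.
Proof. by do 2 (apply: sumr_ge0 => ? _); exact: cabs_ge0. Qed.

Lemma le_mxabs m n (A : 'M[C]_(m, n)) i j : cabs (A i j) <= mxabs A.
Proof.
rewrite /mxabs (bigD1 i) //= (bigD1 j) //= -addrA lerDl addr_ge0 //.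
  by apply: sumr_ge0 => ? _; exact: cabs_ge0.
by do 2 (apply: sumr_ge0 => ? _); exact: cabs_ge0.
Qed.

Lemma le_Re_mxabs m n (A : 'M[C]_(m, n)) i j : `|complex.Re (A i j)| <= mxabs A.
Proof. by apply: le_trans (le_mxabs A i j); rewrite lerDl. Qed.

Lemma le_Im_mxabs m n (A : 'M[C]_(m, n)) i j : `|complex.Im (A i j)| <= mxabs A.
Proof. by apply: le_trans (le_mxabs A i j); rewrite lerDr. Qed.

Lemma mxabs0 m n : mxabs (0 : 'M[C]_(m, n)) = 0.
Proof. by rewrite /mxabs big1 // => i _; rewrite big1 // => j _; rewrite mxE cabs0. Qed.

Lemma mxabsD m n (A B : 'M[C]_(m, n)) : mxabs (A + B) <= mxabs A + mxabs B.
Proof.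
rewrite /mxabs -big_split ler_sum // => i _; rewrite -big_split ler_sum // => j _.
by rewrite mxE cabsD.
Qed.

Lemma mxabsN m n (A : 'M[C]_(m, n)) : mxabs (- A) = mxabs A.
Proof.
apply: eq_bigr => i _; apply: eq_bigr => j _; rewrite mxE /cabs.
by case: (A i j) => a b /=; rewrite !normrN.
Qed.

Lemma mxabs_sum I (r : seq I) P m n (F : I -> 'M[C]_(m, n)) :
  mxabs (\sum_(i <- r | P i) F i) <= \sum_(i <- r | P i) mxabs (F i).
Proof.
elim/big_rec2: _ => [|i x y _ H]; first by rewrite mxabs0.
by apply: le_trans (mxabsD _ _) _; rewrite lerD2l.
Qed.

Lemma mxabsM m n p (A : 'M[C]_(m, n)) (B : 'M[C]_(n, p)) :
  mxabs (A *m B) <= mxabs A * mxabs B.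
Proof.
rewrite /mxabs mulr_suml; apply: ler_sum => i _.
have -> : (\sum_j cabs (A i j)) * (\sum_k \sum_j cabs (B k j)) =
   \sum_k (\sum_j cabs (A i j)) * (\sum_l cabs (B k l)) by rewrite mulr_sumr.
apply: (@le_trans _ _ (\sum_k cabs (A i k) * \sum_l cabs (B k l))).
  rewrite [leRHS](eq_bigr (fun k => \sum_l cabs (A i k) * cabs (B k l))); last first.
    by move=> k _; rewrite mulr_sumr.
  rewrite exchange_big /=; apply: ler_sum => j _; rewrite mxE.
  by apply: le_trans (cabs_sum _ _ _) _; apply: ler_sum => k _; exact: cabsM.
apply: ler_sum => k _; rewrite ler_wpM2r ?sumr_ge0 // => [? _|]; first exact: cabs_ge0.
by rewrite (bigD1 k) //= lerDl sumr_ge0 // => ? _; exact: cabs_ge0.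
Qed.

Lemma mxabs_prod_bound I (r : seq I) n (F : I -> 'M[C]_n) (K : I -> R) :
  (forall i, mxabs (F i) <= K i) ->
  mxabs (\prod_(i <- r) F i) <= mxabs (1%:M : 'M[C]_n) * \prod_(i <- r) K i.
Proof.
move=> FK; elim: r => [|i r IH]; first by rewrite !big_nil mulr1.
rewrite !big_cons (le_trans (mxabsM _ _))// mulrCA ler_pM ?mxabs_ge0//.
Qed.

Definition mxcont {T : topologicalType} {m n} (F : T -> 'M[C]_(m, n)) : Prop :=
  mxall (fun u : T -> R => continuous u) F.

Lemma continuous_mxabs (T : topologicalType) m n (F : T -> 'M[C]_(m, n)) :
  mxcont F -> continuous (fun x => mxabs (F x)).
Proof.
move=> cF; rewrite /mxabs /cabs.
have csum I (r : seq I) (f : I -> T -> R) : (forall i, continuous (f i)) ->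
    continuous (fun x => \sum_(i <- r) f i x).
  move=> cf; elim: r => [|i r IH].
    by under eq_fun do rewrite big_nil; move=> x; exact: cvg_cst.
  under eq_fun do rewrite big_cons.
  by move=> x; apply: cvgD; [exact: cf|exact: IH].
have cN (u : T -> R) : continuous u -> continuous (fun x => `|u x|).
  by move=> cu x; apply: (continuous_comp (cu x)); exact: norm_continuous.
apply: (csum) => i; apply: (csum) => j; have [? ?] := cF i j.
by move=> x; apply: cvgD; apply: (cN).
Qed.

Definition mxcvg {m n} (F : nat -> 'M[C]_(m, n)) (L : 'M[C]_(m, n)) : Prop :=
  forall i j, (fun k => complex.Re (F k i j)) @ \oo --> complex.Re (L i j) /\
              (fun k => complex.Im (F k i j)) @ \oo --> complex.Im (L i j).

Lemma mxcvg_lim m n (F : nat -> 'M[C]_(m, n)) L : mxcvg F L -> mxlim F = L.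
Proof.
move=> FL; apply/matrixP => i j; rewrite mxE /clift; have [cr ci] := FL i j.
rewrite (cvg_lim _ cr) // (cvg_lim _ ci) //; by case: (L i j).
Qed.

Lemma mxcvgP m n (F : nat -> 'M[C]_(m, n)) L :
  (fun k => mxabs (F k - L)) @ \oo --> (0 : R) -> mxcvg F L.
Proof.
move=> F0 i j; split; apply/cvgrPdist_le => e e0.
- have /cvgrPdist_le/(_ _ e0) := F0; apply: filterS => k.
  rewrite sub0r normrN ger0_norm ?mxabs_ge0//; apply: le_trans.
  apply: le_trans (le_Re_mxabs _ i j); rewrite distrC !mxE.
  by case: (F k i j) (L i j) => [? ?] [? ?].
- have /cvgrPdist_le/(_ _ e0) := F0; apply: filterS => k.
  rewrite sub0r normrN ger0_norm ?mxabs_ge0//; apply: le_trans.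
  apply: le_trans (le_Im_mxabs _ i j); rewrite distrC !mxE.
  by case: (F k i j) (L i j) => [? ?] [? ?].
Qed.

Lemma mxcvg_uniq m n (F : nat -> 'M[C]_(m, n)) L L' : mxcvg F L -> mxcvg F L' -> L = L'.
Proof. by move=> /mxcvg_lim <- /mxcvg_lim. Qed.

Lemma mxcvg_cst m n (A : 'M[C]_(m, n)) : mxcvg (fun=> A) A.
Proof. by move=> i j; split; exact: cvg_cst. Qed.

Lemma mxcvgM m n p (F : nat -> 'M[C]_(m, n)) (G : nat -> 'M[C]_(n, p)) L M :
  mxcvg F L -> mxcvg G M -> mxcvg (fun k => F k *m G k) (L *m M).
Proof.
pose ccvg (f : nat -> C) (l : C) := (fun k => complex.Re (f k)) @ \oo --> complex.Re l /\
              (fun k => complex.Im (f k)) @ \oo --> complex.Im l.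
have cM f g l l' : ccvg f l -> ccvg g l' -> ccvg (fun k => f k * g k) (l * l').
  move=> [fr fi] [gr gi]; split.
    under eq_fun do rewrite Defs.ReM; rewrite Defs.ReM.
    apply: cvgD; first exact: cvgM.
    by apply: cvgM; [exact: cvg_cst|exact: cvgM].
  under eq_fun do rewrite Defs.ImM; rewrite Defs.ImM.
  by apply: cvgD; exact: cvgM.
have cS I (r : seq I) (f : I -> nat -> C) l : (forall i, ccvg (f i) (l i)) ->
    ccvg (fun k => \sum_(i <- r) f i k) (\sum_(i <- r) l i).
  move=> cf; elim: r => [|i r [IHr IHi]].
    by rewrite big_nil; under eq_fun do rewrite big_nil; split; exact: cvg_cst.
  rewrite big_cons; under eq_fun do rewrite big_cons; have [fr fi] := cf i; split.
  - by under eq_fun do rewrite complexReD; rewrite complexReD; exact: cvgD.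
  - by under eq_fun do rewrite complexImD; rewrite complexImD; exact: cvgD.
move=> cF cG i j; rewrite -/(ccvg (fun k => (F k *m G k) i j) _).
under eq_fun do rewrite mxE; rewrite mxE; apply: (cS _ _ (fun k N => F N i k * G N k j)) => k.
by apply: cM; [exact: cF|exact: cG].
Qed.

Lemma mxcvg_prod I (r : seq I) n (F : I -> nat -> 'M[C]_n) L :
  (forall i, mxcvg (F i) (L i)) ->
  mxcvg (fun k => \prod_(i <- r) F i k) (\prod_(i <- r) L i).
Proof.
move=> cF; elim: r => [|i r IH].
  by rewrite big_nil; under eq_fun do rewrite big_nil; exact: mxcvg_cst.
by rewrite big_cons; under eq_fun do rewrite big_cons; exact: mxcvgM.
Qed.

(** The ratio 1/2 is the contraction factor of [volterra_bound], and [2 * B * 2^-1 ^+ N] is the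
    geometric tail from N. A remainder depending only on [B] later gives locally uniform
    convergence. *)
Lemma half_geometric_cvg B (u : nat -> R) : (forall k, `|u k| <= B * 2^-1 ^+ k) ->
  exists2 l, (fun N => \sum_(k < N) u k) @ \oo --> l &
    forall N, `|l - \sum_(k < N) u k| <= 2 * B * 2^-1 ^+ N.
Proof.
move=> uB.
have h1 : `|2^-1 : R| < 1 by rewrite ger0_norm ?invr_ge0// invf_lt1 // ltr1n.
have cu : cvgn (series u).
  apply: normed_cvg; apply: (@series_le_cvg _ _ (geometric B 2^-1)) => [n|n|n|].
  - by rewrite normr_ge0.
  - exact: le_trans (normr_ge0 _) (uB n).
  - exact: uB.
  - exact: is_cvg_geometric_series.
have sE : (fun N => \sum_(k < N) u k) = series u.
  by apply/funext => N; rewrite /series /= big_mkord.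
exists (limn (series u)); first by rewrite sE.
move=> N; have B0 : 0 <= B.
  by have := le_trans (normr_ge0 _) (uB 0%N); rewrite expr0 mulr1.
(* The exact value of the finite geometric sum, rather than its limit, makes the induction on n
   close. *)
have tail n : (N <= n)%N -> `|series u n - series u N| <= 2 * B * (2^-1 ^+ N - 2^-1 ^+ n).
  elim: n => [|n IH]; first by rewrite leqn0 => /eqP->; rewrite !subrr normr0 mulr0.
  rewrite leq_eqVlt => /predU1P[->|Nn]; first by rewrite !subrr normr0 mulr0.
  have -> : series u n.+1 = series u n + u n by rewrite /series /= big_nat_recr.
  rewrite addrAC (le_trans (ler_normD _ _))//.
  apply: le_trans (lerD (IH Nn) (uB n)) _.
  rewrite exprS le_eqVlt; apply/orP; left; apply/eqP.
  by field.
have -> : \sum_(k < N) u k = series u N by rewrite -sE.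
have cl : `|series u n - series u N| @[n --> \oo] --> `|limn (series u) - series u N|.
  by apply: cvg_norm; apply: cvgB => //; exact: cvg_cst.
rewrite -(cvg_lim _ cl)//; apply: limr_le; first by apply/cvg_ex; eexists; exact: cl.
near=> n; apply: le_trans (tail n _) _; first by near: n; exists N.
by rewrite ler_wpM2l ?mulr_ge0// gerBl exprn_ge0// invr_ge0.
Unshelve. all: by end_near. Qed.

Lemma mx_half_geometric_cvg m n (B : R) (F : nat -> 'M[C]_(m, n)) :
  (forall k, mxabs (F k) <= B * 2^-1 ^+ k) ->
  exists L, mxcvg (fun N => \sum_(k < N) F k) L /\
    forall N, mxabs (L - \sum_(k < N) F k) <= (m * n)%:R * (4 * B * 2^-1 ^+ N).
Proof.
move=> FB.
have hr (ij : 'I_m * 'I_n) := half_geometric_cvg (fun k => le_trans (le_Re_mxabs (F k) ij.1 ij.2) (FB k)).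
have hi (ij : 'I_m * 'I_n) := half_geometric_cvg (fun k => le_trans (le_Im_mxabs (F k) ij.1 ij.2) (FB k)).
have /choice[lr Hr] : forall ij, exists l, (fun N => \sum_(k < N) complex.Re (F k ij.1 ij.2)) @ \oo --> l /\
    forall N, `|l - \sum_(k < N) complex.Re (F k ij.1 ij.2)| <= 2 * B * 2^-1 ^+ N.
  by move=> ij; have [l ? ?] := hr ij; exists l.
have /choice[li Hi] : forall ij, exists l, (fun N => \sum_(k < N) complex.Im (F k ij.1 ij.2)) @ \oo --> l /\
    forall N, `|l - \sum_(k < N) complex.Im (F k ij.1 ij.2)| <= 2 * B * 2^-1 ^+ N.
  by move=> ij; have [l ? ?] := hi ij; exists l.
have ReS N i j : complex.Re ((\sum_(k < N) F k) i j) = \sum_(k < N) complex.Re (F k i j).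
  by rewrite summxE; elim/big_rec2: _ => // k x y _ <-; rewrite complexReD.
have ImS N i j : complex.Im ((\sum_(k < N) F k) i j) = \sum_(k < N) complex.Im (F k i j).
  by rewrite summxE; elim/big_rec2: _ => // k x y _ <-; rewrite complexImD.
exists (\matrix_(i, j) (lr (i, j) +i* li (i, j))); split=> [i j|N].
  rewrite mxE /=; split.
  - by under eq_fun do rewrite ReS; exact: (Hr (i, j)).1.
  - by under eq_fun do rewrite ImS; exact: (Hi (i, j)).1.
apply: (@le_trans _ _ (\sum_(i < m) \sum_(j < n) 4 * B * 2^-1 ^+ N)).
  apply: ler_sum => i _; apply: ler_sum => j _.
  rewrite 3!mxE /cabs complexReD complexImD.
  have -> : complex.Re (- (\sum_(k < N) F k) i j) = - complex.Re ((\sum_(k < N) F k) i j).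
    by case: (_ i j).
  have -> : complex.Im (- (\sum_(k < N) F k) i j) = - complex.Im ((\sum_(k < N) F k) i j).
    by case: (_ i j).
  rewrite ReS ImS /= (_ : 4 * B * 2^-1 ^+ N = 2 * B * 2^-1 ^+ N + 2 * B * 2^-1 ^+ N); last by ring.
  by apply: lerD; [exact: (Hr (i, j)).2|exact: (Hi (i, j)).2].
by rewrite !sumr_const !card_ord -mulrnA -[leLHS]mulr_natl [(n * m)%N]mulnC.
Qed.

Lemma half_exp_cvg0 (B : R) : (fun N => B * 2^-1 ^+ N) @ \oo --> (0 : R).
Proof.
rewrite -(mulr0 B); apply: cvgM; first exact: cvg_cst.
by apply: cvg_expr; rewrite ger0_norm ?invr_ge0// invf_lt1 // ltr1n.
Qed.

End MatrixNorm.

(** * Integration of matrix-valued functions *)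

Section MatrixIntegral.
Context {R : realType}.
Local Notation C := R[i].
Local Notation mu := (@lebesgue_measure R).

Lemma mxcont_cst (T : topologicalType) m n (A : 'M[C]_(m, n)) : mxcont (fun _ : T => A).
Proof. by move=> i j; split=> x; exact: cvg_cst. Qed.

Lemma mxcontM (T : topologicalType) m n p (F : T -> 'M[C]_(m, n)) (G : T -> 'M[C]_(n, p)) :
  mxcont F -> mxcont G -> mxcont (fun x => F x *m G x).
Proof.
apply: mxallM => [c x|f g cf cg x|f g cf cg x]; first exact: cvg_cst.
  by apply: cvgD; [exact: cf|exact: cg].
by apply: cvgM; [exact: cf|exact: cg].
Qed.

Lemma mxcontD (T : topologicalType) m n (F G : T -> 'M[C]_(m, n)) :
  mxcont F -> mxcont G -> mxcont (fun x => F x + G x).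
Proof. by apply: mxallD => f g cf cg x; apply: cvgD; [exact: cf|exact: cg]. Qed.

Lemma mxcontN (T : topologicalType) m n (F : T -> 'M[C]_(m, n)) :
  mxcont F -> mxcont (fun x => - F x).
Proof.
apply: mxallN => [c x|f g cf cg x|f g cf cg x]; first exact: cvg_cst.
  by apply: cvgD; [exact: cf|exact: cg].
by apply: cvgM; [exact: cf|exact: cg].
Qed.

Lemma mxcont_sum (T : topologicalType) I (r : seq I) P m n (F : I -> T -> 'M[C]_(m, n)) :
  (forall i, mxcont (F i)) -> mxcont (fun x => \sum_(i <- r | P i) F i x).
Proof.
apply: mxall_sum => [c x|f g cf cg x]; first exact: cvg_cst.
by apply: cvgD; [exact: cf|exact: cg].
Qed.

Lemma mxcont_section m n (F : R * R -> 'M[C]_(m, n)) s :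
  mxcont F -> mxcont (fun t => F (s, t)).
Proof.
by move=> cF i j; have [cr ci] := cF i j; split;
  [exact: (continuous_section cr)|exact: (continuous_section ci)].
Qed.

Lemma Rintegral_sum_continuous I (r : seq I) (f : I -> R -> R) a b :
  (forall i, continuous (f i)) ->
  continuous (fun t => \sum_(i <- r) f i t) /\
  Rintegral mu `[a, b] (fun t => \sum_(i <- r) f i t) =
  \sum_(i <- r) Rintegral mu `[a, b] (f i).
Proof.
move=> cf; elim: r => [|i r [cS IH]].
  rewrite big_nil; under eq_fun do rewrite big_nil.
  split; first by move=> x; exact: cvg_cst.
  have [ab|ba] := leP a b; first by rewrite Rintegral_segment_cst// mul0r.
  by rewrite Rintegral_segment0// ltW.
rewrite big_cons; under eq_fun do rewrite big_cons.
split; first by move=> x; apply: cvgD; [exact: cf|exact: cS].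
by rewrite RintegralD ?IH//; exact: integrable_continuous.
Qed.

Definition cint a b (f : R -> C) : C := clift (Rintegral mu `[a, b]) f.

Lemma cintD a b f g : call (fun u : R -> R => continuous u) f ->
  call (fun u : R -> R => continuous u) g ->
  cint a b (fun t => f t + g t) = cint a b f + cint a b g.
Proof.
move=> [fr fi] [gr gi]; rewrite /cint /clift.
under eq_Rintegral do rewrite complexReD.
under [X in _ +i* X]eq_Rintegral do rewrite complexImD.
by rewrite !RintegralD//; exact: integrable_continuous.
Qed.

Lemma cintZ a b c f : call (fun u : R -> R => continuous u) f ->
  cint a b (fun t => c * f t) = c * cint a b f.
Proof.
move=> [fr fi]; rewrite /cint /clift.
have cZ (u : R -> R) d : continuous u -> continuous (fun t => d * u t).
  by move=> cu x; apply: cvgM; [exact: cvg_cst|exact: cu].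
under eq_Rintegral do rewrite Defs.ReM.
under [X in _ +i* X]eq_Rintegral do rewrite Defs.ImM.
rewrite !RintegralD//; try by apply: integrable_continuous; do ?apply: (cZ).
have iZ (u : R -> R) d : continuous u -> Rintegral mu `[a, b] (fun t => d * u t) = d * Rintegral mu `[a, b] u.
  by move=> cu; rewrite RintegralZl //; exact: integrable_continuous.
rewrite !iZ//; last exact: cZ.
by rewrite mulN1r; case: c => x y; simpc.
Qed.

Lemma cint_sum I (r : seq I) a b (f : I -> R -> C) :
  (forall i, call (fun u : R -> R => continuous u) (f i)) ->
  cint a b (fun t => \sum_(i <- r) f i t) = \sum_(i <- r) cint a b (f i).
Proof.
move=> cf; rewrite /cint /clift.
under eq_Rintegral do rewrite raddf_sum.
under [X in _ +i* X]eq_Rintegral do rewrite raddf_sum.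
rewrite !(Rintegral_sum_continuous _ _ _ _).2; try by move=> i; have [] := cf i.
by elim: r => [|i r IH]; rewrite ?big_nil// !big_cons -IH; simpc.
Qed.

Lemma mxintE m n a b (F : R -> 'M[C]_(m, n)) i j :
  mxint a b F i j = cint a b (fun t => F t i j).
Proof. by rewrite mxE. Qed.

Lemma call_contM (T : topologicalType) (f g : T -> C) :
  call (fun u : T -> R => continuous u) f -> call (fun u : T -> R => continuous u) g ->
  call (fun u : T -> R => continuous u) (fun x => f x * g x).
Proof.
apply: callM => [c x|{}f {}g cf cg x|{}f {}g cf cg x]; first exact: cvg_cst.
  by apply: cvgD; [exact: cf|exact: cg].
by apply: cvgM; [exact: cf|exact: cg].
Qed.

Lemma call_cont_cst (T : topologicalType) (c : C) :
  call (fun u : T -> R => continuous u) (fun=> c).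
Proof. by split=> x; exact: cvg_cst. Qed.

Lemma mxint_mull m n p a b (A : 'M[C]_(m, n)) (F : R -> 'M[C]_(n, p)) :
  mxcont F -> mxint a b (fun t => A *m F t) = A *m mxint a b F.
Proof.
move=> cF; apply/matrixP => i j; rewrite mxintE [RHS]mxE.
under eq_fun do rewrite mxE.
rewrite cint_sum => [|k]; last by apply: call_contM; [exact: call_cont_cst|exact: cF].
by apply: eq_bigr => k _; rewrite mxintE cintZ.
Qed.

Lemma mxintD m n a b (F G : R -> 'M[C]_(m, n)) : mxcont F -> mxcont G ->
  mxint a b (fun t => F t + G t) = mxint a b F + mxint a b G.
Proof.
move=> cF cG; apply/matrixP => i j; rewrite mxintE [RHS]mxE !mxintE -cintD //.
by congr cint; apply/funext => t; rewrite mxE.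
Qed.

Lemma mxintN m n a b (F : R -> 'M[C]_(m, n)) : mxcont F ->
  mxint a b (fun t => - F t) = - mxint a b F.
Proof.
move=> cF; apply/matrixP => i j; rewrite mxintE [RHS]mxE !mxintE -mulN1r -cintZ //.
by congr cint; apply/funext => t; rewrite mxE mulN1r.
Qed.

Lemma eq_mxint m n a b (F G : R -> 'M[C]_(m, n)) :
  (forall t, a <= t <= b -> F t = G t) -> mxint a b F = mxint a b G.
Proof.
move=> FG; apply/matrixP => i j; rewrite !mxE /clift.
by congr (_ +i* _); apply: eq_Rintegral_segment => t tab; rewrite FG.
Qed.

Lemma mxint_block m1 m2 n1 n2 a b (A : R -> 'M[C]_(m1, n1)) (B : R -> 'M[C]_(m1, n2))
    (D : R -> 'M[C]_(m2, n1)) (E : R -> 'M[C]_(m2, n2)) :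
  mxint a b (fun t => block_mx (A t) (B t) (D t) (E t)) =
  block_mx (mxint a b A) (mxint a b B) (mxint a b D) (mxint a b E).
Proof.
apply/matrixP => i j; rewrite mxintE -(splitK i) -(splitK j).
case: (fintype.split i) => k; case: (fintype.split j) => l /=.
- by rewrite block_mxEul mxintE; congr cint; apply/funext => t; rewrite block_mxEul.
- by rewrite block_mxEur mxintE; congr cint; apply/funext => t; rewrite block_mxEur.
- by rewrite block_mxEdl mxintE; congr cint; apply/funext => t; rewrite block_mxEdl.
- by rewrite block_mxEdr mxintE; congr cint; apply/funext => t; rewrite block_mxEdr.
Qed.

Lemma mxint0 m n a b (F : R -> 'M[C]_(m, n)) : b <= a -> mxint a b F = 0.
Proof.
by move=> ba; apply/matrixP => i j; rewrite !mxE /clift !Rintegral_segment0.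
Qed.

Lemma mxint_0 m n a b : mxint a b (fun=> 0 : 'M[C]_(m, n)) = 0.
Proof.
have := mxint_mull a b (0 : 'M[C]_m) (@mxcont_cst R m n (0 : 'M[C]_(m, n))).
by rewrite !mul0mx.
Qed.

Lemma mxabs_mxint m n a b (F : R -> 'M[C]_(m, n)) (g : R -> R) :
  mxcont F -> continuous g -> (forall t, a <= t <= b -> mxabs (F t) <= g t) ->
  mxabs (mxint a b F) <= Rintegral mu `[a, b] g.
Proof.
move=> cF cg Fg.
have cN (u : R -> R) : continuous u -> continuous (fun x => `|u x|).
  by move=> cu x; apply: (continuous_comp (cu x)); exact: norm_continuous.
have cA i j : continuous (fun t => cabs (F t i j)).
  by have [cr ci] := cF i j; move=> x; apply: cvgD; apply: (cN).
apply: (@le_trans _ _ (Rintegral mu `[a, b] (fun t => mxabs (F t)))); last first.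
  by apply: le_Rintegral_segment => //; exact: continuous_mxabs.
rewrite /mxabs (Rintegral_sum_continuous _ _ _ _).2; last first.
  by move=> i; apply: (Rintegral_sum_continuous _ 0 0 (cA i)).1.
apply: ler_sum => i _; rewrite (Rintegral_sum_continuous _ _ _ (cA i)).2.
apply: ler_sum => j _; have [cr ci] := cF i j; rewrite mxE /cabs /clift /=.
rewrite RintegralD//; try by apply: integrable_continuous; apply: (cN).
by apply: lerD; apply: normr_Rintegral_segment => //; exact: (cN).
Qed.

Lemma mxcont_mxint m n b (F : R * R -> 'M[C]_(m, n)) : mxcont F ->
  mxcont (fun p : R * R => mxint p.2 b (fun t => F (p.1, t))).
Proof.
move=> cF i j; have [cr ci] := cF i j; split.
- by under eq_fun do rewrite mxE /=; exact: (@continuous_Rintegral _ _ b cr).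
- by under eq_fun do rewrite mxE /=; exact: (@continuous_Rintegral _ _ b ci).
Qed.

Lemma mxder_mxint_lower m n b (F : R -> 'M[C]_(m, n)) x : mxcont F -> x < b ->
  mxder (fun a => mxint a b F) (- F x) x.
Proof.
move=> cF xb i j; have [cr ci] := cF i j.
have := is_derive_Rintegral_lower cr xb; have := is_derive_Rintegral_lower ci xb.
rewrite /cder !mxE; case E : (F x i j) => [u v] /= d1 d2.
by split; [under eq_fun do rewrite mxE|under eq_fun do rewrite mxE].
Qed.

Lemma mxder_mxint_param m n a b s (F F' : R * R -> 'M[C]_(m, n)) :
  mxcont F -> mxcont F' ->
  (forall s t, mxder (fun s => F (s, t)) (F' (s, t)) s) ->
  mxder (fun s => mxint a b (fun t => F (s, t))) (mxint a b (fun t => F' (s, t))) s.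
Proof.
move=> cF cF' dF i j; have [cr ci] := cF i j; have [cr' ci'] := cF' i j.
rewrite !mxintE; split; under eq_fun do rewrite mxintE; rewrite /cint /clift /=.
- by apply: (is_derive_Rintegral_param _ _ _ cr cr') => s' t; have [] := dF s' t i j.
- by apply: (is_derive_Rintegral_param _ _ _ ci ci') => s' t; have [] := dF s' t i j.
Qed.

Lemma mxint_FTC m n a b (F D : R -> 'M[C]_(m, n)) : a <= b -> mxcont D ->
  (forall x, a <= x <= b -> mxder F (D x) x) -> mxint a b D = F b - F a.
Proof.
move=> ab cD dF; apply/matrixP => i j; rewrite mxintE /cint /clift.
have [cr ci] := cD i j.
have er := @Rintegral_FTC _ (fun x => complex.Re (F x i j)) _ a b ab
  (fun x _ => cr x) (fun x h => (dF x h i j).1).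
have ei := @Rintegral_FTC _ (fun x => complex.Im (F x i j)) _ a b ab
  (fun x _ => ci x) (fun x h => (dF x h i j).2).
rewrite er ei.
by rewrite !mxE; case: (F b i j) (F a i j) => [? ?] [? ?]; simpc.
Qed.

End MatrixIntegral.

(** * The Volterra operator and its weighted estimate *)

Section Volterra.
Context {R : realType}.
Local Notation C := R[i].
Local Notation mu := (@lebesgue_measure R).

(* The iterates of this operator on the constant function [1%:M] are the
   iterated integrals of X over the simplices t <= t_1 <= ... <= t_k <= b. *)
Definition volterra {n m} (X : R * R -> 'M[C]_n) (b : R) (F : R * R -> 'M[C]_(n, m)) :
    R * R -> 'M[C]_(n, m) :=
  fun p => mxint p.2 b (fun t => X (p.1, t) *m F (p.1, t)).

Definition dyson {n} (X : R * R -> 'M[C]_n) (b : R) (k : nat) : R * R -> 'M[C]_n :=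
  iter k (volterra X b) (fun=> 1%:M).

Lemma mxcont_volterra n m (X : R * R -> 'M[C]_n) b (F : R * R -> 'M[C]_(n, m)) k :
  mxcont X -> mxcont F -> mxcont (iter k (volterra X b) F).
Proof.
move=> cX cF; elim: k => [//|k IH] /=.
by apply: (@mxcont_mxint _ _ _ b (fun p => X p *m _ p)); exact: mxcontM.
Qed.

Lemma mxcont_dyson n (X : R * R -> 'M[C]_n) b k : mxcont X -> mxcont (dyson X b k).
Proof. by move=> cX; apply: mxcont_volterra => //; exact: mxcont_cst. Qed.

(* The weight [expR (2 * K * (b - t))] makes the operator contract by 1/2. *)
Lemma volterra_bound n m (X : R * R -> 'M[C]_n) a b (F : R * R -> 'M[C]_(n, m)) s K M k :
  0 < K -> mxcont X -> mxcont F ->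
  (forall t, a <= t <= b -> mxabs (X (s, t)) <= K) ->
  (forall t, a <= t <= b -> mxabs (F (s, t)) <= M) ->
  forall t, a <= t <= b ->
  mxabs (iter k (volterra X b) F (s, t)) <= M * 2^-1 ^+ k * expR (2 * K * (b - t)).
Proof.
move=> K0 cX cF XK FM; elim: k => [|k IH] t /andP[at_ tb] /=.
  rewrite expr0 mulr1 (le_trans (FM t _))//; first by rewrite at_.
  have M0 : 0 <= M by apply: le_trans (mxabs_ge0 _) (FM t _); rewrite at_.
  have e0 : 0 <= 2 * K * (b - t) by rewrite mulr_ge0 ?subr_ge0 ?mulr_ge0 ?(ltW K0).
  by rewrite ler_peMr// -[leLHS]expR0 ler_expR.
have M0 : 0 <= M by apply: le_trans (mxabs_ge0 _) (FM t _); rewrite at_.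
pose c := M * 2^-1 ^+ k.
have c0 : 0 <= c by rewrite mulr_ge0 // exprn_ge0 // invr_ge0.
(* [g] dominates the integrand and [G] is an antiderivative of it: dividing the factor [K] by the
   rate [2 * K] leaves the 1/2. *)
pose g (u : R) : R := K * c * expR (2 * K * (b - u)).
pose G (u : R) : R := - (c / 2) * expR (2 * K * (b - u)).
have dE (u : R) : is_derive u (1 : R) (fun u : R => expR (2 * K * (b - u)) : R) (- (2 * K) * expR (2 * K * (b - u))).
  have d1 : is_derive u (1 : R) (fun u : R => 2 * K * (b - u) : R) (- (2 * K)).
    have := @is_deriveZ _ _ _ (fun u => b - u) (2 * K) u 1 _
      (is_deriveB (is_derive_cst b u 1) (is_derive_id u 1)).
    by rewrite sub0r /GRing.scale /= mulrN1.
  by apply: is_derive_eq (is_derive1_comp (is_derive_expR _) d1) _; rewrite [LHS]mulrC.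
have dG (u : R) : is_derive u (1 : R) G (g u).
  apply: is_derive_eq (@is_deriveZ _ _ _ _ (- (c / 2)) u 1 _ (dE u)) _.
  by rewrite /g /GRing.scale /=; field.
have cg : continuous g.
  move=> u; apply: cvgM; first exact: cvg_cst.
  by have [/derivable1_diffP/differentiable_continuous + _] := dE u.
apply: (@le_trans _ _ (Rintegral mu `[t, b] g)).
  apply: mxabs_mxint => //.
    apply: (@mxcontM _ _ _ _ _ (fun u => X (s, u)) (fun u => iter k (volterra X b) F (s, u))).
      exact: mxcont_section.
    by apply: mxcont_section; exact: mxcont_volterra.
  move=> u /andP[tu ub]; have au : a <= u <= b by rewrite (le_trans at_ tu).
  apply: le_trans (mxabsM _ _) _; rewrite /g -mulrA ler_pM ?mxabs_ge0//.
    exact: XK.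
  exact: IH.
have -> := @Rintegral_FTC _ G g t b tb (fun u _ => cg u) (fun u _ => dG u).
rewrite /G subrr mulr0 expR0 mulr1 mulNr opprK exprS addrC.
rewrite (_ : M * (2^-1 * 2^-1 ^+ k) = c / 2); last by rewrite /c; ring.
by rewrite gerDl oppr_le0 divr_ge0.
Qed.

Lemma volterraD n m (X : R * R -> 'M[C]_n) b (F G : R * R -> 'M[C]_(n, m)) :
  mxcont X -> mxcont F -> mxcont G ->
  volterra X b (fun p => F p + G p) = (fun p => volterra X b F p + volterra X b G p).
Proof.
move=> cX cF cG; apply/funext => -[s t]; rewrite /volterra /=.
rewrite -mxintD; try by exact: (mxcont_section s (mxcontM cX _)).
by apply: eq_mxint => u _; rewrite mulmxDr.
Qed.

Lemma volterra_dyson_sum n (X : R * R -> 'M[C]_n) b N : mxcont X ->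
  volterra X b (fun p => \sum_(k < N) dyson X b k p) =
  (fun p => \sum_(k < N) dyson X b k.+1 p).
Proof.
move=> cX; elim: N => [|N IH].
  apply/funext => -[s t]; under eq_fun do rewrite big_ord0; rewrite big_ord0.
  rewrite /volterra /=; under eq_fun do rewrite mulmx0; exact: mxint_0.
under eq_fun do rewrite big_ord_recr.
rewrite /= volterraD ?IH//; last exact: mxcont_dyson.
  by apply/funext => p; rewrite big_ord_recr.
by apply: mxcont_sum => k; exact: mxcont_dyson.
Qed.

End Volterra.

(** * Linear differential equations with continuous coefficients *)

Section LinearODE.
Context {R : realType}.
Local Notation C := R[i].

Lemma mxcont_bounded m n (F : R -> 'M[C]_(m, n)) a b : mxcont F ->
  exists2 K, 0 < K & forall t, a <= t <= b -> mxabs (F t) <= K.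
Proof.
move=> cF; have [ab|ba] := leP a b; last first.
  by exists 1 => // t /andP[at_ tb]; move: (le_trans at_ tb); rewrite leNgt ba.
have [c _ cM] := EVT_max ab (continuous_subspaceT (continuous_mxabs cF)).
exists (mxabs (F c) + 1); first by rewrite ltr_wpDl ?mxabs_ge0.
by move=> t tab; rewrite (le_trans (cM t _)) ?in_itv// lerDl.
Qed.

Lemma mxcont_comp (T U : topologicalType) m n (F : U -> 'M[C]_(m, n)) (h : T -> U) :
  mxcont F -> continuous h -> mxcont (fun x => F (h x)).
Proof.
move=> cF ch i j; have [cr ci] := cF i j; split=> x.
- exact: (@continuous_comp _ _ _ h (fun y => complex.Re (F y i j)) x (ch x) (cr _)).
- exact: (@continuous_comp _ _ _ h (fun y => complex.Im (F y i j)) x (ch x) (ci _)).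
Qed.

Lemma mxcont_snd m n (F : R -> 'M[C]_(m, n)) :
  mxcont F -> mxcont (fun p : R * R => F p.2).
Proof. by move=> cF; apply: (mxcont_comp cF) => p; exact: cvg_snd. Qed.

(** The usual e/3 argument; the constant [c] may depend on the point, since uniformity is local. *)
Lemma mxcont_unif m n (S : nat -> R -> 'M[C]_(m, n)) (Y : R -> 'M[C]_(m, n)) :
  (forall N, mxcont (S N)) ->
  (forall t0 : R, exists c, \forall t \near t0, forall N, mxabs (Y t - S N t) <= c * 2^-1 ^+ N) ->
  mxcont Y.
Proof.
move=> cS YS.
have unif (u : nat -> R -> R) (y : R -> R) : (forall N, continuous (u N)) ->
    (forall t0 : R, exists c, \forall t \near t0, forall N, `|y t - u N t| <= c * 2^-1 ^+ N) ->
    continuous y.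
  move=> cu yu t0; have [c nc] := yu t0; apply/cvgrPdist_le => e e0.
  have e3 : 0 < e / 3 by rewrite divr_gt0.
  have [N cN] : exists N, c * 2^-1 ^+ N <= e / 3.
    have /cvgrPdist_le/(_ _ e3)[N _ /(_ N (leqnn N))] := half_exp_cvg0 c.
    by rewrite sub0r normrN => /(le_trans (ler_norm _)); exists N.
  have nu : \forall t \near t0, `|u N t0 - u N t| <= e / 3.
    by have /cvgrPdist_le := cu N t0; apply.
  have c0 := nbhs_singleton nc.
  near=> t.
  have h1 : `|y t - u N t| <= e / 3 by apply: le_trans cN; near: t; apply: filterS nc => t; exact.
  have h2 : `|u N t0 - u N t| <= e / 3 by near: t.
  have h3 : `|y t0 - u N t0| <= e / 3 by apply: le_trans cN; exact: c0.
  rewrite -(subrKA (u N t0)) -[u N t0 - _](subrKA (u N t)) [e](_ : _ = e / 3 + (e / 3 + e / 3)); last by field.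
  rewrite (le_trans (ler_normD _ _))// lerD// (le_trans (ler_normD _ _))// lerD//.
  by rewrite distrC.
move=> i j; split.
- apply: (unif (fun N t => complex.Re (S N t i j))) => [N|t0]; first by have [] := cS N i j.
  have [c nc] := YS t0; exists c; apply: filterS nc => t H N; apply: le_trans (H N).
  apply: le_trans (le_Re_mxabs _ i j); rewrite !mxE.
  by case: (Y t i j) (S N t i j) => [? ?] [? ?].
- apply: (unif (fun N t => complex.Im (S N t i j))) => [N|t0]; first by have [] := cS N i j.
  have [c nc] := YS t0; exists c; apply: filterS nc => t H N; apply: le_trans (H N).
  apply: le_trans (le_Im_mxabs _ i j); rewrite !mxE.
  by case: (Y t i j) (S N t i j) => [? ?] [? ?].
Unshelve. all: by end_near. Qed.

(** The Dyson series solves the integral equation [Y t = 1 + int_t^b X Y]. It runs backwards from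
    [b] because in the iterated integrals of BCS the lower end is the free one; this is the origin
    of the minus sign. *)
Lemma ode_left n (X : R -> 'M[C]_n) b : mxcont X ->
  exists Y : R -> 'M[C]_n, [/\ mxcont Y, Y b = 1%:M &
    forall x, x < b -> mxder Y (- (X x *m Y x)) x].
Proof.
move=> cX; pose X2 (p : R * R) := X p.2; have cX2 : mxcont X2 by exact: mxcont_snd.
pose S N t := \sum_(k < N) dyson X2 b k (0, t).
(* [Y] is frozen beyond [b], where the estimate of the series does not reach, so that it is
   continuous on the whole line. *)
pose Y t := mxlim (fun N => S N (Num.min t b)).
have cS N : mxcont (S N).
  apply: mxcont_sum => k; apply: (@mxcont_section R _ _ (dyson X2 b k) 0).
  exact: mxcont_dyson.
have Sb a : exists c, forall t, a <= t <= b ->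
    mxcvg (S ^~ t) (Y t) /\ forall N, mxabs (Y t - S N t) <= c * 2^-1 ^+ N.
  have [K K0 XK] := mxcont_bounded a b cX.
  pose M := mxabs (1%:M : 'M[C]_n); pose e := expR (2 * K * (b - a)).
  exists ((n * n)%:R * (4 * (M * e))) => t /andP[at_ tb].
  have B k : mxabs (dyson X2 b k (0, t)) <= M * e * 2^-1 ^+ k.
    have := @volterra_bound _ _ _ X2 a b (fun=> 1%:M) 0 K M k K0 cX2
      (mxcont_cst _ _) XK (fun _ _ => lexx _) t.
    rewrite at_ tb => /(_ isT) /le_trans; apply; rewrite [leRHS]mulrAC.
    have p0 : 0 <= M * 2^-1 ^+ k by rewrite mulr_ge0 ?mxabs_ge0 ?exprn_ge0 ?invr_ge0.
    have q0 : 0 <= 2 * K by rewrite mulr_ge0 // ltW.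
    by rewrite (ler_wpM2l p0)// ler_expR (ler_wpM2l q0)// lerB.
  have [L [cL HL]] := mx_half_geometric_cvg B.
  have -> : Y t = L by rewrite /Y (min_idPl tb); exact: mxcvg_lim.
  by split=> // N; apply: le_trans (HL N) _; rewrite !mulrA.
have YE t : Y t = Y (Num.min t b) by rewrite /Y -minA minxx.
have cY : mxcont Y.
  apply: (@mxcont_unif _ _ (fun N t => S N (Num.min t b))) => [N|t0].
    apply: (@mxcont_comp _ _ _ _ (S N)) => // t.
    by apply: continuous_min; [exact: cvg_id|exact: cvg_cst].
  have [c Hc] := Sb (Num.min t0 b - 1); exists c.
  near=> t => N; rewrite YE.
  have tt : t0 - 1 < t by near: t; apply: lt_nbhsr; rewrite gtrBl.
  apply: (Hc (Num.min t b) _).2; rewrite ge_min lexx orbT andbT le_min.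
  by rewrite !lerBlDr !ge_min ltW ?lerDl ?ler01 ?orbT//= -ltrBlDr.
have Yint t : t <= b -> Y t = 1%:M + mxint t b (fun u => X u *m Y u).
  move=> tb; have [c Hc] := Sb t; have [cvt _] := Hc t (ltac:(by rewrite lexx)).
  (* The shifted partial sums converge to [Y t] too, and they are 1 plus the integral of [X] times
     the unshifted ones; comparing the two limits gives the integral equation. *)
  have cvt1 : mxcvg (fun N => S N.+1 t) (Y t).
    move=> i j; have [? ?] := cvt i j; split.
      by rewrite (cvg_shiftS (fun N => complex.Re (S N t i j))).
    by rewrite (cvg_shiftS (fun N => complex.Im (S N t i j))).
  have SE N : S N.+1 t = 1%:M + mxint t b (fun u => X u *m S N u).
    rewrite /S big_ord_recl; congr (_ + _).
    by have := volterra_dyson_sum b N cX2 => /(congr1 (@^~ (0, t))) <-.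
  suff cv2 : mxcvg (fun N => S N.+1 t) (1%:M + mxint t b (fun u => X u *m Y u)).
    exact: mxcvg_uniq cvt1 cv2.
  apply: mxcvgP; have [K K0 XK] := mxcont_bounded t b cX.
  apply: (@squeeze_cvgr _ _ _ _ (cst 0) (fun N => K * c * (b - t) * 2^-1 ^+ N)).
  - apply: nearW => N; rewrite mxabs_ge0 /=.
    rewrite SE opprD addrACA subrr add0r -mxintN; last exact: mxcontM.
    rewrite -mxintD; [|exact: mxcontM|by apply: mxcontN; exact: mxcontM].
    apply: (@le_trans _ _ (Rintegral lebesgue_measure `[t, b] (fun=> K * (c * 2^-1 ^+ N)))).
      apply: mxabs_mxint.
      + by apply: mxcontD; [|apply: mxcontN]; exact: mxcontM.
      + exact: cst_continuous.
      + move=> u tub; rewrite -mulmxN -mulmxDr (le_trans (mxabsM _ _))//.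
        rewrite ler_pM ?mxabs_ge0 ?XK// -mxabsN opprB.
        exact: (Hc u tub).2.
    by rewrite Rintegral_segment_cst// le_eqVlt; apply/orP; left; apply/eqP; ring.
  - exact: cvg_cst.
  - exact: half_exp_cvg0.
exists Y; split=> //; first by rewrite Yint// mxint0// addr0.
move=> x xb; have cXY : mxcont (fun u => X u *m Y u) by exact: mxcontM.
have := mxderD (mxder_cst 1%:M x) (mxder_mxint_lower cXY xb); rewrite add0r.
apply: mxder_near; near=> t; apply/esym/Yint/ltW; near: t; exact: lt_nbhsl.
Unshelve. all: by end_near. Qed.

Lemma mx_const_segment m n (F : R -> 'M[C]_(m, n)) a b : mxcont F -> a <= b ->
  (forall x, a < x < b -> mxder F 0 x) -> F a = F b.
Proof.
move=> cF ab dF; apply/matrixP => i j; have [cr ci] := cF i j.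
have h (f : R -> R) : continuous f ->
    (forall x, a < x < b -> is_derive x (1 : R) f 0) -> f b = f a.
  move=> cf df; have [c _] := @MVT_segment _ f (fun=> 0) a b ab
    (fun x (h : x \in `]a, b[) => df x h) (continuous_subspaceT cf).
  by rewrite mul0r => /eqP; rewrite subr_eq0 => /eqP.
have dr x : a < x < b -> is_derive x (1 : R) (fun t => complex.Re (F t i j)) 0.
  by move=> /dF /(_ i j)[]; rewrite mxE.
have di x : a < x < b -> is_derive x (1 : R) (fun t => complex.Im (F t i j)) 0.
  by move=> /dF /(_ i j)[]; rewrite mxE.
have := h _ cr dr; have := h _ ci di.
by case: (F a i j) (F b i j) => [? ?] [? ?] /= -> ->.
Qed.

Lemma mx_const_on m n (F : R -> 'M[C]_(m, n)) a b : a <= b ->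
  (forall x, a <= x <= b -> mxder F 0 x) -> F a = F b.
Proof.
move=> ab dF; have := @mxint_FTC _ _ _ a b F (fun=> 0) ab (mxcont_cst _ _) dF.
by rewrite mxint_0 => /eqP; rewrite eq_sym subr_eq0 => /eqP.
Qed.

Lemma mxcont_tr (T : topologicalType) m n (F : T -> 'M[C]_(m, n)) :
  mxcont F -> mxcont (fun t => (F t)^T).
Proof.
move=> cF i j; rewrite (_ : (fun t => _) = (fun t => F t j i)); first exact: cF.
by apply/funext => t; rewrite mxE.
Qed.

(** The inverse of [W] is obtained as a solution: the transpose of [V] solves the equation with
    coefficient [- X^T], so [V W] has derivative 0 and equals its value 1 at [b]. *)
Lemma ode_fundamental n (X : R -> 'M[C]_n) b : mxcont X ->
  exists W V : R -> 'M[C]_n, forall x, x < b ->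
    [/\ mxder W (- (X x *m W x)) x, mxder V (V x *m X x) x & V x *m W x = 1%:M].
Proof.
move=> cX; have [W [cW Wb dW]] := ode_left b cX.
have cT : mxcont (fun t => - (X t)^T).
  exact/mxcontN/mxcont_tr.
have [Z [cZ Zb dZ]] := ode_left b cT.
have dV x : x < b -> mxder (fun t => (Z t)^T) ((Z x)^T *m X x) x.
  move=> /dZ /mxder_trmx; rewrite mulNmx opprK trmx_mul trmxK; exact.
have cV : mxcont (fun t => (Z t)^T).
  exact: mxcont_tr.
exists W, (fun t => (Z t)^T) => x xb; split; [exact: dW|exact: dV|].
rewrite (@mx_const_segment _ _ (fun t => (Z t)^T *m W t) x b) ?ltW//.
- by rewrite Wb Zb trmx1 mulmx1.
- exact: mxcontM.
- move=> y /andP[_ yb]; have := mxderM (dV y yb) (dW y yb).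
  by rewrite mulmxN mulmxA subrr.
Qed.

End LinearODE.

(** * Frames of flat sections: uniqueness, gluing and local existence *)

Section FlatFrames.
Context {R : realType}.
Local Notation C := R[i].

Section Bundle.
Context (E : vbundle R) (a : conn E).
Local Notation n := (vb_rank E).
Local Notation U := (@vb_U R E).
Local Notation g := (@vb_g R E).
Local Notation A := (cn_A a).
Local Notation frame := (vb_idx E -> R -> 'M[C]_n).

Lemma open_vb i : open (U i).
Proof. by have [] := vb_open i. Qed.

(** The gauge law, solved for the derivative of the transition function. *)
Lemma mxder_vb_g i j x : U i x -> U j x ->
  mxder (g i j) (g i j x *m A j x - A i x *m g i j x) x.
Proof.
move=> Ui Uj.
have -> : g i j x *m A j x - A i x *m g i j x = mxderiv (g i j) x.
  rewrite (cn_gauge a Ui Uj) mulmxDr !mulmxA (vb_inv Ui Uj) (vb_gK Ui Uj).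
  by rewrite !mul1mx addrAC subrr add0r.
exact: (mxsmooth_mxder (vb_smooth i j)).
Qed.

(* W is a frame of flat sections over I, written in each trivialization, and
   V is the dual frame. *)
Definition flat_on (I : set R) (W V : frame) : Prop :=
  [/\ forall i x, I x -> U i x -> mxder (W i) (- (A i x *m W i x)) x,
      forall i x, I x -> U i x -> mxder (V i) (V i x *m A i x) x,
      forall i x, I x -> U i x -> V i x *m W i x = 1%:M
    & forall i j x, I x -> U i x -> U j x -> W i x = g i j x *m W j x].

Lemma flat_onS (I J : set R) W V : J `<=` I -> flat_on I W V -> flat_on J W V.
Proof. by move=> JI [dW dV VW gW]; split=> *; [apply: dW|apply: dV|apply: VW|apply: gW] => //; exact: JI. Qed.

Lemma flat_dual I W V i j x : flat_on I W V -> I x -> U i x -> U j x ->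
  V j x = V i x *m g i j x.
Proof.
move=> [_ _ VW gW] Ix Ui Uj.
have h : (V i x *m g i j x) *m W j x = 1%:M by rewrite -mulmxA -gW // VW.
have /mulmx1C WV := VW j x Ix Uj.
by rewrite -[RHS]mulmx1 -WV mulmxA h mul1mx.
Qed.

Lemma flat_mulr I W V (B D : 'M[C]_n) : D *m B = 1%:M -> flat_on I W V ->
  flat_on I (fun i x => W i x *m B) (fun i x => D *m V i x).
Proof.
move=> DB [dW dV VW gW]; split=> [i x Ix Ui|i x Ix Ui|i x Ix Ui|i j x Ix Ui Uj].
- by rewrite mulmxA -mulNmx; apply: mxderMr; exact: dW.
- by rewrite -mulmxA; apply: mxderMl; exact: dV.
- by rewrite mulmxA -[_ *m V i x *m _]mulmxA VW // mulmx1.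
- by rewrite mulmxA -gW.
Qed.

(** The matrix [B = V W'] of the second frame in the first has derivative 0. Its transition factors
    cancel, so the chart in which it is computed may change from point to point. *)
Lemma flat_uniq (I : set R) W V W' V' : open I -> is_interval I -> I !=set0 ->
  flat_on I W V -> flat_on I W' V' ->
  exists B, forall i x, I x -> U i x -> W' i x = W i x *m B.
Proof.
move=> oI iI [x0 Ix0] fW fW'.
have [dW dV VW gW] := fW; have [dW' _ _ gW'] := fW'.
have /choice[c Uc] := vb_cover E.
pose B x := V (c x) x *m W' (c x) x.
have BE i x : I x -> U i x -> B x = V i x *m W' i x.
  move=> Ix Ui; rewrite /B (flat_dual fW Ix Ui (Uc x)) -mulmxA.
  by rewrite -gW'.
have dB x : I x -> mxder B 0 x.
  move=> Ix; have := mxderM (dV _ x Ix (Uc x)) (dW' _ x Ix (Uc x)).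
  rewrite mulmxN mulmxA subrr; apply: mxder_near.
  have nI : nbhs x I by exact: open_nbhs_nbhs.
  have nU : nbhs x (U (c x)) by apply: open_nbhs_nbhs; split=> //; exact: open_vb.
  by apply: filterS2 nI nU => y Iy Uy; rewrite (BE (c x)).
have cB x y : I x -> I y -> x <= y -> B x = B y.
  by move=> Ix Iy xy; apply: mx_const_on => // z zxy; apply: dB; exact: (iI x y).
exists (B x0) => i x Ix Ui.
have -> : B x0 = B x by have [xx|/ltW xx] := leP x0 x; [|symmetry]; exact: cB.
by rewrite (BE i)// mulmxA (mulmx1C (VW i x Ix Ui)) mul1mx.
Qed.

(** On the connected overlap the frames differ by a constant [B]. Correcting the second frame by [B]
    makes them agree there, and being flat is a local condition. *)
Lemma flat_glue (I J : set R) W V W' V' : open I -> open J ->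
  is_interval I -> is_interval J -> I `&` J !=set0 ->
  flat_on I W V -> flat_on J W' V' -> exists W2 V2, flat_on (I `|` J) W2 V2.
Proof.
move=> oI oJ iI iJ [y [Iy Jy]] fW fW'.
have oIJ : open (I `&` J) by exact: openI.
have iIJ : is_interval (I `&` J).
  by move=> u v [? ?] [? ?] z uv; split; [apply: (iI u v)|apply: (iJ u v)].
have IJ0 : I `&` J !=set0 by exists y.
have fI : flat_on (I `&` J) W V by apply: flat_onS fW => ? [].
have fJ : flat_on (I `&` J) W' V' by apply: flat_onS fW' => ? [].
have [B HB'] := flat_uniq oIJ iIJ IJ0 fJ fI.
have HB i x : I x -> J x -> U i x -> W i x = W' i x *m B by move=> Ix Jx; exact: HB'.
have [c Uc] := vb_cover E y.
have DB : V c y *m W' c y *m B = 1%:M.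
  by case: fW => _ _ VW _; rewrite -mulmxA -HB // VW.
set D := V c y *m W' c y in DB.
have [dW dV VW gW] := fW.
have fW2 := flat_mulr DB fW'; have [dW' dV' VW' gW'] := fW2.
pose W2 i x := if `[< I x >] then W i x else W' i x *m B.
pose V2 i x := if `[< I x >] then V i x else D *m V' i x.
have W2I i x : I x -> W2 i x = W i x by move=> Ix; rewrite /W2 asboolT.
have V2I i x : I x -> V2 i x = V i x by move=> Ix; rewrite /V2 asboolT.
have W2J i x : J x -> U i x -> W2 i x = W' i x *m B.
  by move=> Jx Ui; rewrite /W2; case: asboolP => // Ix; exact: HB.
have V2J i x : J x -> U i x -> V2 i x = D *m V' i x.
  move=> Jx Ui; rewrite /V2; case: asboolP => // Ix.
  have := VW' i x Jx Ui; rewrite -HB // => h.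
  by rewrite -[LHS]mul1mx -h -mulmxA (mulmx1C (VW i x Ix Ui)) mulmx1.
have nO (K : set R) i x : open K -> K x -> U i x -> nbhs x (K `&` U i).
  by move=> oK Kx Ui; apply: open_nbhs_nbhs; split=> //; apply: openI => //; exact: open_vb.
exists W2, V2; split.
- move=> i x [Ix|Jx] Ui.
  + rewrite W2I//; apply: mxder_near (dW i x Ix Ui).
    by apply: filterS (nO _ _ _ oI Ix Ui) => z [Iz _]; rewrite W2I.
  + rewrite W2J//; apply: mxder_near (dW' i x Jx Ui).
    by apply: filterS (nO _ _ _ oJ Jx Ui) => z [Jz Uz]; rewrite W2J.
- move=> i x [Ix|Jx] Ui.
  + rewrite V2I//; apply: mxder_near (dV i x Ix Ui).
    by apply: filterS (nO _ _ _ oI Ix Ui) => z [Iz _]; rewrite V2I.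
  + rewrite V2J//; apply: mxder_near (dV' i x Jx Ui).
    by apply: filterS (nO _ _ _ oJ Jx Ui) => z [Jz Uz]; rewrite V2J.
- move=> i x [Ix|Jx] Ui; first by rewrite V2I// W2I//; exact: VW.
  by rewrite V2J// W2J//; exact: VW'.
- move=> i j x [Ix|Jx] Ui Uj; first by rewrite !W2I//; exact: gW.
  by rewrite !W2J//; exact: gW'.
Qed.

(** Retraction of the line onto [[c, d]]. The values of [cn_A] outside its chart are arbitrary;
    composing with the retraction gives a function continuous on all of R that agrees with it on the
    segment. *)
Definition clamp (c d t : R) : R := Num.max c (Num.min d t).

Lemma clamp_in c d t : c <= d -> c <= clamp c d t <= d.
Proof. by move=> cd; rewrite /clamp le_max lexx /= ge_max cd ge_min lexx. Qed.

Lemma clamp_id c d t : c <= t <= d -> clamp c d t = t.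
Proof. by move=> /andP[ct td]; rewrite /clamp (min_idPr td) (max_idPr ct). Qed.

Lemma continuous_clamp c d : continuous (clamp c d).
Proof.
move=> t; apply: continuous_max; first exact: cvg_cst.
by apply: continuous_min; [exact: cvg_cst|exact: cvg_id].
Qed.

Lemma mxcont_clamp m k (S : set R) (F : R -> 'M[C]_(m, k)) c d : mxsmooth S F ->
  c <= d -> (forall t, c <= t <= d -> S t) -> mxcont (fun t => F (clamp c d t)).
Proof.
move=> sF cd cdS i j; have [fr fi] := sF i j.
split=> t.
- apply: (@continuous_comp _ _ _ (clamp c d) (fun y => complex.Re (F y i j))).
    exact: continuous_clamp.
  by have [] := fr [::] _ (cdS _ (clamp_in t cd)).
- apply: (@continuous_comp _ _ _ (clamp c d) (fun y => complex.Im (F y i j))).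
    exact: continuous_clamp.
  by have [] := fi [::] _ (cdS _ (clamp_in t cd)).
Qed.

(** The equation is solved in the single chart [i0] and the transition functions carry the solution
    to the other charts, where the terms with [A i0] cancel by [mxder_vb_g]. *)
Lemma flat_local i0 c d : c <= d -> (forall t, c <= t <= d -> U i0 t) ->
  exists W V, flat_on `]c, d[ W V.
Proof.
move=> cd cdU.
have cX := mxcont_clamp (cn_smooth a i0) cd cdU.
have [Y [Z YZ]] := ode_fundamental d cX.
have YZ' x : `]c, d[%classic x -> [/\ U i0 x, mxder Y (- (A i0 x *m Y x)) x,
    mxder Z (Z x *m A i0 x) x & Z x *m Y x = 1%:M].
  rewrite /= in_itv /= => /andP[cx xd]; have cxd : c <= x <= d by rewrite !ltW.
  by have := YZ x xd; rewrite clamp_id // => -[? ? ?]; split=> //; exact: cdU.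
exists (fun i x => g i i0 x *m Y x), (fun i x => Z x *m g i0 i x).
split=> [i x /YZ'[U0 dY dZ ZY] Ui|i x /YZ'[U0 dY dZ ZY] Ui|i x /YZ'[U0 dY dZ ZY] Ui|i j x /YZ'[U0 dY dZ ZY] Ui Uj].
- have := mxderM (mxder_vb_g Ui U0) dY; rewrite mulmxN mulmxBl -!mulmxA.
  by rewrite addrAC subrr add0r.
- have := mxderM dZ (mxder_vb_g U0 Ui); rewrite mulmxBr !mulmxA.
  by rewrite addrCA subrr addr0.
- by rewrite mulmxA -[_ *m _ *m g i i0 x]mulmxA vb_gK // mulmx1.
- by rewrite mulmxA vb_cocycle.
Qed.

(** A Lebesgue number of the cover. Compactness gives it on [[0, 1]], and periodicity of the charts
    moves any point there by its integer part. *)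
Lemma vb_lebesgue : exists2 dl : R, 0 < dl &
  forall x, exists i, forall t, x - dl <= t <= x + dl -> U i t.
Proof.
have := @segment_compact R 0 1; rewrite compact_near_coveringP.
move=> /(_ R (0 : R)^'+ (fun dl x => exists i, forall t, x - dl <= t <= x + dl -> U i t) _) H.
have HN : \forall dl \near (0 : R)^'+, `[0, 1] `<=` (fun x => exists i, forall t, x - dl <= t <= x + dl -> U i t).
  apply: H => x _; have [i Ui] := vb_cover E x.
  have /nbhs_ballP[e /= e0 xe] : nbhs x (U i) by apply: open_nbhs_nbhs; split=> //; exact: open_vb.
  exists (ball x (e / 3), [set dl | dl < e / 3]) => /=.
    split; first by apply: nbhsx_ballx; rewrite divr_gt0.
    by apply: nbhs_right_lt; rewrite divr_gt0.
  move=> -[y dl] /= [xy dle]; exists i => t /andP[ty yt]; apply: xe.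
  move: xy; rewrite /ball /= => xy; rewrite -(subrKA y) (le_lt_trans (ler_normD _ _))//.
  have : `|y - t| <= dl by rewrite ler_norml; apply/andP; split; lra.
  move: xy dle e0; lra.
have nr : \forall dl \near (0 : R)^'+, 0 < dl by exact: nbhs_right_gt.
have [dl [dl0 Hdl]] := filter_ex (filterI nr HN); exists dl => // x.
have cU i (k : int) t : U i (t + k%:~R) <-> U i t.
  have pU y : U i (y + 1) <-> U i y by have [_ /(_ y)] := vb_open i.
  elim/int_rec: k t => [|k IH|k IH] t; first by rewrite addr0.
    by rewrite -addn1 PoszD intrD addrA pU.
  have tk : t + (- k.+1%:Z)%:~R + 1 = t + (- k%:Z)%:~R.
    by rewrite !rmorphN /= -addn1 PoszD intrD opprD -!addrA addNr addr0.
  by rewrite -(pU (t + (- k.+1%:Z)%:~R)) tk IH.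
pose k := Num.floor x; have := floor_itv x; rewrite -/k => /andP[kx /ltW xk].
have [|i Hi] := Hdl (x - k%:~R).
  rewrite /= in_itv /= subr_ge0 lerBlDl.
  by rewrite kx; move: xk; rewrite intrD.
exists i => t /andP[xt tx]; rewrite -(cU i (- k)); apply: Hi.
by rewrite rmorphN /= addrAC lerB // -addrA [- _ + _]addrC addrA lerB.
Qed.

End Bundle.
End FlatFrames.

(** * Global flat frames and the monodromy matrix *)

Section Monodromy.
Context {R : realType}.
Local Notation C := R[i].

Section Bundle.
Context (E : vbundle R) (a : conn E).
Local Notation n := (vb_rank E).
Local Notation U := (@vb_U R E).
Local Notation g := (@vb_g R E).
Local Notation A := (cn_A a).

Lemma open_itvoo (c d : R) : open [set` `]c, d[] /\ is_interval [set` `]c, d[].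
Proof. by split; [exact: interval_open|exact: interval_is_interval]. Qed.

(** Each step enlarges the interval by [dl / 2] on both sides, gluing on local frames of radius [dl]
    centred at its two ends, so that every overlap is nonempty. *)
Lemma flat_segment (r : R) : exists W V, flat_on a `]- r, r[ W V.
Proof.
have [dl dl0 HU] := vb_lebesgue E.
have loc x : exists W V, flat_on a `]x - dl, x + dl[ W V.
  by have [i Hi] := HU x; apply: (flat_local a _ Hi); rewrite lerD // ge0_cp // ltW.
have gl c d c' d' p q y : (exists W V, flat_on a `]c, d[ W V) ->
    (exists W V, flat_on a `]c', d'[ W V) ->
    y \in `]c, d[ -> y \in `]c', d'[ ->
    `]p, q[ `<=` `]c, d[ `|` `]c', d'[ -> exists W V, flat_on a `]p, q[ W V.
  move=> [W [V fW]] [W' [V' fW']] yc yc' pq.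
  have [oc ic] := open_itvoo c d; have [oc' ic'] := open_itvoo c' d'.
  have [|W2 [V2 f2]] := flat_glue oc oc' ic ic' _ fW fW'; first by exists y.
  by exists W2, V2; exact: flat_onS f2.
have step m : exists W V, flat_on a `]- (dl + m%:R * (dl / 2)), dl + m%:R * (dl / 2)[ W V.
  elim: m => [|m IH].
    rewrite mul0r addr0; have [W [V fW]] := loc 0; exists W, V.
    by move: fW; rewrite sub0r add0r.
  set r0 := dl + m%:R * (dl / 2) in IH *.
  have r0dl : dl <= r0 by rewrite lerDl mulr_ge0 // divr_ge0 // ltW.
  have -> : dl + m.+1%:R * (dl / 2) = r0 + dl / 2 by rewrite /r0 -natr1; ring.
  have IH2 : exists W V, flat_on a `]- r0, r0 + dl[ W V.
    apply: (gl _ _ _ _ _ _ (r0 - dl / 2) IH (loc r0)); rewrite ?in_itv /=.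
    - by apply/andP; split; lra.
    - by apply/andP; split; lra.
    - move=> z; rewrite /= !in_itv /= => /andP[z1 z2].
      have [zr|rz] := ltP z r0; first by left; rewrite /= ?in_itv /= z1.
      by right; rewrite /= ?in_itv /= z2 andbT; lra.
  apply: (gl _ _ _ _ _ _ (- r0 + dl / 2) IH2 (loc (- r0))); rewrite ?in_itv /=.
  - by apply/andP; split; lra.
  - by apply/andP; split; lra.
  - move=> z; rewrite /= !in_itv /= => /andP[z1 z2].
    have [zr|rz] := ltP (- r0) z; first by left; rewrite /= ?in_itv /=; lra.
    by right; rewrite /= ?in_itv /=; apply/andP; split; lra.
have [W [V fW]] := step (Num.truncn (r / (dl / 2))).+1; exists W, V.
apply: flat_onS fW => z; rewrite /= !in_itv /= => /andP[z1 z2].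
have : r <= (Num.truncn (r / (dl / 2))).+1%:R * (dl / 2).
  rewrite -ler_pdivrMr ?divr_gt0//; exact/ltW/truncnS_gt.
by move=> h; apply/andP; split; lra.
Qed.

(** The frames on the growing intervals are normalized to 1 at the point 0 in one chart. By
    uniqueness each extends the previous ones, so near x every interval containing x yields the same
    frame. *)
Lemma flat_global : exists W V, flat_on a setT W V.
Proof.
have [i0 U0] := vb_cover E 0.
pose I (m : nat) : set R := `](- m.+1%:R : R), m.+1%:R[%classic.
have I0 m : I m 0 by rewrite /I /= in_itv /= oppr_lt0 ltr0n.
have /choice[F HF] : forall m, exists WV : (vb_idx E -> R -> 'M[C]_n) * (vb_idx E -> R -> 'M[C]_n),
    flat_on a (I m) WV.1 WV.2 /\ WV.1 i0 0 = 1%:M.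
  move=> m; have [W [V fW]] := flat_segment m.+1%:R.
  have VW : V i0 0 *m W i0 0 = 1%:M by case: (fW) => _ _ + _; apply=> //; exact: (I0 m).
  exists (fun i x => W i x *m V i0 0, fun i x => W i0 0 *m V i x) => /=.
  split; last exact: mulmx1C.
  by apply: flat_mulr => //; exact: mulmx1C.
have II m m' x : (m <= m')%N -> I m x -> I m' x.
  move=> mm; rewrite /I /= !in_itv /= => /andP[x1 x2].
  have : m.+1%:R <= m'.+1%:R :> R by rewrite ler_nat ltnS.
  by move=> h; apply/andP; split; lra.
have agree m m' i x : (m <= m')%N -> I m x -> U i x ->
    (F m).1 i x = (F m').1 i x /\ (F m).2 i x = (F m').2 i x.
  move=> mm Ix Ui; have [fm m1] := HF m; have [fm' m1'] := HF m'.
  have fm2 : flat_on a (I m) (F m').1 (F m').2 by apply: flat_onS fm' => y; exact: II.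
  have [oI iI] := open_itvoo (- m.+1%:R) m.+1%:R.
  have [|B HB] := flat_uniq oI iI _ fm fm2; first by exists 0; exact: (I0 m).
  have B1 : B = 1%:M by have := HB i0 0 (I0 m) U0; rewrite m1 m1' mul1mx.
  have WE : (F m).1 i x = (F m').1 i x by rewrite HB // B1 mulmx1.
  split=> //; have [_ _ VW _] := fm; have [_ _ VW' _] := fm2.
  have := VW i x Ix Ui; rewrite WE => h.
  by rewrite -[LHS]mulmx1 -(mulmx1C (VW' i x Ix Ui)) mulmxA h mul1mx.
pose N (x : R) := Num.truncn `|x|.
have NI x : I (N x) x by rewrite /I /= in_itv /= -ltr_norml truncnS_gt.
have agN x m i : I m x -> U i x ->
    (F (N x)).1 i x = (F m).1 i x /\ (F (N x)).2 i x = (F m).2 i x.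
  move=> Ix Ui; have [h|/ltnW h] := leqP (N x) m; first exact: agree.
  by have [-> ->] := agree _ _ i x h Ix Ui.
pose W i x := (F (N x)).1 i x; pose V i x := (F (N x)).2 i x.
have nE i x : U i x -> \forall y \near x, I (N x) y /\ U i y.
  move=> Ui; have [oI _] := open_itvoo (- (N x).+1%:R) (N x).+1%:R.
  have : nbhs x (I (N x) `&` U i); last by apply: filterS.
  apply: open_nbhs_nbhs; split; last by split=> //; exact: NI.
  by apply: openI => //; exact: open_vb.
exists W, V; split.
- move=> i x _ Ui; have [[dW _ _ _] _] := HF (N x).
  apply: mxder_near (dW i x (NI x) Ui).
  by apply: filterS (nE i x Ui) => y [Iy Uy]; rewrite /W (agN y (N x) i Iy Uy).1.
- move=> i x _ Ui; have [[_ dV _ _] _] := HF (N x).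
  apply: mxder_near (dV i x (NI x) Ui).
  by apply: filterS (nE i x Ui) => y [Iy Uy]; rewrite /V (agN y (N x) i Iy Uy).2.
- by move=> i x _ Ui; have [[_ _ VW _] _] := HF (N x); exact: VW.
- by move=> i j x _ Ui Uj; have [[_ _ _ gW] _] := HF (N x); exact: gW.
Qed.

Lemma csmooth_cderiv (S : set R) (f : R -> C) : open S -> csmooth S f -> csmooth S (cderiv f).
Proof.
move=> oS [fr fi]; split; rewrite /cderiv /clift /=.
- by under eq_fun do rewrite derive1E; exact: (@smoothDr R R S _ 1 fr).
- by under eq_fun do rewrite derive1E; exact: (@smoothDr R R S _ 1 fi).
Qed.

Lemma mxsmooth_mxderiv m k (S : set R) (F : R -> 'M[C]_(m, k)) :
  open S -> mxsmooth S F -> mxsmooth S (mxderiv F).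
Proof.
by move=> oS sF i j; under eq_fun do rewrite mxE; exact: csmooth_cderiv.
Qed.

Lemma mxsmoothN m k (S : set R) (F : R -> 'M[C]_(m, k)) :
  mxsmooth S F -> open S -> mxsmooth S (fun x => - F x).
Proof.
move=> sF oS; under eq_fun do rewrite -scaleN1r.
exact: mxsmoothZ oS (csmooth_cst _ _) sF.
Qed.

(* The derivative of tr (P W) is tr ((P' - P B) W) if W' = - B W, so the real
   parts of the functions tr (P W) form a class closed under differentiation. *)
Lemma linear_ode_smooth m (S : set R) (B W : R -> 'M[C]_m) : open S -> mxsmooth S B ->
  (forall x, S x -> mxder W (- (B x *m W x)) x) -> mxsmooth S W.
Proof.
move=> oS sB dW.
pose K (f : R -> R) := exists2 P : R -> 'M[C]_m, mxsmooth S P &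
  forall x, S x -> f x = complex.Re (\tr (P x *m W x)).
have dK P x : mxsmooth S P -> S x ->
    is_derive x (1 : R) (fun y => complex.Re (\tr (P y *m W y)))
      (complex.Re (\tr ((mxderiv P x - P x *m B x) *m W x))).
  move=> sP Sx.
  have := mxderM (mxsmooth_mxder sP Sx) (dW x Sx).
  rewrite mulmxN mulmxA -mulmxBl => dPW.
  have : cder (fun y => \tr (P y *m W y)) (\tr ((mxderiv P x - P x *m B x) *m W x)) x.
    by apply: cder_sum => i; exact: dPW.
  by case.
have Ksmooth : forall f, K f -> smooth S f.
  apply: smooth_class => //.
  - move=> f x [P sP fE] Sx; apply: (@near_eq_derivable _ _ _ (fun y => complex.Re (\tr (P y *m W y)))).
    + have : nbhs x S by exact: open_nbhs_nbhs.
      by apply: filterS => y /fE.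
    + by have [] := dK P x sP Sx.
  - move=> f v [P sP fE].
    exists (fun x => complex.Re (\tr ((v%:C *: (mxderiv P x - P x *m B x)) *m W x))).
      exists (fun x => v%:C *: (mxderiv P x - P x *m B x)); last by [].
      apply: (mxsmoothZ oS (csmooth_cst _ _)).
      apply: (mxsmoothD oS (mxsmooth_mxderiv oS sP)).
      exact: (mxsmoothN (mxsmooth_mul oS sP sB) oS).
    move=> x Sx; have -> : 'D_1 f x = 'D_1 (fun y => complex.Re (\tr (P y *m W y))) x.
      apply: near_eq_derive; have : nbhs x S by exact: open_nbhs_nbhs.
      by apply: filterS => y /fE.
    have [_ ->] := dK P x sP Sx.
    by rewrite -scalemxAl mxtraceZ; case: (\tr _) => u w /=; rewrite mul0r subr0.
have trE (z : C) i j x : \tr ((z *: delta_mx j i) *m W x) = z * W x i j.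
  rewrite -scalemxAl mxtraceZ; congr (_ * _).
  rewrite /mxtrace (bigD1 j) //= big1 ?addr0 => [|k kj].
    rewrite mxE (bigD1 i) //= big1 ?addr0 => [|l li]; rewrite mxE eqxx /= ?(negPf li) ?mul0r//.
    by rewrite eqxx mul1r.
  by rewrite mxE big1 // => l _; rewrite mxE (negPf kj) mul0r.
have sD (z : C) i j : mxsmooth S (fun=> z *: delta_mx j i : 'M[C]_m).
  by apply: mxsmooth_cst.
move=> i j; split; apply: Ksmooth.
- by exists (fun=> 1 *: delta_mx j i); [exact: sD|move=> x _; rewrite trE mul1r].
(* The imaginary part of z is the real part of [- 'i * z]. *)
- exists (fun=> (- 'i) *: delta_mx j i); [exact: sD|move=> x _; rewrite trE].
  by case: (W x i j) => u v; simpc.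
Qed.

(* The monodromy is inverted: the frame W satisfies [W (x + 1) = W x * H^-1]. *)
Definition monodromy (H : 'M[C]_n) : Prop :=
  exists W V, [/\ flat_on a setT W V, forall i, mxsmooth (U i) (W i)
    & forall i x, U i x -> W i (x + 1) *m H = W i x].

Lemma vb_U_add1 i x : U i (x + 1) <-> U i x.
Proof. by have [_ ->] := vb_open i. Qed.

(** Charts, connection and transition functions being periodic, the translate of a flat frame by 1
    is again flat. The two differ by a constant matrix, whose inverse is [H]. *)
Lemma monodromy_exists : exists H, monodromy H.
Proof.
have [W [V fW]] := flat_global; have [dW dV VW gW] := fW.
have fW1 : flat_on a setT (fun i x => W i (x + 1)) (fun i x => V i (x + 1)).
  split=> [i x _ Ui|i x _ Ui|i x _ Ui|i j x _ Ui Uj].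
  - rewrite -(cn_periodic a Ui); apply: mxder_shift.
    by apply: dW => //; exact/vb_U_add1.
  - rewrite -(cn_periodic a Ui); apply: mxder_shift.
    by apply: dV => //; exact/vb_U_add1.
  - by apply: VW => //; exact/vb_U_add1.
  - rewrite -(@vb_periodic _ E i j x)//.
    by apply: gW => //; exact/vb_U_add1.
have [||B HB] := flat_uniq (@openT R) _ _ fW fW1.
- by [].
- by exists 0.
exists (invmx B); exists W, V; split=> // [i|].
  exact: (linear_ode_smooth (@open_vb _ E i) (cn_smooth a i) (fun x => dW i x I)).
move=> i x Ui; rewrite HB// -mulmxA mulmxV ?mulmx1//.
  have /mulmx1_unit[_] := VW i (x + 1) I ((vb_U_add1 i x).2 Ui).
  by rewrite HB // unitmx_mul => /andP[].
Qed.

End Bundle.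
End Monodromy.

(** * Monodromy under isomorphisms, direct sums and tensor products *)

Section MonodromyInvariance.
Context {R : realType}.
Local Notation C := R[i].

Section Bundle.
Context (E : vbundle R) (a : conn E).
Local Notation n := (vb_rank E).
Local Notation U := (@vb_U R E).

Lemma vb_U_addn i x k : U i x -> U i (x + k%:R).
Proof.
elim: k => [|k IH] Ui; first by rewrite addr0.
by rewrite -natr1 addrA; apply/vb_U_add1/IH.
Qed.

Lemma monodromy_iter (W : vb_idx E -> R -> 'M[C]_n) H i x k :
  (forall i x, U i x -> W i (x + 1) *m H = W i x) ->
  U i x -> W i (x + k%:R) *m H ^+ k = W i x.
Proof.
move=> WH Ui; elim: k => [|k IH]; first by rewrite addr0 expr0 mulmx1.
rewrite -natr1 addrA exprS -mulmxE mulmxA WH ?IH //.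
exact: vb_U_addn.
Qed.

Lemma monodromy_conn_eq (b : conn E) H : conn_eq a b -> monodromy a H -> monodromy b H.
Proof.
move=> ab [W [V [[dW dV VW gW] sW WH]]]; exists W, V; split=> //; split=> //.
- by move=> i x Ix Ui; rewrite -ab//; exact: dW.
- by move=> i x Ix Ui; rewrite -ab//; exact: dV.
Qed.

End Bundle.

(** [B] is rectangular because the ranks of isomorphic bundles are equal only a posteriori, so that
    [H] and [K] have different types. *)
Lemma conj_trace_expr m n (B : 'M[C]_(m, n)) (D : 'M[C]_(n, m)) (H : 'M[C]_m) (K : 'M[C]_n) k :
  B *m D = 1%:M -> D *m B = 1%:M -> H *m B = B *m K -> \tr (H ^+ k) = \tr (K ^+ k).
Proof.
move=> BD DB HB; have HBk : H ^+ k *m B = B *m K ^+ k.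
  elim: k => [|k IH]; first by rewrite !expr0 mul1mx mulmx1.
  by rewrite exprS -mulmxE -mulmxA IH mulmxA HB -mulmxA exprS.
by rewrite -[H ^+ k]mulmx1 -BD mulmxA HBk mxtrace_mulC mulmxA DB mul1mx.
Qed.

(** In flat frames the isomorphism becomes [B = V h Z], which is constant because [h] matches the
    two connections. Comparing its values at 0 and 1 gives [H B = B K]. *)
Lemma monodromy_iso (E F : vbundle R) (a : conn E) (b : conn F) H K k :
  vbc_iso (existT _ E a) (existT _ F b) -> monodromy a H -> monodromy b K ->
  \tr (H ^+ k) = \tr (K ^+ k).
Proof.
move=> [h [h' [hp hs hh hg hA]]].
move=> [W [V [fW sW WH]]] [Z [Y [fZ sZ ZK]]].
have [dW dV VW gW] := fW; have [dZ dY YZ gZ] := fZ.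
have /choice[c Uc] := vb_cover E; have /choice[e Ue] := vb_cover F.
pose B x := V (c x) x *m h (c x) (e x) x *m Z (e x) x.
have BE i j x : vb_U i x -> vb_U j x -> B x = V i x *m h i j x *m Z j x.
  move=> Ui Uj; rewrite /B (flat_dual fW I Ui (Uc x)) (gZ (e x) j x I (Ue x) Uj).
  by rewrite (hg i (c x) j (e x) x)// !mulmxA.
have dB x : mxder B 0 x.
  have Ui := Uc x; have Uj := Ue x.
  have Uo : open (vb_U (c x) `&` vb_U (e x)) by apply: openI; exact: open_vb.
  have dh := mxsmooth_mxder (hs (c x) (e x)) (conj Ui Uj).
  have hB : h (c x) (e x) x *m cn_A b (e x) x =
      cn_A a (c x) x *m h (c x) (e x) x + mxderiv (h (c x) (e x)) x.
    by rewrite (hA (c x)) // mulmxDr !mulmxA (hh _ _ _ Ui Uj).1 !mul1mx.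
  have := mxderM (mxderM (dV _ x I Ui) dh) (dZ _ x I Uj).
  rewrite [X in mxder _ X _](_ : _ = 0).
    apply: mxder_near.
    have nU : nbhs x (vb_U (c x) `&` vb_U (e x)) by exact: open_nbhs_nbhs.
    by apply: filterS nU => y [Ui' Uj']; rewrite (BE (c x) (e x)).
  rewrite mulmxN !mulmxA -[_ *m h _ _ x *m cn_A b _ x]mulmxA hB mulmxDr !mulmxA.
  by rewrite subrr.
have cB x y : B x = B y.
  wlog xy : x y / x <= y.
    by move=> wl; have [xy|/ltW xy] := leP x y; [|symmetry]; exact: wl.
  by apply: mx_const_on => // z _; exact: dB.
pose D := Y (e 0) 0 *m h' (c 0) (e 0) 0 *m W (c 0) 0.
have [h1 h2] := hh _ _ _ (Uc 0) (Ue 0).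
have WV := mulmx1C (VW _ _ I (Uc 0)); have ZY := mulmx1C (YZ _ _ I (Ue 0)).
apply: (@conj_trace_expr _ _ (B 0) D).
- rewrite /D /B !mulmxA -[_ *m Z _ _ *m Y _ _]mulmxA ZY mulmx1.
  by rewrite -[_ *m h _ _ 0 *m h' _ _ 0]mulmxA h1 mulmx1 VW.
- rewrite /D /B !mulmxA -[_ *m W _ _ *m V _ _]mulmxA WV mulmx1.
  by rewrite -[_ *m h' _ _ 0 *m h _ _ 0]mulmxA h2 mulmx1 YZ.
- have Uc1 := (vb_U_add1 (c 0) 0).2 (Uc 0); have Ue1 := (vb_U_add1 (e 0) 0).2 (Ue 0).
  rewrite [in RHS](cB 0 (0 + 1)) (BE _ _ _ Uc1 Ue1) -[RHS]mulmxA ZK// hp//.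
  have -> : H = V (c 0) (0 + 1) *m W (c 0) 0 by rewrite -WH// mulmxA VW// mul1mx.
  by rewrite /B !mulmxA -[_ *m W _ _ *m V _ _]mulmxA WV mulmx1.
Qed.

Lemma mxder_block m1 m2 n1 n2 (P : R -> 'M[C]_(m1, n1)) (Q : R -> 'M[C]_(m1, n2))
    (S : R -> 'M[C]_(m2, n1)) (T : R -> 'M[C]_(m2, n2)) dP dQ dS dT x :
  mxder P dP x -> mxder Q dQ x -> mxder S dS x -> mxder T dT x ->
  mxder (fun y => block_mx (P y) (Q y) (S y) (T y)) (block_mx dP dQ dS dT) x.
Proof.
move=> hP hQ hS hT i j; rewrite -(splitK i) -(splitK j).
case: (fintype.split i) => k; case: (fintype.split j) => l /=.
- by rewrite block_mxEul; under eq_fun do rewrite block_mxEul.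
- by rewrite block_mxEur; under eq_fun do rewrite block_mxEur.
- by rewrite block_mxEdl; under eq_fun do rewrite block_mxEdl.
- by rewrite block_mxEdr; under eq_fun do rewrite block_mxEdr.
Qed.

Lemma mxder_tens m n p q (P : R -> 'M[C]_(m, n)) (Q : R -> 'M[C]_(p, q)) dP dQ x :
  mxder P dP x -> mxder Q dQ x ->
  mxder (fun y => P y *t Q y) (dP *t Q x + P x *t dQ) x.
Proof.
by move=> hP hQ i j; under eq_fun do rewrite mxE; rewrite !mxE; exact: cderM.
Qed.

Lemma block_expr m n (H : 'M[C]_m) (K : 'M[C]_n) k :
  (block_mx H 0 0 K) ^+ k = block_mx (H ^+ k) 0 0 (K ^+ k).
Proof.
elim: k => [|k IH]; first by rewrite !expr0 -scalar_mx_block.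
by rewrite !exprS IH -!mulmxE mulmx_block !(mulmx0, mul0mx, addr0, add0r).
Qed.

Lemma tens_expr m n (H : 'M[C]_m) (K : 'M[C]_n) k :
  (H *t K) ^+ k = (H ^+ k) *t (K ^+ k).
Proof.
elim: k => [|k IH]; first by rewrite !expr0; symmetry; exact: tensmx11.
by rewrite !exprS IH -!mulmxE tensmx_mul.
Qed.

Lemma mxtrace_tens m n (H : 'M[C]_m) (K : 'M[C]_n) : \tr (H *t K) = \tr H * \tr K.
Proof.
rewrite /mxtrace big_distrlr /= pair_bigA /=.
rewrite (reindex (fun ij : 'I_m * 'I_n => mxtens_index ij)) /=; last first.
  by apply: onW_bij; exists (@mxtens_unindex m n); [exact: mxtens_indexK|exact: mxtens_unindexK].
by apply: eq_bigr => ij _; rewrite mxE mxtens_indexK.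
Qed.

Lemma monodromy_dsum (E F : vbundle R) (a : conn E) (b : conn F) H K :
  monodromy a H -> monodromy b K ->
  @monodromy R (dsum E F) (dsum_conn a b) (block_mx H 0 0 K).
Proof.
move=> [W [V [fW sW WH]]] [Z [Y [fZ sZ ZK]]].
have [dW dV VW gW] := fW; have [dZ dY YZ gZ] := fZ.
have m0 m n x : mxder (fun=> 0 : 'M[C]_(m, n)) 0 x by exact: mxder_cst.
exists (fun i x => block_mx (W i.1 x) 0 0 (Z i.2 x)),
  (fun i x => block_mx (V i.1 x) 0 0 (Y i.2 x)); split.
- split.
  + move=> [i k] x _ [/= Ui Uk].
    rewrite mulmx_block !(mulmx0, mul0mx, addr0, add0r) opp_block_mx !oppr0.
    by apply: mxder_block; [exact: dW|exact: m0|exact: m0|exact: dZ].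
  + move=> [i k] x _ [/= Ui Uk].
    rewrite mulmx_block !(mulmx0, mul0mx, addr0, add0r).
    by apply: mxder_block; [exact: dV|exact: m0|exact: m0|exact: dY].
  + move=> [i k] x _ [/= Ui Uk].
    by rewrite mulmx_block !(mulmx0, mul0mx, addr0, add0r) VW// YZ// -scalar_mx_block.
  + move=> [i k] [j l] x _ [/= Ui Uk] [/= Uj Ul].
    by rewrite mulmx_block !(mulmx0, mul0mx, addr0, add0r) -gW// -gZ.
- move=> [i k] /=; apply: mxsmooth_block.
  + by apply: mxsmooth_sub (sW i) => x [].
  + by apply: mxsmooth_sub (sZ k) => x [].
- move=> [i k] x [/= Ui Uk].
  by rewrite mulmx_block !(mulmx0, mul0mx, addr0, add0r) WH// ZK.
Qed.

Lemma monodromy_tens (E F : vbundle R) (a : conn E) (b : conn F) H K :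
  monodromy a H -> monodromy b K ->
  @monodromy R (tens E F) (tens_conn a b) (H *t K).
Proof.
move=> [W [V [fW sW WH]]] [Z [Y [fZ sZ ZK]]].
have [dW dV VW gW] := fW; have [dZ dY YZ gZ] := fZ.
exists (fun i x => W i.1 x *t Z i.2 x), (fun i x => V i.1 x *t Y i.2 x); split.
- split.
  + move=> [i k] x _ [/= Ui Uk]; have := mxder_tens (dW i x I Ui) (dZ k x I Uk).
    rewrite [X in mxder _ X _ -> _](_ : _ =
      - ((cn_A a i x *t 1%:M + 1%:M *t cn_A b k x) *m (W i x *t Z k x))) //.
    rewrite mulmxDl !tensmx_mul !mul1mx opprD.
    by congr (_ + _); apply/matrixP => u v; rewrite !mxE ?mulNr ?mulrN.
  + move=> [i k] x _ [/= Ui Uk]; have := mxder_tens (dV i x I Ui) (dY k x I Uk).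
    by rewrite mulmxDr !tensmx_mul !mulmx1.
  + by move=> [i k] x _ [/= Ui Uk]; rewrite tensmx_mul VW// YZ// tensmx11.
  + by move=> [i k] [j l] x _ [/= Ui Uk] [/= Uj Ul]; rewrite tensmx_mul -gW// -gZ.
- move=> [i k] /=; apply: mxsmooth_tens.
  + by apply: openI; exact: open_vb.
  + by apply: mxsmooth_sub (sW i) => x [].
  + by apply: mxsmooth_sub (sZ k) => x [].
- by move=> [i k] x [/= Ui Uk]; rewrite tensmx_mul WH// ZK.
Qed.

End MonodromyInvariance.

(** * Leibniz' rule through square-zero block matrices *)

Section Leibniz.
Context {R : realType} {n : nat}.
Local Notation C := R[i].

(** [diagb] and [nilb] are the degrees 0 and 1 of the algebra of upper triangular 2 by 2 block
    matrices. There is no degree 2: at most one [nilb] factor survives in a product, just as A'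
    occurs once in each term of BCS. *)
Definition diagb (M : 'M[C]_(n + n)) : Prop := ursubmx M = 0 /\ dlsubmx M = 0.

Definition nilb (M : 'M[C]_(n + n)) : Prop :=
  [/\ ulsubmx M = 0, dlsubmx M = 0 & drsubmx M = 0].

Lemma diagbE M : diagb M -> M = block_mx (ulsubmx M) 0 0 (drsubmx M).
Proof. by move=> [e1 e2]; rewrite -[LHS]submxK e1 e2. Qed.

Lemma nilbE M : nilb M -> M = block_mx 0 (ursubmx M) 0 0.
Proof. by move=> [e1 e2 e3]; rewrite -[LHS]submxK e1 e2 e3. Qed.

Lemma diagb_block A B : diagb (block_mx A 0 0 B).
Proof. by rewrite /diagb block_mxKur block_mxKdl. Qed.

Lemma nilb_block A : nilb (block_mx 0 A 0 0).
Proof. by rewrite /nilb block_mxKul block_mxKdl block_mxKdr. Qed.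

Lemma diagb1 : diagb 1%:M.
Proof. by rewrite scalar_mx_block; exact: diagb_block. Qed.

Lemma diagbM A B : diagb A -> diagb B -> diagb (A *m B).
Proof.
move=> /diagbE-> /diagbE->; rewrite mulmx_block !(mulmx0, mul0mx, addr0, add0r).
exact: diagb_block.
Qed.

Lemma nilb_mull A B : diagb A -> nilb B -> nilb (A *m B).
Proof.
move=> /diagbE-> /nilbE->; rewrite mulmx_block !(mulmx0, mul0mx, addr0, add0r).
exact: nilb_block.
Qed.

Lemma nilb_mulr A B : nilb A -> diagb B -> nilb (A *m B).
Proof.
move=> /nilbE-> /diagbE->; rewrite mulmx_block !(mulmx0, mul0mx, addr0, add0r).
exact: nilb_block.
Qed.

Lemma nilbM A B : nilb A -> nilb B -> A *m B = 0.
Proof.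
move=> /nilbE-> /nilbE->; rewrite mulmx_block !(mulmx0, mul0mx, addr0, add0r).
by rewrite block_mx0.
Qed.

Lemma nilb0 : nilb 0.
Proof. by rewrite -(block_mx0 _ n n n n); exact: nilb_block. Qed.

Lemma nilbD A B : nilb A -> nilb B -> nilb (A + B).
Proof.
by move=> /nilbE-> /nilbE->; rewrite add_block_mx !addr0; exact: nilb_block.
Qed.

Lemma nilb_sum I (r : seq I) (P : pred I) (F : I -> 'M[C]_(n + n)) :
  (forall i, P i -> nilb (F i)) -> nilb (\sum_(i <- r | P i) F i).
Proof. by move=> hF; apply: (big_ind nilb) => //; [exact: nilb0|exact: nilbD]. Qed.

Lemma diagb_mxint a b (F : R -> 'M[C]_(n + n)) : (forall t, diagb (F t)) ->
  diagb (mxint a b F).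
Proof.
move=> dF; rewrite (_ : F = fun t => block_mx (ulsubmx (F t)) 0 0 (drsubmx (F t))).
  by rewrite mxint_block !mxint_0; exact: diagb_block.
by apply/funext => t; exact/diagbE.
Qed.

Lemma nilb_mxint a b (F : R -> 'M[C]_(n + n)) : (forall t, nilb (F t)) ->
  nilb (mxint a b F).
Proof.
move=> dF; rewrite (_ : F = fun t => block_mx 0 (ursubmx (F t)) 0 0).
  by rewrite mxint_block !mxint_0; exact: nilb_block.
by apply/funext => t; exact/nilbE.
Qed.

Lemma diagb_prod p (D : 'I_p -> 'M[C]_(n + n)) :
  (forall r, diagb (D r)) -> diagb (\prod_(r < p) D r).
Proof. by move=> dD; apply: (big_ind diagb) => //; [exact: diagb1|exact: diagbM]. Qed.

(** In the expansion of the product all terms with two factors [S] vanish. The surviving pairs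
    [(q, m)] are those of the formula for BCS, with [P q m] standing for [m < n_q]. The block shape
    of each term is carried along for the induction. *)
Lemma prod_diagb_nilb p (D : 'I_p -> 'M[C]_(n + n)) N (P : 'I_p -> pred 'I_N)
    (S : 'I_p -> 'I_N -> 'M[C]_(n + n)) :
  (forall r, diagb (D r)) -> (forall r m, P r m -> nilb (S r m)) ->
  \prod_(r < p) (D r + \sum_(m | P r m) S r m) = \prod_(r < p) D r +
    \sum_(q < p) \sum_(m | P q m) \prod_(r < p) (if r == q then S q m else D r) /\
  forall q m, P q m -> nilb (\prod_(r < p) (if r == q then S q m else D r)).
Proof.
elim: p D P S => [|p IH] D P S dD dS.
  by split=> [|[]//]; rewrite !big_ord0 addr0.
have [IH1 IH2] := IH (fun r => D (lift ord0 r)) (fun r => P (lift ord0 r))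
  (fun r => S (lift ord0 r)) (fun r => dD _) (fun r m => dS _ m).
have E0 m : \prod_(r < p.+1) (if r == ord0 then S ord0 m else D r) =
    S ord0 m * \prod_(r < p) D (lift ord0 r) by rewrite big_ord_recl.
have E1 q m : \prod_(r < p.+1) (if r == lift ord0 q then S (lift ord0 q) m else D r) =
    D ord0 * \prod_(r < p) (if r == q then S (lift ord0 q) m else D (lift ord0 r)).
  by rewrite big_ord_recl; congr (_ * _); apply: eq_bigr => r _; rewrite (inj_eq lift_inj).
have dP : diagb (\prod_(r < p) D (lift ord0 r)) by exact: diagb_prod.
split; last first.
  move=> q m Pqm; case: (unliftP ord0 q) Pqm => [j ->|->] Pqm.
    by rewrite E1; apply: nilb_mull => //; exact: IH2.
  by rewrite E0; apply: nilb_mulr => //; exact: dS.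
rewrite !big_ord_recl IH1.
under [X in _ = _ + (X + _)]eq_bigr do rewrite E0.
under [X in _ = _ + (_ + X)]eq_bigr do under eq_bigr do rewrite E1.
rewrite mulrDl !mulrDr -!addrA; congr (_ + _).
rewrite addrC -addrA -mulr_suml; congr (_ + _).
have -> : (\sum_(m | P ord0 m) S ord0 m) * (\sum_(q < p) \sum_(m | P (lift ord0 q) m)
    \prod_(r < p) (if r == q then S (lift ord0 q) m else D (lift ord0 r))) = 0.
  apply: nilbM; first by apply: nilb_sum => m; exact: dS.
  by apply: nilb_sum => q _; apply: nilb_sum => m; exact: IH2.
rewrite add0r mulr_sumr; apply: eq_bigr => q _; by rewrite mulr_sumr.
Qed.

End Leibniz.

(** * Iterated integrals with varying factors *)

Section Chains.
Context {R : realType}.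
Local Notation C := R[i].

(* The iterated integral of [Y 0 t_1 * ... * Y (k - 1) t_k] over a simplex. *)
Fixpoint chain {n} (b : R) (k : nat) (Y : nat -> R * R -> 'M[C]_n) : R * R -> 'M[C]_n :=
  if k is k'.+1 then volterra (Y 0%N) b (chain b k' (fun j => Y j.+1)) else fun=> 1%:M.

Lemma mxcont_chain n b k (Y : nat -> R * R -> 'M[C]_n) :
  (forall j, mxcont (Y j)) -> mxcont (chain b k Y).
Proof.
elim: k Y => [|k IH] Y cY; first exact: mxcont_cst.
by apply: (@mxcont_volterra _ _ _ _ _ _ 1) => //; exact: IH.
Qed.

(** The prefix [A] makes the induction possible: [simplex_int] fixes the outer variables first, and
    their factors accumulate on the left of the product. *)
Lemma simplex_int_chain n b k (Y : nat -> R * R -> 'M[C]_n) (A : 'M[C]_n) s a :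
  (forall j, mxcont (Y j)) ->
  simplex_int k a b (fun ts => A *m \prod_(j < k) Y j (s, ts`_j)) = A *m chain b k Y (s, a).
Proof.
move=> cY; elim: k Y cY A a => [|k IH] Y cY A a; first by rewrite /= big_ord0.
rewrite /= -mxint_mull; last first.
  apply: mxcontM; first exact: (mxcont_section s (cY 0%N)).
  exact/mxcont_section/mxcont_chain.
congr mxint; apply/funext => t; rewrite mulmxA -IH; last by [].
congr (simplex_int _ _ _ _); apply/funext => ts.
by rewrite big_ord_recl /= mulmxA.
Qed.

Lemma eq_simplex_int n k (a b : R) (F G : seq R -> 'M[C]_n) :
  (forall ts, size ts = k -> all (fun t => a <= t <= b) ts -> F ts = G ts) ->
  simplex_int k a b F = simplex_int k a b G.
Proof.
elim: k a F G => [|k IH] a F G FG /=; first exact: FG.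
apply: eq_mxint => t /andP[at_ tb]; apply: IH => ts sts tsb.
apply: FG; rewrite /= ?sts// at_ tb /=; apply: sub_all tsb => u /andP[tu ->].
by rewrite (le_trans at_).
Qed.

Lemma simplex_int_block n k (a b : R) (F G D : seq R -> 'M[C]_n) :
  simplex_int k a b (fun ts => block_mx (F ts) (G ts) 0 (D ts)) =
  block_mx (simplex_int k a b F) (simplex_int k a b G) 0 (simplex_int k a b D).
Proof.
elim: k a F G D => [//|k IH] a F G D /=.
by rewrite -[X in block_mx _ _ X _](@mxint_0 R n n a b) -mxint_block;
  congr mxint; apply/funext => t; rewrite IH.
Qed.

Lemma volterraDl n m (X X' : R * R -> 'M[C]_n) b (F : R * R -> 'M[C]_(n, m)) :
  mxcont X -> mxcont X' -> mxcont F ->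
  volterra (fun p => X p + X' p) b F = (fun p => volterra X b F p + volterra X' b F p).
Proof.
move=> cX cX' cF; apply/funext => -[s t]; rewrite /volterra /=.
rewrite -mxintD; [|exact: (mxcont_section s (mxcontM cX cF))|exact: (mxcont_section s (mxcontM cX' cF))].
by apply: eq_mxint => u _; rewrite mulmxDl.
Qed.

Lemma volterra_sum n m (X : R * R -> 'M[C]_n) b I (r : seq I) (F : I -> R * R -> 'M[C]_(n, m)) :
  mxcont X -> (forall i, mxcont (F i)) ->
  volterra X b (fun p => \sum_(i <- r) F i p) = (fun p => \sum_(i <- r) volterra X b (F i) p).
Proof.
move=> cX cF; elim: r => [|i r IH].
  apply/funext => -[s t]; under eq_fun do rewrite big_nil; rewrite big_nil.
  by rewrite /volterra /=; under eq_fun do rewrite mulmx0; exact: mxint_0.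
under eq_fun do rewrite big_cons.
rewrite volterraD ?IH//; first by apply/funext => p; rewrite big_cons.
exact: mxcont_sum.
Qed.

Definition site {T : Type} (D S : T) (m j : nat) : T := if j == m then S else D.

(** The iterated integral of [D + S] expands into words in the two letters. Integration keeps the
    block shape, so the words with two letters [S] vanish, and those with one are indexed by its
    position m. *)
Lemma dyson_site n b k (D S : R * R -> 'M[C]_(n + n)) :
  mxcont D -> mxcont S -> (forall p, diagb (D p)) -> (forall p, nilb (S p)) ->
  [/\ dyson (fun p => D p + S p) b k =
        (fun p => chain b k (fun=> D) p + \sum_(m < k) chain b k (site D S m) p),
      forall p, diagb (chain b k (fun=> D) p)
    & forall m p, (m < k)%N -> nilb (chain b k (site D S m) p)].
Proof.
move=> cD cS dD nS.
have csite m j : mxcont (site D S m j) by rewrite /site; case: ifP.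
elim: k => [|k [IH1 IH2 IH3]].
  split=> [|p|//]; last exact: diagb1.
  by apply/funext => p; rewrite big_ord0 addr0.
have n3 m p : (m < k.+1)%N -> nilb (chain b k.+1 (site D S m) p).
  case: m => [|m] mk /=.
    by apply: nilb_mxint => t; apply: nilb_mulr; [exact: nS|exact: IH2].
  by apply: nilb_mxint => t; apply: nilb_mull; [exact: dD|exact: IH3].
split=> //; last first.
  by move=> p /=; apply: diagb_mxint => t; apply: diagbM; [exact: dD|exact: IH2].
have cC : mxcont (chain b k (fun=> D)) by exact: mxcont_chain.
have cCS m : mxcont (chain b k (site D S m)) by apply: mxcont_chain.
have cSS : mxcont (fun p => \sum_(m < k) chain b k (site D S m) p) by exact: mxcont_sum.
have -> : dyson (fun p => D p + S p) b k.+1 = volterra (fun p => D p + S p) b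
    (fun p => chain b k (fun=> D) p + \sum_(m < k) chain b k (site D S m) p).
  by rewrite -IH1.
rewrite (volterraDl b cD cS (mxcontD cC cSS)).
apply/funext => p; rewrite (volterraD b cD cC cSS) (volterraD b cS cC cSS).
have VS0 : volterra S b (fun p => \sum_(m < k) chain b k (site D S m) p) p = 0.
  rewrite /volterra (_ : (fun t => _) = fun=> 0) ?mxint_0//.
  apply/funext => t; apply: nilbM; first exact: nS.
  by apply: nilb_sum => m _; exact: IH3.
rewrite VS0 addr0 big_ord_recl -!addrA; congr (_ + _); rewrite addrC; congr (_ + _).
by rewrite volterra_sum.
Qed.

End Chains.

(** * Forms of degree at most 1 as block matrices *)

Section Theta.
Context {R : realType} {n : nat} {T : Type} (v : T).
Local Notation C := R[i].
Implicit Types al be : seq T -> 'M[C]_n.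

(* The components of degrees 0 and 1 of a form, evaluated at v: contraction
   with v is an odd derivation, so this is multiplicative. *)
Definition theta al : 'M[C]_(n + n) := block_mx (al [::]) (al [:: v]) 0 (al [::]).

Lemma theta_wedge al be : theta (wedge al be) = theta al * theta be.
Proof.
rewrite /theta /= -mulmxE mulmx_block !(mulmx0, mul0mx, addr0, add0r) expr0 scale1r.
by rewrite addrC.
Qed.

Lemma theta_form0 A : theta (form0 A) = block_mx A 0 0 A.
Proof. by []. Qed.

Lemma theta_big I (r : seq I) P (F : I -> seq T -> 'M[C]_n) :
  theta (\big[wedge/form0 1%:M]_(i <- r | P i) F i) = \prod_(i <- r | P i) theta (F i).
Proof.
apply: (big_morph theta theta_wedge).
by rewrite theta_form0 -scalar_mx_block.
Qed.

End Theta.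

Lemma mxcont_block (R : realType) (T : topologicalType) m1 m2 n1 n2
    (A : T -> 'M[R[i]]_(m1, n1)) (B : T -> 'M[R[i]]_(m1, n2))
    (D : T -> 'M[R[i]]_(m2, n1)) (E : T -> 'M[R[i]]_(m2, n2)) :
  mxcont A -> mxcont B -> mxcont D -> mxcont E ->
  mxcont (fun x => block_mx (A x) (B x) (D x) (E x)).
Proof. by move=> *; apply/mxall_block. Qed.

(** * The truncated sums of BCS in degree 1 *)

Section BCSPartialSums.
Context {R : realType} (E : vbundle R) (a : R -> conn E).
Local Notation C := R[i].
Local Notation n := (vb_rank E).
Context (p' : nat) (i : 'I_p'.+1 -> vb_idx E) (g v : R -> R) (s : R).
Local Notation p := p'.+1.
Local Notation lo := (fun r : 'I_p => r%:R / p%:R : R).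
Local Notation hi := (fun r : 'I_p => r.+1%:R / p%:R : R).
(** [X] and [X'] are continuous on the whole plane, but are tied to the connection only on the r-th
    time segment, where the loop stays in the chart [i r]. *)
Context (X X' : 'I_p -> R * R -> 'M[C]_n).
Hypothesis cX : forall r, mxcont (X r).
Hypothesis cX' : forall r, mxcont (X' r).
Hypothesis XE : forall r t, lo r <= t <= hi r ->
  X r (s, t) = (derive1 g t)%:C *: cn_A (a s) (i r) (g t).
Hypothesis X'E : forall r t, lo r <= t <= hi r ->
  X' r (s, t) = (v t)%:C *: mxderiv (fun s => cn_A (a s) (i r) (g t)) s.

Let G (r : 'I_p) : 'M[C]_n := vb_g (i (ord_pred r)) (i r) (g (lo r)).
Let D (r : 'I_p) (q : R * R) : 'M[C]_(n + n) := block_mx (X r q) 0 0 (X r q).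
Let S (r : 'I_p) (q : R * R) : 'M[C]_(n + n) := block_mx 0 (X' r q) 0 0.

Let diag (A : 'M[C]_n) : 'M[C]_(n + n) := block_mx A 0 0 A.

Let cD r : mxcont (D r).
Proof. by apply: mxcont_block; rewrite //; exact: mxcont_cst. Qed.

Let cS r : mxcont (S r).
Proof. by apply: mxcont_block; rewrite //; exact: mxcont_cst. Qed.

Let Y (r : 'I_p) (q : 'I_p) (m : nat) : nat -> R * R -> 'M[C]_(n + n) :=
  if r == q then site (D r) (S r) m else fun=> D r.

(** With [J] empty no curvature factor occurs. Contracted with the velocity, A has degree 0 and
    yields the block diagonal [D], while A' is purely of degree 1 and yields [S], which therefore
    stands at the position [qm] only. *)
Lemma theta_BCS_I N (nn : {ffun 'I_p -> 'I_N}) (qm : 'I_p * 'I_N) r :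
  theta v (BCS_I a i s nn finset.set0 qm r g) =
  chain (hi r) (nn r) (Y r qm.1 qm.2) (s, lo r).
Proof.
have cY j : mxcont (Y r qm.1 qm.2 j).
  by rewrite /Y /site; case: ifP => _; [case: ifP|].
rewrite -[RHS]mul1mx -simplex_int_chain //.
rewrite /theta /BCS_I -simplex_int_block.
apply: eq_simplex_int => ts sts tsr; rewrite mul1mx.
pose F (j : 'I_N) := BCS_X a i s finset.set0 qm (r, j) ts`_j g.
rewrite -[LHS]/(theta v (\big[wedge/form0 1%:M]_(j < N | (j < nn r)%N) F j)) theta_big.
rewrite (big_ord_narrow (ltnW (ltn_ord (nn r)))).
apply: eq_bigr => j _ /=; set w := widen_ord _ j.
have tj : lo r <= ts`_j <= hi r.
  by have /allP := tsr; apply; rewrite mem_nth // sts.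
rewrite /F /BCS_X inE /Y.
have -> : ((r, w) == qm) = (r == qm.1) && (val j == qm.2) by case: (qm) => q m /=.
case: (r == qm.1) => /=; last first.
  rewrite /D XE// /theta /ev_pull /form1 /=; congr block_mx.
rewrite /site; case: (val j == qm.2) => /=.
  by rewrite /S X'E// /theta /ev_pull /form1 /=.
by rewrite /D XE// /theta /ev_pull /form1 /=.
Qed.

Lemma nat_site_diag r k q : diagb (chain (hi r) k (fun=> D r) q) /\
  (forall m, (m < k)%N -> nilb (chain (hi r) k (site (D r) (S r) m) q)) /\
  dyson (fun x => block_mx (X r x) (X' r x) 0 (X r x)) (hi r) k q =
    chain (hi r) k (fun=> D r) q + \sum_(m < k) chain (hi r) k (site (D r) (S r) m) q.
Proof.
have [E1 E2 E3] := dyson_site (hi r) k (cD r) (cS r)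
  (fun x => diagb_block (X r x) (X r x)) (fun x => nilb_block (X' r x)).
split; [exact: E2|split=> [m|]; first exact: E3].
have XhE : (fun x => block_mx (X r x) (X' r x) 0 (X r x)) = (fun x => D r x + S r x).
  by apply/funext => x; rewrite /D /S add_block_mx !addr0 !add0r.
by rewrite XhE E1.
Qed.

Let Mhat (N : nat) : 'M[C]_(n + n) := \prod_(r < p)
  (diag (G r) * \sum_(k < N)
     dyson (fun x => block_mx (X r x) (X' r x) 0 (X r x)) (hi r) k (s, lo r)).

Lemma ursubmx_sum I (r : seq I) P (F : I -> 'M[C]_(n + n)) :
  ursubmx (\sum_(i <- r | P i) F i) = \sum_(i <- r | P i) ursubmx (F i).
Proof.
apply: (big_morph (@ursubmx C n n n n)) => [x y|].
  by apply/matrixP => ? ?; rewrite !mxE.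
by apply/matrixP => ? ?; rewrite !mxE.
Qed.

(** Bounding every [n_r] by N truncates every Dyson series at N. Distributing the product of the
    truncated series enumerates [nn], and for each [nn] Leibniz' rule enumerates [(q, m)]; the terms
    containing A' fill the upper right block. The equality is exact for every N. *)
Lemma BCS_partial_sum N :
  \sum_(nn : {ffun 'I_p -> 'I_N})
    \sum_(J : {set 'I_p * 'I_N} | (J \subset Sset nn) && (#|J| == 0)%N)
      \sum_(qm in Sset nn :\: J) BCS_term a i s nn J qm g [:: v] = ursubmx (Mhat N).
Proof.
rewrite /Mhat; under [in RHS]eq_bigr do rewrite mulr_sumr.
rewrite bigA_distr_bigA /= ursubmx_sum; apply: eq_bigr => nn _.
rewrite (big_pred1 finset.set0); last first.
  by move=> J /=; rewrite cards_eq0 andbC; case: eqP => //= ->; rewrite finset.sub0set.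
rewrite finset.setD0.
rewrite (eq_bigl (fun qm : 'I_p * 'I_N => (qm.2 < nn qm.1)%N)); last first.
  by move=> qm; rewrite inE.
pose Dr r := diag (G r) * chain (hi r) (nn r) (fun=> D r) (s, lo r).
pose Sr r m := diag (G r) * chain (hi r) (nn r) (site (D r) (S r) m) (s, lo r).
have dG r : diagb (diag (G r)) by exact: diagb_block.
have dD r : diagb (Dr r) by apply: diagbM => //; exact: (nat_site_diag r _ _).1.
have nS r (m : 'I_N) : (m < nn r)%N -> nilb (Sr r m).
  by move=> mn; apply: nilb_mull => //; exact: (nat_site_diag r _ _).2.1.
have [LE _] := prod_diagb_nilb dD nS.
rewrite [in RHS](eq_bigr (fun r => Dr r + \sum_(m < N | (m < nn r)%N) Sr r m)); last first.
  move=> r _; have [_ [_ ->]] := nat_site_diag r (nn r) (s, lo r).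
  rewrite mulrDr; congr (_ + _).
  by rewrite (big_ord_narrow (ltnW (ltn_ord (nn r)))) mulr_sumr.
have urD (P Q : 'M[C]_(n + n)) : ursubmx (P + Q) = ursubmx P + ursubmx Q.
  by apply/matrixP => ? ?; rewrite !mxE.
rewrite LE urD (diagb_prod dD).1 add0r ursubmx_sum.
under [RHS]eq_bigr do rewrite ursubmx_sum.
rewrite pair_big_dep /=; apply: eq_bigr => -[q m] /= qm.
rewrite -[LHS](@block_mxKur _ n n n n (BCS_term a i s nn finset.set0 (q, m) g [::]) _ 0
  (BCS_term a i s nn finset.set0 (q, m) g [::])).
rewrite -/(theta v (BCS_term a i s nn finset.set0 (q, m) g)) theta_big.
congr ursubmx; apply: eq_bigr => r _.
rewrite theta_wedge theta_form0 theta_BCS_I /Y /=.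
by case: eqP => [->|_].
Qed.

End BCSPartialSums.

(** * Differentiation in the path parameter *)

Section Jets.
Context {R : realType} {n : nat}.
Local Notation C := R[i].

(** [Fhat] is the value of F over the dual numbers, with the derivative as nilpotent part, so that
    multiplying jets is the product rule. Continuity of the derivative is included for the
    fundamental theorem. *)
Definition jet (Fhat : R -> 'M[C]_(n + n)) (F : R -> 'M[C]_n) : Prop :=
  exists2 D : R -> 'M[C]_n, mxcont D &
    forall s, Fhat s = block_mx (F s) (D s) 0 (F s) /\ mxder F (D s) s.

Lemma mxder_mxcont m k (F : R -> 'M[C]_(m, k)) D : (forall s, mxder F (D s) s) -> mxcont F.
Proof.
by move=> dF i j; split=> s; have [] := mxder_continuous (dF s) i j.
Qed.

Lemma jet_cst A : jet (fun=> block_mx A 0 0 A) (fun=> A).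
Proof.
exists (fun=> 0); first exact: mxcont_cst.
by move=> s; split=> //; exact: mxder_cst.
Qed.

Lemma jetM Fhat F Ghat G : jet Fhat F -> jet Ghat G ->
  jet (fun s => Fhat s * Ghat s) (fun s => F s * G s).
Proof.
move=> [D cD hF] [D' cD' hG].
have cF : mxcont F by apply: mxder_mxcont => s; exact: (hF s).2.
have cG : mxcont G by apply: mxder_mxcont => s; exact: (hG s).2.
exists (fun s => D s *m G s + F s *m D' s).
  by apply: mxcontD; exact: mxcontM.
move=> s; have [-> dF] := hF s; have [-> dG] := hG s; split; last exact: mxderM.
by rewrite -mulmxE mulmx_block !(mulmx0, mul0mx, addr0, add0r) addrC.
Qed.

Lemma jetD Fhat F Ghat G : jet Fhat F -> jet Ghat G ->
  jet (fun s => Fhat s + Ghat s) (fun s => F s + G s).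
Proof.
move=> [D cD hF] [D' cD' hG]; exists (fun s => D s + D' s); first exact: mxcontD.
move=> s; have [-> dF] := hF s; have [-> dG] := hG s; split; last exact: mxderD.
by rewrite add_block_mx addr0.
Qed.

Lemma jet_prod I (r : seq I) (Fhat : I -> R -> 'M[C]_(n + n)) F :
  (forall i, jet (Fhat i) (F i)) ->
  jet (fun s => \prod_(i <- r) Fhat i s) (fun s => \prod_(i <- r) F i s).
Proof.
move=> hF; elim: r => [|i r IH].
  under eq_fun do rewrite big_nil; under [X in jet _ X]eq_fun do rewrite big_nil.
  by have := jet_cst 1%:M; rewrite -scalar_mx_block.
under eq_fun do rewrite big_cons; under [X in jet _ X]eq_fun do rewrite big_cons.
exact: jetM.
Qed.

Lemma jet_sum I (r : seq I) (Fhat : I -> R -> 'M[C]_(n + n)) F :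
  (forall i, jet (Fhat i) (F i)) ->
  jet (fun s => \sum_(i <- r) Fhat i s) (fun s => \sum_(i <- r) F i s).
Proof.
move=> hF; elim: r => [|i r IH].
  under eq_fun do rewrite big_nil; under [X in jet _ X]eq_fun do rewrite big_nil.
  by have := jet_cst 0; rewrite block_mx0.
under eq_fun do rewrite big_cons; under [X in jet _ X]eq_fun do rewrite big_cons.
exact: jetD.
Qed.

Context (X X' : R * R -> 'M[C]_n) (cX : mxcont X) (cX' : mxcont X').
Hypothesis dX : forall s t, mxder (fun s => X (s, t)) (X' (s, t)) s.

Local Notation Xhat := (fun q => block_mx (X q) (X' q) 0 (X q)).

Lemma mxcont_Xhat : mxcont Xhat.
Proof. by apply: mxcont_block => //; exact: mxcont_cst. Qed.

Lemma continuous_pairr (t : R) : continuous (fun s : R => (s, t)).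
Proof.
move=> s A [[B D] /= [nB nD] BD]; apply: filterS nB => y By; apply: BD.
by split=> //=; exact: nbhs_singleton.
Qed.

(** The induction differentiates under an integral over t, hence it needs a derivative jointly
    continuous in [(s, t)]; it runs on this stronger statement. *)
Lemma dyson_jet b k t :
  jet (fun s => dyson Xhat b k (s, t)) (fun s => dyson X b k (s, t)).
Proof.
suff [D cD hD] : exists2 D : R * R -> 'M[C]_n, mxcont D & forall s t,
    dyson Xhat b k (s, t) = block_mx (dyson X b k (s, t)) (D (s, t)) 0 (dyson X b k (s, t)) /\
    mxder (fun s => dyson X b k (s, t)) (D (s, t)) s.
  exists (fun s => D (s, t)) => [|s]; last exact: hD.
  exact/(mxcont_comp cD)/continuous_pairr.
elim: k => [|k [D cD hD]].
  exists (fun=> 0); first exact: mxcont_cst.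
  move=> s {}t; split; last exact: mxder_cst.
  by rewrite /dyson /= scalar_mx_block.
have cI := mxcont_dyson b k cX.
pose F' q := X' q *m dyson X b k q + X q *m D q.
have cF' : mxcont F' by apply: mxcontD; exact: mxcontM.
exists (fun q => mxint q.2 b (fun u => F' (q.1, u))); first exact: mxcont_mxint.
move=> s {}t; split; last first.
  apply: (@mxder_mxint_param R n n t b s (fun q => X q *m dyson X b k q) F') => //.
    exact: mxcontM.
  by move=> s' u; apply: mxderM; [exact: dX|exact: (hD s' u).2].
rewrite -[LHS]/(volterra Xhat b (dyson Xhat b k) (s, t)) /volterra /=.
rewrite -[X in block_mx _ _ X _](@mxint_0 R n n t b) -mxint_block; apply: eq_mxint => u _.
rewrite (hD s u).1 mulmx_block !(mulmx0, mul0mx, addr0, add0r) /F'.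
by rewrite addrC.
Qed.

Lemma mxcont_bounded2 m (F : R * R -> 'M[C]_m) s0 s1 a b : mxcont F ->
  exists2 K, 0 < K & forall s t, s0 <= s <= s1 -> a <= t <= b -> mxabs (F (s, t)) <= K.
Proof.
move=> cF; have [M HM] := segment_bounded s0 s1 a b (continuous_mxabs cF).
exists (`|M| + 1); first by rewrite ltr_wpDl.
move=> s t hs ht; rewrite (le_trans (ler_norm _))// (le_trans (HM s t hs ht))//.
by rewrite (le_trans (ler_norm M))// lerDl.
Qed.

Lemma dyson_uniform_bound m (F : R * R -> 'M[C]_m) s0 s1 a b : mxcont F -> a <= b ->
  exists2 B, 0 <= B & forall k s, s0 <= s <= s1 -> mxabs (dyson F b k (s, a)) <= B * 2^-1 ^+ k.
Proof.
move=> cF ab; have [K K0 HK] := mxcont_bounded2 s0 s1 a b cF.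
exists (mxabs (1%:M : 'M[C]_m) * expR (2 * K * (b - a))).
  by rewrite mulr_ge0 ?mxabs_ge0 ?expR_ge0.
move=> k s hs; rewrite mulrAC.
have := @volterra_bound _ _ _ F a b (fun=> 1%:M) s K (mxabs 1%:M) k K0 cF (mxcont_cst _ _)
  (fun t => HK s t hs) (fun _ _ => lexx _) a.
by rewrite lexx ab => /(_ isT).
Qed.

Lemma half_geometric_sum N : \sum_(k < N) (2^-1 : R) ^+ k <= 2.
Proof.
suff -> : \sum_(k < N) (2^-1 : R) ^+ k = 2 - 2 * 2^-1 ^+ N.
  by rewrite gerBl mulr_ge0 // exprn_ge0 // invr_ge0.
elim: N => [|N IH]; first by rewrite big_ord0 expr0 mulr1 subrr.
by rewrite big_ord_recr /= IH exprS; field.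
Qed.

End Jets.

(** * The integral over one smooth piece of the path *)

Section PieceIntegral.
Context {R : realType} {n p : nat}.
Local Notation C := R[i].
Local Notation mu := (@lebesgue_measure R).
Context (X X' : 'I_p -> R * R -> 'M[C]_n) (G : 'I_p -> 'M[C]_n) (lo hi : 'I_p -> R).
Hypothesis cX : forall r, mxcont (X r).
Hypothesis cX' : forall r, mxcont (X' r).
Hypothesis dX : forall r s t, mxder (fun s => X r (s, t)) (X' r (s, t)) s.
Hypothesis lohi : forall r, lo r <= hi r.

Definition Mhat (N : nat) (s : R) : 'M[C]_(n + n) := \prod_(r < p)
  (block_mx (G r) 0 0 (G r) * \sum_(k < N)
     dyson (fun q => block_mx (X r q) (X' r q) 0 (X r q)) (hi r) k (s, lo r)).

Definition Mprod (N : nat) (s : R) : 'M[C]_n := \prod_(r < p)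
  (G r * \sum_(k < N) dyson (X r) (hi r) k (s, lo r)).

Lemma Mhat_jet N : jet (Mhat N) (Mprod N).
Proof.
apply: jet_prod => r; apply: jetM; first exact: jet_cst.
by apply: jet_sum => k; exact: dyson_jet.
Qed.

(** The bound is uniform in N because each Dyson series is dominated by a geometric one with sum at
    most [2 * B r]. It is the dominating constant of [piece_integral]. *)
Lemma Mhat_bounded s0 s1 :
  exists K, forall N s, s0 <= s <= s1 -> mxabs (Mhat N s) <= K.
Proof.
have cXh r := mxcont_Xhat (cX r) (cX' r).
have /choice[B HB] : forall r : 'I_p, exists B, 0 <= B /\ forall k s, s0 <= s <= s1 ->
    mxabs (dyson (fun q => block_mx (X r q) (X' r q) 0 (X r q)) (hi r) k (s, lo r)) <= B * 2^-1 ^+ k.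
  by move=> r; have [B B0 HB] := dyson_uniform_bound s0 s1 (cXh r) (lohi r); exists B.
exists (mxabs (1%:M : 'M[C]_(n + n)) * \prod_(r < p) (mxabs (block_mx (G r) 0 0 (G r)) * (2 * B r))).
move=> N s hs; apply: mxabs_prod_bound => r; apply: le_trans (mxabsM _ _) _.
rewrite ler_wpM2l ?mxabs_ge0 //; apply: le_trans (mxabs_sum _ _ _) _.
have [B0 Hr] := HB r.
apply: (@le_trans _ _ (\sum_(k < N) B r * 2^-1 ^+ k)).
  by apply: ler_sum => k _; exact: Hr.
by rewrite -mulr_sumr mulrC ler_wpM2r // half_geometric_sum.
Qed.

Lemma Mhat_cvg s : exists L, mxcvg (Mhat ^~ s) L.
Proof.
have cXh r := mxcont_Xhat (cX r) (cX' r).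
have /choice[L HL] : forall r : 'I_p, exists L, mxcvg (fun N => \sum_(k < N)
    dyson (fun q => block_mx (X r q) (X' r q) 0 (X r q)) (hi r) k (s, lo r)) L.
  move=> r; have [B B0 HB] := dyson_uniform_bound s s (cXh r) (lohi r).
  have [|L [? _]] := @mx_half_geometric_cvg _ _ _ B (fun k =>
    dyson (fun q => block_mx (X r q) (X' r q) 0 (X r q)) (hi r) k (s, lo r)).
    by move=> k; apply: HB; rewrite lexx.
  by exists L.
exists (\prod_(r < p) (block_mx (G r) 0 0 (G r) * L r)).
by apply: mxcvg_prod => r; apply: mxcvgM; [exact: mxcvg_cst|exact: HL].
Qed.

Lemma mxcvg_ursubmx (F : nat -> 'M[C]_(n + n)) L :
  mxcvg F L -> mxcvg (fun N => ursubmx (F N)) (ursubmx L).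
Proof.
move=> FL i j; have [fr fi] := FL (lshift n i) (rshift n j).
by rewrite !mxE; split; under eq_fun do rewrite !mxE.
Qed.

(** By the jet property the upper right block of [Mhat N] integrates to the increment of [Mprod N].
    One side passes to the limit by dominated convergence, the other by the convergence assumed at
    the two ends. *)
Lemma piece_integral (f : R -> 'M[C]_n) s0 s1 L0 L1 : s0 <= s1 ->
  (forall s, s0 < s < s1 -> f s = mxlim (fun N => ursubmx (Mhat N s))) ->
  mxcvg (Mprod ^~ s0) L0 -> mxcvg (Mprod ^~ s1) L1 ->
  forall i j,
  [/\ mu.-integrable `[s0, s1] (EFin \o (fun s => complex.Re (f s i j))),
      mu.-integrable `[s0, s1] (EFin \o (fun s => complex.Im (f s i j))),
      Rintegral mu `[s0, s1] (fun s => complex.Re (f s i j)) =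
        complex.Re (L1 i j) - complex.Re (L0 i j)
    & Rintegral mu `[s0, s1] (fun s => complex.Im (f s i j)) =
        complex.Im (L1 i j) - complex.Im (L0 i j)].
Proof.
move=> s01 fE c0 c1 i j.
have /choice[D HD] : forall N, exists D : R -> 'M[C]_n, mxcont D /\
    forall s, Mhat N s = block_mx (Mprod N s) (D s) 0 (Mprod N s) /\ mxder (Mprod N) (D s) s.
  by move=> N; have [D ? ?] := Mhat_jet N; exists D.
have [K HK] := Mhat_bounded s0 s1.
have urD N s : ursubmx (Mhat N s) = D N s by rewrite ((HD N).2 s).1 block_mxKur.
have DE N s : D N s i j = Mhat N s (lshift n i) (rshift n j) by rewrite -urD !mxE.
have Dcvg s : s0 < s < s1 -> mxcvg (D ^~ s) (f s).
  move=> hs; have [L cL] := Mhat_cvg s; have cU := mxcvg_ursubmx cL.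
  rewrite fE // (mxcvg_lim cU); move: cU.
  by rewrite (_ : (fun N => _) = D ^~ s)//; apply/funext => N; exact: urD.
have cD N := (HD N).1 i j.
have [ir vr] := @bounded_cvg_Rintegral _ (fun N s => complex.Re (D N s i j))
  (fun s => complex.Re (f s i j)) s0 s1 K (fun N => (cD N).1)
  (fun N s hs => le_trans (eq_ind_r (fun z : C => `|complex.Re z| <= _)
     (le_Re_mxabs _ _ _) (DE N s)) (HK N s hs))
  (fun s hs => (Dcvg s hs i j).1).
have [ii vi] := @bounded_cvg_Rintegral _ (fun N s => complex.Im (D N s i j))
  (fun s => complex.Im (f s i j)) s0 s1 K (fun N => (cD N).2)
  (fun N s hs => le_trans (eq_ind_r (fun z : C => `|complex.Im z| <= _)
     (le_Im_mxabs _ _ _) (DE N s)) (HK N s hs))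
  (fun s hs => (Dcvg s hs i j).2).
have intr N : Rintegral mu `[s0, s1] (fun s => complex.Re (D N s i j)) =
    complex.Re (Mprod N s1 i j) - complex.Re (Mprod N s0 i j).
  apply: (@Rintegral_FTC _ (fun s => complex.Re (Mprod N s i j))) => // s _.
    exact: (cD N).1.
  by have [] := ((HD N).2 s).2 i j.
have inti N : Rintegral mu `[s0, s1] (fun s => complex.Im (D N s i j)) =
    complex.Im (Mprod N s1 i j) - complex.Im (Mprod N s0 i j).
  apply: (@Rintegral_FTC _ (fun s => complex.Im (Mprod N s i j))) => // s _.
    exact: (cD N).2.
  by have [] := ((HD N).2 s).2 i j.
have [r0 i0] := c0 i j; have [r1 i1] := c1 i j.
split=> //.
- rewrite -(cvg_lim (@Rhausdorff R) vr); apply/(cvg_lim (@Rhausdorff R)).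
  by rewrite (funext intr); exact: cvgB.
- rewrite -(cvg_lim (@Rhausdorff R) vi); apply/(cvg_lim (@Rhausdorff R)).
  by rewrite (funext inti); exact: cvgB.
Qed.

End PieceIntegral.

(** * The Dyson series as parallel transport; additivity over pieces *)

Section Transport.
Context {R : realType}.
Local Notation C := R[i].
Local Notation mu := (@lebesgue_measure R).

Lemma cder_scale (f : R -> C) d c x : cder f d (c * x) -> cder (fun y => f (c * y)) (c%:C * d) x.
Proof.
have sc (u : R -> R) e : is_derive (c * x) (1 : R) u e ->
    is_derive x (1 : R) (fun y => u (c * y)) (c * e).
  move=> du; rewrite mulrC; apply: (@is_derive1_comp _ u (fun y => c * y)).
  have := is_deriveZ c (is_derive_id x (1 : R)).
  by rewrite /GRing.scale /= mulr1.
case: d => d1 d2 [/= fr fi]; split; rewrite /= ?mul0r ?subr0 ?addr0; exact: sc.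
Qed.

Lemma mxder_scale m n (F : R -> 'M[C]_(m, n)) D c x :
  mxder F D (c * x) -> mxder (fun y => F (c * y)) (c%:C *: D) x.
Proof. by move=> dF i j; rewrite mxE; exact: (@cder_scale (fun y => F y i j)). Qed.

(** Substituting the integral equation into itself N times leaves as remainder the N-th Volterra
    iterate of the solution itself, which is geometrically small. *)
Lemma dyson_transport n (X : R * R -> 'M[C]_n) s a b (F : R -> 'M[C]_n) (V : 'M[C]_n) :
  mxcont X -> a <= b -> F b *m V = 1%:M ->
  (forall t, a <= t <= b -> mxder F (- (X (s, t) *m F t)) t) ->
  mxcvg (fun N => \sum_(k < N) dyson X b k (s, a)) (F a *m V).
Proof.
move=> cX ab FV dF.
pose Y t := F (clamp a b t) *m V.
have cY : mxcont Y.
  apply: mxcontM; last exact: mxcont_cst.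
  move=> i j; split=> t; have [hr hi] := mxder_continuous (dF _ (clamp_in t ab)) i j.
    exact: (@continuous_comp _ _ _ _ (fun y => complex.Re (F y i j)) t (@continuous_clamp _ a b t) hr).
  exact: (@continuous_comp _ _ _ _ (fun y => complex.Im (F y i j)) t (@continuous_clamp _ a b t) hi).
have cXY : mxcont (fun t => X (s, t) *m Y t).
  by apply: mxcontM => //; exact: mxcont_section.
have Yint t : a <= t <= b -> Y t = 1%:M + mxint t b (fun u => X (s, u) *m Y u).
  move=> /andP[at_ tb].
  have -> : mxint t b (fun u => X (s, u) *m Y u) = - mxint t b (fun u => - (X (s, u) *m Y u)).
    by rewrite mxintN // opprK.
  have tab : a <= t <= b by rewrite at_.
  rewrite (@mxint_FTC _ _ _ t b (fun u => F u *m V)) //.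
  - by rewrite FV opprB addrC subrK /Y clamp_id.
  - exact: mxcontN.
  - move=> u /andP[tu ub]; have uab : a <= u <= b by rewrite (le_trans at_).
    by rewrite /Y clamp_id // mulmxA -mulNmx; apply: mxderMr; exact: dF.
pose Y2 (q : R * R) := Y q.2; have cY2 : mxcont Y2 by exact: mxcont_snd.
have rem N t : a <= t <= b ->
    Y t - \sum_(k < N) dyson X b k (s, t) = iter N (volterra X b) Y2 (s, t).
  elim: N t => [|N IH] t tab; first by rewrite big_ord0 subr0.
  rewrite big_ord_recl /= (Yint t tab) opprD addrACA subrr add0r.
  have -> : \sum_(k < N) dyson X b (lift ord0 k) (s, t) =
      mxint t b (fun u => X (s, u) *m \sum_(k < N) dyson X b k (s, u)).
    by have /(congr1 (@^~ (s, t))) := volterra_dyson_sum b N cX.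
  have cS : mxcont (fun u => X (s, u) *m \sum_(k < N) dyson X b k (s, u)).
    apply: mxcontM; first exact: mxcont_section.
    by apply: mxcont_sum => k; apply: (@mxcont_section _ _ _ (dyson X b k)); exact: mxcont_dyson.
  rewrite -mxintN // -mxintD //; last exact: mxcontN.
  apply: eq_mxint => u /andP[tu ub]; rewrite -mulmxN -mulmxDr IH //.
  by case/andP: tab => at_ _; rewrite (le_trans at_).
have [K K0 HK] := mxcont_bounded a b (mxcont_section s cX).
have [M M0 HM] := mxcont_bounded a b cY.
have -> : F a *m V = Y a by rewrite /Y clamp_id // lexx.
apply: mxcvgP.
apply: (@squeeze_cvgr _ _ _ _ (cst 0) (fun N => M * expR (2 * K * (b - a)) * 2^-1 ^+ N)).
- apply: nearW => N; rewrite mxabs_ge0 /= -mxabsN opprB rem ?lexx // mulrAC.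
  by apply: (@volterra_bound _ _ _ X a b Y2 s K M) => //; rewrite lexx.
- exact: cvg_cst.
- exact: half_exp_cvg0.
Qed.

(** Here [w r] will be the flat frame at the left end of segment r and [v r.+1] the dual frame at
    its right end, so the inner pairs cancel. *)
Lemma prod_telescope n m (w v : nat -> 'M[C]_n) :
  (forall r, (r < m)%N -> v r.+1 *m w r.+1 = 1%:M) ->
  \prod_(r < m.+1) (w r *m v r.+1) = w 0%N *m v m.+1.
Proof.
elim: m => [|m IH] vw; first by rewrite big_ord1.
rewrite big_ord_recr /= IH => [|r rm]; last by apply: vw; exact: ltnW.
by rewrite -mulmxE mulmxA -[w 0%N *m _ *m _]mulmxA vw // mulmx1.
Qed.

Lemma integrable_segmentU (f : R -> R) x y z : x <= y -> y <= z ->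
  mu.-integrable `[x, y] (EFin \o f) -> mu.-integrable `[y, z] (EFin \o f) ->
  mu.-integrable `[x, z] (EFin \o f).
Proof.
move=> xy yz fxy fyz.
have fyz' : mu.-integrable `]y, z] (EFin \o f).
  by apply: integrableS fyz => // t /=; rewrite !in_itv /= => /andP[/ltW -> ->].
have E : `[x, z]%classic = `[x, y]%classic `|` `]y, z]%classic :> set R.
  by apply: itv_bndbnd_setU; rewrite bnd_simp.
rewrite E; move/integrableP: fxy => [m1 i1]; move/integrableP: fyz' => [m2 i2].
have mU : measurable_fun (`[x, y] `|` `]y, z]) (EFin \o f) by apply/measurable_funU.
apply/integrableP; split=> //.
have dj : [disjoint `[x, y]%classic & `]y, z]%classic].
  apply/disj_setPS => t [/=]; rewrite !in_itv /= => /andP[_ ty] /andP[].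
  by rewrite ltNge ty.
have mA : measurable_fun (`[x, y] `|` `]y, z]) (fun t => `|(EFin \o f) t|%E).
  exact: measurableT_comp.
have IU : (\int[mu]_(t in `[x, y] `|` `]y, z]) `|(EFin \o f) t| =
    \int[mu]_(t in `[x, y]) `|(EFin \o f) t| + \int[mu]_(t in `]y, z]) `|(EFin \o f) t|)%E.
  exact: ge0_integral_setU.
by rewrite IU; exact: lte_add_pinfty.
Qed.

Lemma Rintegral_segmentU (f : R -> R) x y z : x <= y -> y <= z ->
  mu.-integrable `[x, z] (EFin \o f) ->
  Rintegral mu `[x, z] f = Rintegral mu `[x, y] f + Rintegral mu `[y, z] f.
Proof.
move=> xy yz fi; have := @Rintegral_itvB _ f (BLeft x) (BRight z) y fi.
rewrite !bnd_simp => /(_ xy yz) E; rewrite -[X in _ + X]Rintegral_itv_obnd_cbnd.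
  by rewrite -E addrC subrK.
apply: integrableS fi => // t /=; rewrite !in_itv /= => /andP[yt ->].
by rewrite andbT (le_trans xy) // ltW.
Qed.

(** The increments of [phi] telescope. Integrability is part of the induction, since splitting the
    integral requires it on the union of the pieces. *)
Lemma piecewise_Rintegral (f phi : R -> R) x ss : path <%R x ss ->
  (forall k, (k < size ss)%N ->
    mu.-integrable `[nth 0 (x :: ss) k, nth 0 ss k] (EFin \o f) /\
    Rintegral mu `[nth 0 (x :: ss) k, nth 0 ss k] f = phi (nth 0 ss k) - phi (nth 0 (x :: ss) k)) ->
  [/\ x <= last x ss, mu.-integrable `[x, last x ss] (EFin \o f)
   & Rintegral mu `[x, last x ss] f = phi (last x ss) - phi x].
Proof.
elim: ss x => [|y ss IH] x /=.
  move=> _ _; split=> //; last by rewrite Rintegral_segment0 // subrr.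
  rewrite set_itv1; apply/integrableP; split; first exact: measurable_fun_set1.
  by rewrite integral_set1.
move=> /andP[xy ys] H; have [k ks|yl iy Ey] := IH y ys; first exact: (H k.+1).
have [ix Ex] := H 0%N isT; have xy' := ltW xy; rewrite /= in ix Ex.
have il := integrable_segmentU xy' yl ix iy.
split=> //; first exact: le_trans yl.
by rewrite (Rintegral_segmentU xy' yl il) Ex Ey addrC addrA subrK.
Qed.

End Transport.

(** * BCS-equivalent connections have equal traces *)

Section BCSTrace.
Context {R : realType}.
Local Notation C := R[i].
Local Notation mu := (@lebesgue_measure R).

(* Contracting with the velocity kills everything but the derivative of the
   degree 0 part along the loop rotation, which vanishes by invariance. *)
Lemma dexact_velocity (b : lform R) g : dexact b -> loop g -> tangent (derive1 g) ->
  b g [:: derive1 g] = 0.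
Proof.
move=> [w [[_ _ wA _] _ wI wE]] lg tg.
have Fv : List.Forall tangent [:: derive1 g].
  by apply: List.Forall_cons; [exact: tg|exact: List.Forall_nil].
rewrite wE // /iota_form.
have -> : w g [:: derive1 g; derive1 g] = 0.
  exact: (wA g [::] [::] [::] (derive1 g) lg (List.Forall_nil _) (List.Forall_nil _) (List.Forall_nil _) tg).
have := wI g [::] lg (List.Forall_nil _).
by rewrite /iota_form {1}/dform /= big_ord0 add0r addr0.
Qed.

Lemma is_derive_fst (f : R * R -> R) s x : derivable f (s, x) (1, 0) ->
  is_derive s (1 : R) (fun s => f (s, x)) ('D_(1, 0) f (s, x)).
Proof.
have E : (fun h : R => h^-1 *: ((f \o shift (s, x)) (h *: ((1 : R), (0 : R))) - f (s, x))) =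
         (fun h : R => h^-1 *: (((fun s => f (s, x)) \o shift s) (h *: (1 : R)) - f (s, x))).
  apply/funext => h /=; congr (_ *: (f _ - _)).
  by rewrite /shift /=; congr pair; rewrite /= scaler0 add0r.
by rewrite /derivable /derive E => df; split.
Qed.

Lemma vb_U_subn (E : vbundle R) (i : vb_idx E) x k : vb_U i (x + k%:R) -> vb_U i x.
Proof.
elim: k => [|k IH]; first by rewrite addr0.
by rewrite -natr1 addrA => /vb_U_add1.
Qed.

Lemma loop_linear (k : nat) : loop (fun t : R => k%:R * t).
Proof.
split; last by exists (Posz k) => t; rewrite mulrDr mulr1.
apply: smoothM; [exact: openT|exact: smooth_cst|].
have : smooth setT (fun t : R => t); last by [].
apply: (smooth_class openT (K := fun f => exists u v, f = (fun t => u * t + v))).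
- move=> f x [u [v ->]] _; apply: derivableD; last exact: derivable_cst.
  by apply: derivableM; [exact: derivable_cst|exact: derivable_id].
- move=> f c [u [v ->]]; exists (fun t => 0 * t + c * u); first by exists 0, (c * u).
  move=> x _; rewrite mul0r add0r; congr (_ * _).
  have du : is_derive x (1 : R) (fun t : R => u * t + v) u.
    have := is_deriveD (is_deriveZ u (is_derive_id x (1 : R))) (is_derive_cst v x 1).
    by rewrite /GRing.scale /= mulr1 addr0.
  by case: du.
- by exists 1, 0; apply/funext => t; rewrite mul1r addr0.
Qed.

Lemma derive1_linear (c : R) : derive1 (fun t : R => c * t) = fun=> c.
Proof.
apply/funext => t; rewrite derive1E.
have := is_deriveZ c (is_derive_id t (1 : R)).
by rewrite /GRing.scale /= mulr1 => -[].
Qed.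

Lemma tangent_cst (c : R) : tangent (fun=> c).
Proof. by split=> //; exact: smooth_cst. Qed.

Section Piece.
Context (E : vbundle R) (a : R -> conn E) (k q' : nat).
Local Notation n := (vb_rank E).
Local Notation K := (k.+1%:R : R).
Let q := q'.+1.
(** The loop winds [k.+1] times and each turn is cut into q segments, so that time [r / p] is sent
    to [x r = r / q]. The predecessor appears because the formula is indexed by ['I_p'.+1]. *)
Let p' := (k.+1 * q).-1.
Let pE : p'.+1 = (k.+1 * q)%N. Proof. by []. Qed.
Let x (r : nat) : R := r%:R / q%:R.
Context (c : nat -> vb_idx E).
Hypothesis Uc : forall r t, x r <= t <= x r.+1 -> vb_U (c r) t.
Let i (r : 'I_p'.+1) := c r.
Let g (t : R) : R := K * t.
Let lo (r : 'I_p'.+1) : R := r%:R / p'.+1%:R.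
Let hi (r : 'I_p'.+1) : R := r.+1%:R / p'.+1%:R.

Let gx (r : nat) : g (r%:R / p'.+1%:R) = x r.
Proof.
rewrite /g /x pE natrM; field.
by rewrite -[1 + _](natrD _ 1) !pnatr_eq0.
Qed.

Let lohi r : lo r <= hi r.
Proof. by rewrite /lo /hi ler_wpM2r ?invr_ge0 ?ler0n // ler_nat. Qed.

Let gU r t : lo r <= t <= hi r -> vb_U (i r) (g t).
Proof.
by move=> /andP[l h]; apply: Uc; rewrite -!gx /g !ler_wpM2l ?ler0n.
Qed.

Lemma inN_linear : inN i g.
Proof. by move=> r t; exact: gU. Qed.

(** [L s] is the transport around the loop. The formula starts with the transition from the last
    chart to the first, so the loop is read in [c p'] both at 0 and at its translate [K]. *)
Lemma piece_trace (s0 s1 : R) (B : vb_idx E -> R * R -> 'M[C]_n) (L : R -> 'M[C]_n) :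
  s0 <= s1 ->
  (forall j, mxsmooth [set sx : R * R | vb_U j sx.2] (B j)) ->
  (forall j s y, s0 <= s <= s1 -> vb_U j y -> cn_A (a s) j y = B j (s, y)) ->
  (forall s, s0 <= s <= s1 -> exists W V, [/\ flat_on (a s) setT W V
     & L s = W (c p') 0 *m V (c p') K]) ->
  forall u w,
  let f s := BCS_integrand a i 0 g [:: fun=> K] s in
  [/\ mu.-integrable `[s0, s1] (EFin \o (fun s => complex.Re (f s u w))),
      mu.-integrable `[s0, s1] (EFin \o (fun s => complex.Im (f s u w))),
      Rintegral mu `[s0, s1] (fun s => complex.Re (f s u w)) =
        complex.Re (L s1 u w) - complex.Re (L s0 u w)
    & Rintegral mu `[s0, s1] (fun s => complex.Im (f s u w)) =
        complex.Im (L s1 u w) - complex.Im (L s0 u w)].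
Proof.
move=> s01 sB aB HL u w f.
(* Times are clamped to the r-th segment, so that [B] is evaluated inside its chart only and [X],
   [X'] become continuous on the plane. *)
pose h (r : 'I_p'.+1) (st : R * R) : R * R := (st.1, g (clamp (lo r) (hi r) st.2)).
have Uh r st : vb_U (i r) (h r st).2 by apply: gU; exact: clamp_in.
have ch r : continuous (h r).
  have cg : continuous (fun t => g (clamp (lo r) (hi r) t)).
    by move=> t; apply: cvgM; [exact: cvg_cst|exact: continuous_clamp].
  move=> st S [[B1 D1] /= [nB nD] BD].
  have n1 : \forall z \near st, B1 z.1 by apply: (@cvg_fst _ _ (nbhs st.1) (nbhs st.2)).
  have n2 : \forall z \near st, D1 (g (clamp (lo r) (hi r) z.2)).
    exists (setT, [set t | D1 (g (clamp (lo r) (hi r) t))]) => /= [|z []//].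
    by split; [exact: filterT|exact: (cg st.2 _ nD)].
  by apply: filterS2 n1 n2 => z z1 z2; exact: (BD (h r z)).
pose DB (j : vb_idx E) (sx : R * R) : 'M[C]_n := \matrix_(k, l)
  ('D_(1, 0) (fun sx => complex.Re (B j sx k l)) sx +i*
   'D_(1, 0) (fun sx => complex.Im (B j sx k l)) sx).
pose X r st := K%:C *: B (i r) (h r st).
pose X' r st := K%:C *: DB (i r) (h r st).
have cZ (F : R * R -> 'M[C]_n) : mxcont F -> mxcont (fun st => K%:C *: F st).
  move=> cF; rewrite (_ : (fun _ => _) = fun st => K%:C%:M *m F st).
    by apply: mxcontM => //; exact: mxcont_cst.
  by apply/funext => st; rewrite mul_scalar_mx.
have cX r : mxcont (X r).
  apply: cZ => k1 l1; have [sr si] := sB (i r) k1 l1; split=> st.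
  - by apply: (@continuous_comp _ _ _ (h r) (fun y => complex.Re (B (i r) y k1 l1))); [exact: ch|exact: (sr [::] _ (Uh r st)).1].
  - by apply: (@continuous_comp _ _ _ (h r) (fun y => complex.Im (B (i r) y k1 l1))); [exact: ch|exact: (si [::] _ (Uh r st)).1].
have cX' r : mxcont (X' r).
  apply: cZ => k1 l1; have [sr si] := sB (i r) k1 l1; split=> st.
  - under eq_fun do rewrite mxE /=.
    by apply: (@continuous_comp _ _ _ (h r) ('D_(1, 0) (fun y => complex.Re (B (i r) y k1 l1)))); [exact: ch|exact: (sr [:: (1, 0)] _ (Uh r st)).1].
  - under eq_fun do rewrite mxE /=.
    by apply: (@continuous_comp _ _ _ (h r) ('D_(1, 0) (fun y => complex.Im (B (i r) y k1 l1)))); [exact: ch|exact: (si [:: (1, 0)] _ (Uh r st)).1].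
have dB j s y : vb_U j y -> mxder (fun s => B j (s, y)) (DB j (s, y)) s.
  move=> Uy k1 l1; have [sr si] := sB j k1 l1; rewrite mxE; split=> /=.
  - apply: (@is_derive_fst (fun sx => complex.Re (B j sx k1 l1))).
    exact: (sr [::] (s, y) Uy).2.
  - apply: (@is_derive_fst (fun sx => complex.Im (B j sx k1 l1))).
    exact: (si [::] (s, y) Uy).2.
have dZ (F : R -> 'M[C]_n) D s : mxder F D s -> mxder (fun s => K%:C *: F s) (K%:C *: D) s.
  by move=> /(mxderZ (cder_cst K%:C s)); rewrite scale0r add0r.
have dX r s t : mxder (fun s => X r (s, t)) (X' r (s, t)) s.
  exact: (dZ _ _ _ (dB (i r) s _ (Uh r (s, t)))).
have XE r s t : s0 <= s <= s1 -> lo r <= t <= hi r ->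
    X r (s, t) = K%:C *: cn_A (a s) (i r) (g t).
  by move=> hs ht; rewrite /X /h /= clamp_id // aB //; exact: gU.
pose G (r : 'I_p'.+1) : 'M[C]_n := vb_g (i (ord_pred r)) (i r) (g (lo r)).
have L_cvg s : s0 <= s <= s1 -> mxcvg (fun N => Mprod X G lo hi N s) (L s).
  move=> hs; have [W [V [fW ->]]] := HL s hs.
  have [dW dV VW gW] := fW.
  (* The frame at the left end of segment r is read in the previous chart, the last one if r = 0;
     the factor [G r] changes it to the chart of the segment itself. *)
  pose ww (r : nat) := if r is r'.+1 then W (c r') (x r) else W (c p') 0.
  pose vv (r : nat) := if r is r'.+1 then V (c r') (x r) else V (c p') 0.
  have xl r : x r <= x r <= x r.+1.
    by rewrite lexx /x ler_wpM2r ?invr_ge0 ?ler0n // ler_nat.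
  have xr r : x r <= x r.+1 <= x r.+1.
    by rewrite lexx andbT /x ler_wpM2r ?invr_ge0 ?ler0n // ler_nat.
  have xp : x p'.+1 = K by rewrite -gx /g mulfV ?mulr1 ?pnatr_eq0.
  have x0 : x 0%N = 0 by rewrite /x mul0r.
  have U0 : vb_U (c p') 0.
    by apply: (@vb_U_subn E _ 0 k.+1); rewrite add0r -xp; exact: Uc.
  have -> : W (c p') 0 *m V (c p') K = ww 0%N *m vv p'.+1 by rewrite /vv xp.
  rewrite -(prod_telescope (m := p')); last first.
    by move=> r _; apply: VW => //; exact: Uc.
  apply: mxcvg_prod => r.
  have -> : ww r *m vv r.+1 = G r *m (W (c r) (x r) *m vv r.+1).
    rewrite mulmxA; congr (_ *m _); rewrite /G /lo gx /i.
    case: r => -[|r] rp /=.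
      by rewrite x0 modn_small // (gW (c p') (c 0%N) 0) // -x0; exact: Uc.
    rewrite modnDr modn_small ?(ltnW rp) //.
    by apply: gW => //; exact: Uc.
  apply: mxcvgM; first exact: mxcvg_cst.
  have := @dyson_transport R n (X r) s (lo r) (hi r) (fun t => W (c r) (g t)) (vv r.+1)
    (cX r) (lohi r).
  rewrite /lo /hi !gx; apply.
    by apply: mulmx1C; apply: VW => //; exact: Uc.
  move=> t ht; rewrite XE // -scalemxAl -scalerN.
  by apply: (mxder_scale (F := W (c r))); apply: dW => //; exact: (gU ht).
apply: (@piece_integral R n p'.+1 X X' G lo hi cX cX' dX lohi f s0 s1 (L s0) (L s1) s01).
- move=> s hs; have /andP[/ltW hs0 /ltW hs1] := hs.
  rewrite /f /BCS_integrand; congr mxlim; apply/funext => N.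
  rewrite (@BCS_partial_sum R E a p' i g (fun=> K) s X X') //.
  + by move=> r t ht; rewrite XE ?hs0 // /g derive1_linear.
  + move=> r t ht; rewrite /X' /h /= clamp_id //; congr (_ *: _).
    (* Strictly inside the piece the path agrees with [B] for all nearby s, hence so do the
       derivatives in s. *)
    symmetry; apply: mxder_derivE; apply: mxder_near (dB (i r) s (g t) (gU ht)).
    case/andP: hs => h0 h1; near=> s'; rewrite aB //; last exact: gU.
    apply/andP; split; apply: ltW; near: s'.
      exact: (lt_nbhsr h0).
    exact: (lt_nbhsl h1).
- by apply: L_cvg; rewrite lexx.
- by apply: L_cvg; rewrite lexx s01.
Unshelve. all: by end_near. Qed.

End Piece.
Lemma vbc_iso_refl (E : vbundle R) (a : conn E) : vbc_iso (existT _ E a) (existT _ E a).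
Proof.
exists (@vb_g R E), (fun i j x => vb_g j i x); split.
- exact: vb_periodic.
- exact: vb_smooth.
- by move=> i j x Ui Uj; rewrite !vb_gK.
- by move=> i k j l x Ui Uk Uj Ul; rewrite !vb_cocycle.
- by move=> i j x Ui Uj; rewrite (cn_gauge a Ui Uj) (vb_inv Ui Uj).
Qed.

Lemma monodromy_trace_uniq (E : vbundle R) (a : conn E) H K k :
  monodromy a H -> monodromy a K -> \tr (H ^+ k) = \tr (K ^+ k).
Proof. exact: monodromy_iso (vbc_iso_refl a). Qed.

(** At the loop [t |-> k.+1 * t] and its velocity, [dexact_velocity] gives 0 while the local formula
    gives [tr L 1 - tr L 0]. *)
Lemma path_trace (E : vbundle R) (a : R -> conn E) (b : lform R) H0 H1 k :
  piecewise_smooth a -> is_BCS a b -> dexact b ->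
  monodromy (a 0) H0 -> monodromy (a 1) H1 -> \tr (H0 ^+ k.+1) = \tr (H1 ^+ k.+1).
Proof.
move=> [ss [pss lss HB]] bE db m0 m1.
have [dl dl0 Hdl] := vb_lebesgue E.
(* The length [1 / q'.+1] is at most the Lebesgue number, so that each segment lies in one chart. *)
pose q' := Num.truncn dl^-1.
have q'dl : (q'.+1%:R : R)^-1 <= dl.
  by rewrite -[leRHS]invrK lef_pV2 ?posrE ?invr_gt0 ?ltr0n //; exact/ltW/truncnS_gt.
have /choice[c Hc] : forall r : nat, exists i : vb_idx E, forall t : R,
    r%:R / q'.+1%:R - dl <= t <= r%:R / q'.+1%:R + dl -> vb_U i t by move=> r; exact: Hdl.
have Uc (r : nat) (t : R) : r%:R / q'.+1%:R <= t <= r.+1%:R / q'.+1%:R -> vb_U (c r) t.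
  move=> /andP[t1 t2]; apply: Hc; apply/andP; split.
    by apply: le_trans t1; rewrite gerBl ltW.
  by apply: le_trans t2 _; rewrite -natr1 mulrDl mul1r lerD2l.
pose p' := (k.+1 * q'.+1).-1.
(* Frames are chosen for each s independently. Only the values of [L] at the breakpoints are
   compared, so an arbitrary choice is harmless. *)
have /choice[HWV PH] : forall s, exists HWV : 'M[C]_(vb_rank E) *
    ((vb_idx E -> R -> 'M[C]_(vb_rank E)) * (vb_idx E -> R -> 'M[C]_(vb_rank E))),
    [/\ monodromy (a s) HWV.1, flat_on (a s) setT HWV.2.1 HWV.2.2 &
     forall i x, vb_U i x -> HWV.2.1 i (x + 1) *m HWV.1 = HWV.2.1 i x].
  move=> s; have [H mH] := monodromy_exists (a s); have [W [V [fW sW WH]]] := mH.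
  by exists (H, (W, V)).
pose L s := (HWV s).2.1 (c p') 0 *m (HWV s).2.2 (c p') k.+1%:R.
have U0 : vb_U (c p') 0.
  apply: (@vb_U_subn E _ 0 k.+1); rewrite add0r; apply: Uc.
  have -> : p'.+1 = (k.+1 * q'.+1)%N by [].
  rewrite natrM mulfK ?pnatr_eq0 // lexx andbT ler_pdivrMr ?ltr0n // -natrM ler_nat.
  by rewrite leq_pred.
(* With [K = k.+1], cyclicity replaces [W 0 V K] by [V K W 0], which is [H ^+ k.+1] because
   [W 0 = W K H ^+ k.+1]. *)
have trL s : \tr (L s) = \tr ((HWV s).1 ^+ k.+1).
  have [_ [dW dV VW gW] WH] := PH s.
  rewrite /L mxtrace_mulC -(monodromy_iter k.+1 WH U0) add0r mulmxA VW ?mul1mx //.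
  by rewrite -[k.+1%:R]add0r; exact: vb_U_addn.
pose i (r : 'I_p'.+1) := c r.
pose g (t : R) : R := k.+1%:R * t.
pose f s := BCS_integrand a i 0 g [:: fun=> k.+1%:R] s.
have ssP l : (l < size ss)%N -> nth 0 (0 :: ss) l < nth 0 ss l.
  by move/pathP : pss => /(_ 0 l).
have piece l : (l < size ss)%N -> forall u w,
  [/\ mu.-integrable `[nth 0 (0 :: ss) l, nth 0 ss l] (EFin \o (fun s => complex.Re (f s u w))),
      mu.-integrable `[nth 0 (0 :: ss) l, nth 0 ss l] (EFin \o (fun s => complex.Im (f s u w))),
      Rintegral mu `[nth 0 (0 :: ss) l, nth 0 ss l] (fun s => complex.Re (f s u w)) =
        complex.Re (L (nth 0 ss l) u w) - complex.Re (L (nth 0 (0 :: ss) l) u w)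
    & Rintegral mu `[nth 0 (0 :: ss) l, nth 0 ss l] (fun s => complex.Im (f s u w)) =
        complex.Im (L (nth 0 ss l) u w) - complex.Im (L (nth 0 (0 :: ss) l) u w)].
  move=> ls; have [B [sB aB]] := HB l ls.
  apply: (piece_trace Uc (ltW (ssP l ls)) sB) => [j s y|s _]; first exact: aB.
  by exists (HWV s).2.1, (HWV s).2.2; split=> //; have [] := PH s.
have intf : mxint 0 1 f = L 1 - L 0.
  apply/matrixP => u w; rewrite mxintE /cint /clift.
  have [l ls|_ _ +] := @piecewise_Rintegral _ (fun s => complex.Re (f s u w))
    (fun s => complex.Re (L s u w)) 0 ss pss; first by have [? _ ? _] := piece l ls u w.
  have [l ls|_ _ +] := @piecewise_Rintegral _ (fun s => complex.Im (f s u w))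
    (fun s => complex.Im (L s u w)) 0 ss pss; first by have [_ ? _ ?] := piece l ls u w.
  rewrite lss => -> ->; rewrite [RHS]mxE [X in _ = _ + X]mxE.
  by case: (L 1 u w) (L 0 u w) => [? ?] [? ?]; simpc.
have lg : loop g by exact: loop_linear.
have dg : derive1 g = fun=> k.+1%:R by exact: derive1_linear.
have bg := dexact_velocity db lg; rewrite dg in bg.
have Fv : List.Forall tangent [:: (fun=> k.+1%:R) : R -> R].
  by apply: List.Forall_cons; [exact: tangent_cst|exact: List.Forall_nil].
have := bE p' i g [:: fun=> k.+1%:R] lg Fv (inN_linear Uc).
rewrite bg; last exact: tangent_cst.
rewrite /BCS_local /= -/f intf raddfB /= => /esym/eqP; rewrite subr_eq0 => /eqP.
rewrite !trL => tr01; have [m0' _ _] := PH 0; have [m1' _ _] := PH 1.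
exact: (etrans (monodromy_trace_uniq k.+1 m0 m0')
  (etrans (esym tr01) (esym (monodromy_trace_uniq k.+1 m1 m1')))).
Qed.

Lemma BCS_equiv_trace (E : vbundle R) (a0 a1 : conn E) H0 H1 k :
  BCS_equiv a0 a1 -> monodromy a0 H0 -> monodromy a1 H1 ->
  \tr (H0 ^+ k) = \tr (H1 ^+ k).
Proof.
move=> [a [b [pa e0 e1 ab db]]] m0 m1; case: k => [|k]; first by rewrite !expr0.
apply: (path_trace k pa ab db).
- by apply: monodromy_conn_eq m0 => i x Ui; rewrite e0.
- by apply: monodromy_conn_eq m1 => i x Ui; rewrite e1.
Qed.

End BCSTrace.

(** * The complex exponential: kernel, image and derivative *)

Section ComplexExponential.
Context {R : realType}.
Local Notation C := R[i].

Definition cexp (z : C) : C :=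
  (expR (complex.Re z) * cos (complex.Im z)) +i* (expR (complex.Re z) * sin (complex.Im z)).

Lemma cexpD z w : cexp (z + w) = cexp z * cexp w.
Proof.
case: z w => [a b] [c d]; rewrite /cexp /= expRD cosD sinD; simpc.
by congr (_ +i* _); ring.
Qed.

Lemma cexp0 : cexp 0 = 1.
Proof. by rewrite /cexp /= expR0 cos0 sin0 mulr1 mulr0. Qed.

Lemma cexpN z : cexp (- z) * cexp z = 1.
Proof. by rewrite -cexpD addNr cexp0. Qed.

Lemma cexp_neq0 z : cexp z != 0.
Proof.
by apply/eqP => z0; have := cexpN z; rewrite z0 mulr0 => /eqP; rewrite eq_sym oner_eq0.
Qed.

(** The remainder z of y modulo [2 * pi] is 0 by injectivity of the cosine on [[0, pi]]; if z
    exceeds pi, the same argument for [2 * pi - z] contradicts [z < 2 * pi]. *)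
Lemma cos_eq1 (y : R) : cos y = 1 -> exists k : int, y = 2 * k%:~R * pi.
Proof.
have pi2 : 0 < 2 * pi :> R by rewrite mulr_gt0 ?pi_gt0.
pose k := Num.floor (y / (2 * pi)); pose z := y - 2 * k%:~R * pi.
have cosz : cos z = cos y.
  have cN (m : nat) (x : R) : cos (x + 2 * m%:R * pi) = cos x.
    rewrite -(periodicn (@cosD2pi R) m x); congr (cos (x + _)).
    by rewrite -mulr_natr -[pi *+ 2]mulr_natr; ring.
  rewrite /z; case: (k) => m.
    by rewrite -[in RHS](subrK (2 * m%:R * pi) y) cN.
  by rewrite NegzE rmorphN /= mulrN mulNr opprK cN.
have := floor_itv (y / (2 * pi)); rewrite -/k => /andP[k1 k2].
have z0 : 0 <= z.
  by rewrite /z subr_ge0 -mulrA mulrCA -ler_pdivlMr.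
have z2 : z < 2 * pi.
  by move: k2; rewrite ltr_pdivrMr // intrD /z; lra.
move=> cy; exists k; apply/eqP; rewrite -subr_eq0 -/z; apply/eqP.
have cz : cos z = cos 0 by rewrite cosz cy cos0.
have [zpi|piz] := leP z pi.
  by apply: (@cos_inj R); rewrite ?in_itv /= ?z0 ?lexx ?pi_ge0.
have cz' : cos (2 * pi - z) = cos 0.
  have E : z - 2 * pi + pi *+ 2 = z by rewrite -[pi *+ 2]mulr_natr; ring.
  by rewrite -cz -cosN opprB -(cosD2pi (z - 2 * pi)) E.
have : 2 * pi - z = 0.
  apply: (@cos_inj R) => //; rewrite in_itv /= ?lexx ?pi_ge0 //.
  by apply/andP; split; lra.
by move/eqP; rewrite subr_eq0 => /eqP E; move: z2; rewrite -E ltxx.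
Qed.

Lemma cexp_eq1 (z : C) : cexp z = 1 <-> z \in @periods R.
Proof.
split=> [|/asboolP[k ->]]; last first.
  rewrite /cexp /= expR0 !mul1r.
  have cN (m : nat) : cos (2 * m%:R * pi) = 1 :> R /\ sin (2 * m%:R * pi) = 0 :> R.
    have E : 2 * m%:R * pi = 0 + (pi *+ 2) *+ m :> R.
      by rewrite add0r -mulr_natr -[pi *+ 2]mulr_natr; ring.
    by rewrite E (periodicn (@cosD2pi R)) (periodicn (@sinD2pi R)) cos0 sin0.
  case: k => m; first by have [-> ->] := cN m.
  rewrite NegzE rmorphN /= mulrN mulNr cosN sinN.
  by have [-> ->] := cN m.+1; rewrite oppr0.
case: z => a b; rewrite /cexp /= => /eqP; rewrite eq_complex /= => /andP[/eqP c1 /eqP s0].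
have sb : sin b = 0.
  by move/eqP: s0; rewrite mulf_eq0 gt_eqF ?expR_gt0 //= => /eqP.
have cb : cos b = 1.
  have := sin0cos1 sb; have [cb|cb] := leP 0 (cos b); first by rewrite ger0_norm.
  have : expR a * cos b < 0 by rewrite pmulr_rlt0 ?expR_gt0.
  by rewrite c1 ltr10.
have ea : a = 0.
  by move: c1; rewrite cb mulr1 -expR0 => /expR_inj.
have [k ->] := cos_eq1 cb; apply/asboolP; exists k.
by rewrite ea.
Qed.

(** Polar coordinates: the argument is [acos (a / r)] up to a sign, which is that of [b]. *)
Lemma cexp_surj (z : C) : z != 0 -> exists w, cexp w = z.
Proof.
case: z => a b ab0.
pose r := Num.sqrt (a ^+ 2 + b ^+ 2).
have r2 : r ^+ 2 = a ^+ 2 + b ^+ 2 by rewrite sqr_sqrtr // addr_ge0 ?sqr_ge0.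
have r0 : 0 < r.
  rewrite lt_neqAle sqrtr_ge0 andbT eq_sym; apply: contra ab0 => /eqP r0.
  move: r2; rewrite r0 expr0n /= => /esym/eqP; rewrite paddr_eq0 ?sqr_ge0 //.
  by rewrite !sqrf_eq0 => /andP[/eqP-> /eqP->].
have rn0 : r != 0 by rewrite gt_eqF.
have ar : (a / r) ^+ 2 + (b / r) ^+ 2 = 1.
  by rewrite !expr_div_n -mulrDl -r2 divff // expf_neq0.
have ar1 : -1 <= a / r <= 1.
  have : `|a / r| ^+ 2 <= 1 by rewrite real_normK ?num_real // -ar lerDl sqr_ge0.
  by rewrite expr_le1 // ler_norml.
have e : expR (ln r) = r by rewrite lnK // posrE.
have s2 : sin (acos (a / r)) = `|b / r|.
  rewrite sin_acos //; have -> : 1 - (a / r) ^+ 2 = (b / r) ^+ 2 by rewrite -ar addrAC subrr add0r.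
  by rewrite sqrtr_sqr.
have ca : cos (acos (a / r)) = a / r by apply: acosK; rewrite in_itv.
have [b0|b0] := leP 0 (b / r).
  exists (ln r +i* acos (a / r)); rewrite /cexp /= e ca s2 ger0_norm //.
  by rewrite ![r * _]mulrC !divfK.
exists (ln r +i* (- acos (a / r))); rewrite /cexp /= e cosN sinN ca s2 ltr0_norm // opprK.
by rewrite ![r * _]mulrC !divfK.
Qed.

Lemma cder_cexp (m : C) x : cder (fun y : R => cexp (y%:C * m)) (m * cexp (x%:C * m)) x.
Proof.
case: m => a b.
have dl c : is_derive x (1 : R) (fun y : R => y * c) c.
  have := is_deriveM (is_derive_id x (1 : R)) (is_derive_cst c x 1).
  by rewrite /GRing.scale /= mulr0 mulr1 add0r.
have de : is_derive x (1 : R) (fun y : R => expR (y * a)) (a * expR (x * a)).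
  by apply: is_derive_eq (is_derive1_comp (is_derive_expR _) (dl a)) _; rewrite mulrC.
have dc : is_derive x (1 : R) (fun y : R => cos (y * b)) (- sin (x * b) * b).
  exact: (is_derive1_comp (is_derive_cos _) (dl b)).
have ds : is_derive x (1 : R) (fun y : R => sin (y * b)) (cos (x * b) * b).
  exact: (is_derive1_comp (is_derive_sin _) (dl b)).
have E (y : R) : y%:C * (a +i* b) = (y * a) +i* (y * b) by simpc.
rewrite (_ : (fun y : R => _) = fun y => (expR (y * a) * cos (y * b)) +i* (expR (y * a) * sin (y * b))); last first.
  by apply/funext => y; rewrite E.
rewrite E /cexp /=; split => /=.
- apply: is_derive_eq (is_deriveM de dc) _.
  by rewrite /GRing.scale /=; ring.
- apply: is_derive_eq (is_deriveM de ds) _.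
  by rewrite /GRing.scale /=; ring.
Qed.

End ComplexExponential.

(** * Exponential polynomials and their difference equations *)

Section ExponentialPolynomials.
Context {R : realType}.
Local Notation C := R[i].

Definition exppoly (l : seq ({poly C} * C)) (x : R) : C :=
  \sum_(pm <- l) pm.1.[x%:C] * cexp (x%:C * pm.2).

(** The gauge is built inside this class because it is closed under products and derivatives,
    consists of smooth functions, and contains a solution of [z (x + 1) - z x = f x] for each of its
    members f. *)
Definition ep (f : R -> C) : Prop := exists l, f =1 exppoly l.

Definition mxep {m n} (F : R -> 'M[C]_(m, n)) : Prop := forall i j, ep (fun x => F x i j).

Lemma ep_eq f g : f =1 g -> ep f -> ep g.
Proof. by move=> fg [l fl]; exists l => x; rewrite -fg. Qed.

Lemma ep_atom p m : ep (fun x => p.[x%:C] * cexp (x%:C * m)).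
Proof. by exists [:: (p, m)] => x; rewrite /exppoly big_seq1. Qed.

Lemma ep_cst c : ep (fun=> c).
Proof.
by apply: ep_eq (ep_atom c%:P 0) => x; rewrite hornerC mulr0 cexp0 mulr1.
Qed.

Lemma ep_cexp m : ep (fun x => cexp (x%:C * m)).
Proof. by apply: ep_eq (ep_atom 1 m) => x; rewrite hornerC mul1r. Qed.

Lemma epD f g : ep f -> ep g -> ep (fun x => f x + g x).
Proof.
by move=> [l fl] [l' gl]; exists (l ++ l') => x; rewrite fl gl /exppoly big_cat.
Qed.

Lemma ep_sum I (r : seq I) (f : I -> R -> C) : (forall i, ep (f i)) ->
  ep (fun x => \sum_(i <- r) f i x).
Proof.
move=> ef; elim: r => [|i r IH].
  by apply: ep_eq (ep_cst 0) => x; rewrite big_nil.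
by apply: ep_eq (epD (ef i) IH) => x; rewrite big_cons.
Qed.

Lemma epM f g : ep f -> ep g -> ep (fun x => f x * g x).
Proof.
move=> [l fl] [l' gl].
apply: (@ep_eq (fun x => \sum_(pm <- l) \sum_(qk <- l')
    (pm.1 * qk.1).[x%:C] * cexp (x%:C * (pm.2 + qk.2)))).
  move=> x; rewrite fl gl /exppoly mulr_suml; apply: eq_bigr => pm _.
  rewrite mulr_sumr; apply: eq_bigr => qk _.
  by rewrite hornerM mulrDr cexpD mulrACA.
by apply: ep_sum => pm; apply: ep_sum => qk; exact: ep_atom.
Qed.

Lemma cder_id x : cder (fun y : R => y%:C) 1 x.
Proof. by split; [exact: is_derive_id|exact: is_derive_cst]. Qed.

Lemma cder_horner (p : {poly C}) x : cder (fun y : R => p.[y%:C]) p^`().[x%:C] x.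
Proof.
elim/poly_ind: p => [|p c IH].
  rewrite linear0 horner0; under eq_fun do rewrite horner0; exact: cder_cst.
under eq_fun do rewrite !hornerE.
have := cderD (cderM IH (cder_id x)) (cder_cst c x).
by rewrite mulr1 derivD derivM derivX derivC !hornerE.
Qed.

Lemma ep_der f : ep f -> exists2 d, ep d & forall x, cder f (d x) x.
Proof.
move=> [l fl].
exists (fun x => \sum_(pm <- l) (pm.1^`() + pm.2 *: pm.1).[x%:C] * cexp (x%:C * pm.2)).
  by apply: ep_sum => pm; exact: ep_atom.
move=> x; rewrite (funext fl); apply: cder_sum => pm.
have := cderM (cder_horner pm.1 x) (cder_cexp pm.2 x).
by rewrite hornerD hornerZ mulrDl mulrCA mulrA.
Qed.

Lemma ep_csmooth f : ep f -> csmooth setT f.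
Proof.
move=> ef.
have K : forall u, (exists2 f, ep f & u = fun x => complex.Re (f x)) -> smooth (setT : set R) u.
  apply: (smooth_class openT) => [u x [h eh ->] _|u v [h eh ->]].
    by have [d _ /(_ x)[[]]] := ep_der eh.
  have [d ed hd] := ep_der eh.
  exists (fun x => complex.Re (v%:C * d x)).
    by exists (fun x => v%:C * d x) => //; apply: epM => //; exact: ep_cst.
  move=> x _; have [[_ ->] _] := hd x.
  by case: (d x) => a b /=; rewrite mul0r subr0.
split; apply: K; first by exists f.
exists (fun x => - 'i * f x); first by apply: epM => //; exact: ep_cst.
by apply/funext => x; case: (f x) => a b; simpc.
Qed.

(* The leading term of [c *: (q \Po ('X + 1)) - q] is [(c - 1) * q_k] in the
   degree k of q or, for [c = 1], [k * q_k] in degree [k - 1]. *)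
Lemma poly_difference (c : C) (p : {poly C}) : c != 0 ->
  exists q, c *: (q \Po ('X + 1)) - q = p.
Proof.
move=> c0.
pose D (q : {poly C}) := c *: (q \Po ('X + 1)) - q.
have DD q r : D (q + r) = D q + D r.
  by rewrite /D comp_polyD scalerDr opprD addrACA.
have DZ a q : D (a *: q) = a *: D q.
  by rewrite /D comp_polyZ scalerA mulrC -scalerA scalerBr.
have DB q r : D (q - r) = D q - D r.
  by rewrite DD -scaleN1r DZ scaleN1r.
have Dsum N (a : 'I_N -> C) (q r : 'I_N -> {poly C}) : (forall j, D (q j) = r j) ->
    D (\sum_(j < N) a j *: q j) = \sum_(j < N) a j *: r j.
  move=> qr; elim: N a q r qr => [|N IH] a q r qr.
    by rewrite !big_ord0 /D comp_poly0 scaler0 subrr.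
  by rewrite !big_ord_recr /= DD DZ qr (IH _ _ _ (fun j => qr _)).
have DX k : D 'X^k = (c - 1) *: 'X^k + \sum_(j < k) (c * ('C(k, j))%:R) *: 'X^j.
  rewrite /D comp_Xn_poly exprD1n big_ord_recr /= binn mulr1n scalerDr scalerBl scale1r.
  rewrite -addrA addrC; congr (_ + _).
  by rewrite scaler_sumr; apply: eq_bigr => j _; rewrite -scaler_nat scalerA.
have mon k : exists q, D q = 'X^k.
  elim/ltn_ind: k => k IH.
  have /choice[q Hq] : forall j : 'I_k, exists q, D q = 'X^j by move=> j; exact: IH.
  have [c1|c1] := eqVneq c 1.
    exists (k.+1%:R^-1 *: ('X^(k.+1) - \sum_(j < k) ('C(k.+1, j))%:R *: q j)).
    rewrite DZ DB (Dsum _ _ _ _ Hq) DX c1 subrr scale0r add0r.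
    rewrite big_ord_recr /= !mul1r.
    rewrite addrAC -sumrB big1 => [|j _]; last by rewrite mul1r subrr.
    rewrite add0r binSn scalerA mulVf ?scale1r // pnatr_eq0.
  exists ((c - 1)^-1 *: ('X^k - \sum_(j < k) (c * ('C(k, j))%:R) *: q j)).
  rewrite DZ DB (Dsum _ _ _ _ Hq) DX addrK scalerA mulVf ?scale1r //.
  by rewrite subr_eq0.
have /choice[q Hq] := mon.
exists (\sum_(j < size p) p`_j *: q j); rewrite -/(D _) (Dsum _ _ _ _ (fun j => Hq j)).
by rewrite -poly_def coefK.
Qed.

(** Shifting [q(x) exp(m x)] by 1 multiplies its exponential by [cexp m], so each term reduces to
    [poly_difference] with [c = cexp m]. *)
Lemma ep_difference f : ep f -> exists2 z, ep z & forall x, z (x + 1) - z x = f x.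
Proof.
move=> [l fl].
have /choice[q Hq] : forall pm : {poly C} * C, exists q,
    cexp pm.2 *: (q \Po ('X + 1)) - q = pm.1.
  by move=> pm; apply: poly_difference; exact: cexp_neq0.
exists (fun x => \sum_(pm <- l) (q pm).[x%:C] * cexp (x%:C * pm.2)).
  by apply: ep_sum => pm; exact: ep_atom.
move=> x; rewrite fl /exppoly -sumrB; apply: eq_bigr => pm _.
rewrite -[in RHS](Hq pm) !hornerE horner_comp !hornerE mulrBl; congr (_ - _).
have -> : (x + 1)%:C = x%:C + 1 :> C by rewrite raddfD.
by rewrite mulrDl mul1r cexpD; ring.
Qed.

Lemma mxepM m n p (F : R -> 'M[C]_(m, n)) (G : R -> 'M[C]_(n, p)) :
  mxep F -> mxep G -> mxep (fun x => F x *m G x).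
Proof.
move=> eF eG i j; apply: (@ep_eq (fun x => \sum_k F x i k * G x k j)).
  by move=> x; rewrite mxE.
by apply: ep_sum => k; apply: epM; [exact: eF|exact: eG].
Qed.

Lemma mxep_cst m n (A : 'M[C]_(m, n)) : mxep (fun=> A).
Proof. by move=> i j; exact: ep_cst. Qed.

Lemma mxepZ m n f (F : R -> 'M[C]_(m, n)) : ep f -> mxep F -> mxep (fun x => f x *: F x).
Proof. by move=> ef eF i j; under eq_fun do rewrite mxE; exact: epM. Qed.

Lemma mxep_block m1 m2 n1 n2 (A : R -> 'M[C]_(m1, n1)) (B : R -> 'M[C]_(m1, n2))
    (D : R -> 'M[C]_(m2, n1)) (E : R -> 'M[C]_(m2, n2)) :
  mxep A -> mxep B -> mxep D -> mxep E ->
  mxep (fun x => block_mx (A x) (B x) (D x) (E x)).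
Proof.
move=> eA eB eD eE i j; rewrite -(splitK i) -(splitK j).
case: (fintype.split i) => a; case: (fintype.split j) => b /=.
- by under eq_fun do rewrite block_mxEul; exact: eA.
- by under eq_fun do rewrite block_mxEur; exact: eB.
- by under eq_fun do rewrite block_mxEdl; exact: eD.
- by under eq_fun do rewrite block_mxEdr; exact: eE.
Qed.

Lemma mxep_smooth m n (F : R -> 'M[C]_(m, n)) : mxep F -> mxsmooth setT F.
Proof. by move=> eF i j; exact: ep_csmooth. Qed.

Lemma mxep_der m n (F : R -> 'M[C]_(m, n)) : mxep F ->
  exists2 D, mxep D & forall x, mxder F (D x) x.
Proof.
move=> eF; have /choice[d Hd] : forall ij : 'I_m * 'I_n, exists d,
    ep d /\ forall x, cder (fun x => F x ij.1 ij.2) (d x) x.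
  by move=> ij; have [d ? ?] := ep_der (eF ij.1 ij.2); exists d.
exists (fun x => \matrix_(i, j) d (i, j) x) => [i j|x i j].
  by under eq_fun do rewrite mxE; exact: (Hd (i, j)).1.
by rewrite mxE; exact: (Hd (i, j)).2.
Qed.

Lemma mxep_difference m n (F : R -> 'M[C]_(m, n)) : mxep F ->
  exists2 Z, mxep Z & forall x, Z (x + 1) - Z x = F x.
Proof.
move=> eF; have /choice[d Hd] : forall ij : 'I_m * 'I_n, exists d,
    ep d /\ forall x, d (x + 1) - d x = F x ij.1 ij.2.
  by move=> ij; have [d ? ?] := ep_difference (eF ij.1 ij.2); exists d.
exists (fun x => \matrix_(i, j) d (i, j) x) => [i j|x].
  by under eq_fun do rewrite mxE; exact: (Hd (i, j)).1.
by apply/matrixP => i j; rewrite !mxE; exact: (Hd (i, j)).2.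
Qed.

End ExponentialPolynomials.

(** * A triangular gauge with prescribed monodromy *)

Section ExponentialGauge.
Context {R : realType}.
Local Notation C := R[i].

Lemma char_poly_conj n (P H : 'M[C]_n) : P \in unitmx ->
  char_poly (P *m H *m invmx P) = char_poly H.
Proof.
move=> uP; rewrite /char_poly /char_poly_mx.
pose f := map_mx (@polyC C) : 'M[C]_n -> 'M[{poly C}]_n.
have PV : f P *m f (invmx P) = 1%:M by rewrite -map_mxM mulmxV // map_mx1.
have -> : 'X%:M - map_mx polyC (P *m H *m invmx P) =
    f P *m ('X%:M - map_mx polyC H) *m f (invmx P).
  rewrite mulmxBr mulmxBl scalar_mxC -(mulmxA 'X%:M) PV mulmx1; congr (_ - _).
  by rewrite /f !map_mxM.
by rewrite !det_mulmx mulrAC -det_mulmx PV det1 mul1r.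
Qed.

Lemma char_poly_lblock m n (A : 'M[C]_m) u (B : 'M[C]_n) :
  char_poly (block_mx A 0 u B) = char_poly A * char_poly B.
Proof.
rewrite /char_poly /char_poly_mx map_block_mx map_mx0 scalar_mx_block.
by rewrite opp_block_mx add_block_mx oppr0 addr0 det_lblock.
Qed.

Lemma lblock_expr m n (A : 'M[C]_m) u (B : 'M[C]_n) k :
  exists w, (block_mx A 0 u B) ^+ k = block_mx (A ^+ k) 0 w (B ^+ k).
Proof.
elim: k => [|k [w IH]]; first by exists 0; rewrite !expr0 -scalar_mx_block.
exists (u *m A ^+ k + B *m w); rewrite !exprS IH -!mulmxE mulmx_block.
by rewrite !(mulmx0, mul0mx, addr0, add0r).
Qed.

(** In the rank normal form of a row the left factor is a scalar c, so v is c times the first row of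
    the invertible matrix [row_ebase v]. *)
Lemma unit_row_extend n (v : 'rV[C]_n.+1) : v != 0 ->
  exists2 P : 'M[C]_n.+1, P \in unitmx & row 0 P = v.
Proof.
move=> v0.
have rv : \rank v = 1%N by apply/eqP; rewrite rank_rV v0.
pose c := col_ebase v 0 0.
have c0 : c != 0.
  have := col_ebase_unit v; rewrite unitmxE det_mx11 unitfE; exact.
exists (c *: row_ebase v).
  by rewrite unitmxZ ?row_ebase_unit // unitfE.
rewrite -[RHS]mulmx_ebase rv linearZ /= rowE.
have -> : col_ebase v = c%:M by exact: mx11_scalar.
rewrite -mulmxA mul_scalar_mx; congr (_ *: (_ *m _)).
apply/matrixP => i j; rewrite !mxE !ord1 /= andbT.
by rewrite -val_eqE /= eq_sym; case: (nat_of_ord j).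
Qed.

(* Gi * D is a triangular connection with monodromy H.  The induction splits off
   one eigenvector of H; the remaining column solves a difference equation. *)
Lemma exp_gauge n (H : 'M[C]_n) (l : nat -> C) :
  char_poly H = \prod_(i < n) ('X - (cexp (l i))%:P) ->
  (forall k, \tr (H ^+ k) = \sum_(i < n) cexp (l i) ^+ k) /\
  exists G Gi D : R -> 'M[C]_n,
  [/\ [/\ mxep G, mxep Gi & mxep D],
      forall x, G x *m Gi x = 1%:M,
      forall x, mxder G (D x) x,
      forall x, G (x + 1) = H *m G x
    & forall x (i j : 'I_n), (i <= j)%N -> (Gi x *m D x) i j = l i *+ (i == j)].
Proof.
elim: n H l => [|n IH] H l Hl.
  split=> [k|]; first by rewrite big_ord0 /mxtrace big_ord0.
  exists (fun=> 0), (fun=> 0), (fun=> 0); split.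
  - by split=> -[].
  - by move=> x; apply/matrixP => -[].
  - by move=> x -[].
  - by move=> x; apply/matrixP => -[].
  - by move=> x -[].
have eH : eigenvalue H (cexp (l 0%N)).
  by rewrite eigenvalue_root_char Hl big_ord_recl rootM root_XsubC eqxx.
have [v vH v0] := eigenvalueP eH; have [P uP Pv] := unit_row_extend v0.
pose la := cexp (l 0%N).
(* The first row of [P] is a left eigenvector of [H], so the first row of [H1] is [la] followed by
   zeros. *)
pose H1 : 'M[C]_(1 + n) := P *m H *m invmx P.
have row0 : row 0 H1 = la *: row 0 (1%:M : 'M[C]_(1 + n)).
  by rewrite /H1 !row_mul Pv vH -scalemxAl -Pv -row_mul mulmxV.
have H1E : H1 = block_mx la%:M 0 (dlsubmx H1) (drsubmx H1).
  rewrite -[LHS]submxK; congr block_mx.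
    apply/matrixP => i j; have := congr1 (fun r : 'rV_(1 + n) => r 0 (lshift n j)) row0.
    rewrite !mxE => e; rewrite !ord1 in e *.
    rewrite (_ : lshift n 0 = 0) in e *; last exact: val_inj.
    by rewrite e eqxx mulr1 mulr1n.
  apply/matrixP => i j; have := congr1 (fun r : 'rV_(1 + n) => r 0 (rshift 1 j)) row0.
  rewrite !mxE => e; rewrite !ord1 in e *.
  by rewrite (_ : lshift n 0 = 0) ?e ?mulr0 //; exact: val_inj.
set u := dlsubmx H1 in H1E; set H' := drsubmx H1 in H1E.
have Hl' : char_poly H' = \prod_(i < n) ('X - (cexp (l i.+1))%:P).
  have cE : char_poly H1 = char_poly (la%:M : 'M[C]_1) * char_poly H'.
    by rewrite {1}H1E char_poly_lblock.
  move: (etrans (esym (char_poly_conj H uP)) cE); rewrite Hl big_ord_recl.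
  have -> : char_poly (la%:M : 'M[C]_1) = 'X - la%:P.
    by rewrite /char_poly det_mx11 /char_poly_mx !mxE eqxx.
  by move=> e; apply/esym; apply: mulfI e; rewrite polyXsubC_eq0.
have [trH' [G' [Gi' [D' [[eG eGi eD] GGi dG GH GD]]]]] := IH H' (fun i => l i.+1) Hl'.
split.
  move=> k; have -> : \tr (H ^+ k) = \tr (H1 ^+ k).
    apply: (@conj_trace_expr _ _ _ (invmx P) P); rewrite ?mulVmx ?mulmxV //.
    by rewrite /H1 !mulmxA mulVmx // mul1mx.
  have [w e] := lblock_expr la%:M u H' k.
  have e1 : \tr (H1 ^+ k) = \tr (la%:M ^+ k : 'M[C]_1) + \tr (H' ^+ k).
    by rewrite -(@mxtrace_block _ 1 n _ 0 w) -e -H1E.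
  apply: etrans e1 _; rewrite trH' big_ord_recl; congr (_ + _).
  elim: k {w e} => [|k IHk]; first by rewrite !expr0 mxtrace1.
  rewrite !exprS -mulmxE mul_scalar_mx mxtraceZ.
  by rewrite IHk.
have uH' : H' \in unitmx.
  have := GGi (0 + 1); rewrite GH -mulmxA => /mulmx1_unit[]; exact.
(* The lower left block w of the gauge must satisfy [w (x + 1) = cexp (x l_0) u + H' w x]. Writing
   [w = G' Z] and using [G' (x + 1) = H' G' x] turns this into [Z (x + 1) - Z x = f x]. *)
pose f x := cexp (x%:C * l 0%N) *: (Gi' x *m (invmx H' *m u)).
have ef : mxep f.
  by apply: mxepZ; [exact: ep_cexp|apply: mxepM => //; exact: mxep_cst].
have [Z eZ HZ] := mxep_difference ef.
pose w x := G' x *m Z x.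
have ew : mxep w by exact: mxepM.
have [w' ew' dw] := mxep_der ew.
have wH x : w (x + 1) = cexp (x%:C * l 0%N) *: u + H' *m w x.
  rewrite /w GH -(subrK (Z x) (Z (x + 1))) HZ mulmxDr /f -!scalemxAr -!mulmxA; congr (_ + _).
  by rewrite !mulmxA -[H' *m _ *m Gi' x]mulmxA GGi mulmx1 mulmxV // mul1mx.
pose e x := cexp (x%:C * l 0%N).
pose ei x := cexp (x%:C * (- l 0%N)).
have eei x : e x * ei x = 1 by rewrite /e /ei mulrN mulrC cexpN.
pose sc (f : R -> C) x : 'M[C]_1 := (f x)%:M.
have esc h : ep h -> mxep (sc h).
  by move=> eh i j; under eq_fun do rewrite mxE !ord1 eqxx mulr1n.
have ee : ep e by exact: ep_cexp.
have eei' : ep ei by exact: ep_cexp.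
pose G0 x := block_mx (sc e x) 0 (w x) (G' x).
pose Gi0 x := block_mx (sc ei x) 0 (- (ei x *: Z x)) (Gi' x).
pose D0 x := block_mx (l 0%N *: sc e x) 0 (w' x) (D' x).
have GiG x : Gi' x *m G' x = 1%:M by exact: mulmx1C.
have eG0 : mxep G0 by apply: mxep_block => //; [exact: esc|exact: mxep_cst].
have eGi0 : mxep Gi0.
  apply: mxep_block => //; [exact: esc|exact: mxep_cst|].
  under eq_fun do rewrite -scaleNr.
  apply: mxepZ => //; apply: ep_eq (epM (ep_cst (-1)) eei') => x.
  by rewrite mulN1r.
have eD0 : mxep D0.
  apply: mxep_block => //; [|exact: mxep_cst].
  by apply: mxepZ; [exact: ep_cst|exact: esc].
exists (fun x => invmx P *m G0 x), (fun x => Gi0 x *m P), (fun x => invmx P *m D0 x).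
split.
- by split; [exact: (mxepM (mxep_cst _) eG0)|exact: (mxepM eGi0 (mxep_cst _))|
    exact: (mxepM (mxep_cst _) eD0)].
- move=> x; rewrite mulmxA -[invmx P *m G0 x *m Gi0 x]mulmxA.
  suff -> : G0 x *m Gi0 x = 1%:M by rewrite mulmx1 mulVmx.
  rewrite mulmx_block !(mulmx0, mul0mx, addr0, add0r) GGi.
  rewrite /sc -scalar_mxM eei mul_mx_scalar mulmxN -scalemxAr.
  by rewrite -/(w x) subrr -scalar_mx_block.
- move=> x; have dG0 : mxder G0 (D0 x) x.
    apply: (@mxder_block R 1 n 1 n) => //; last exact: mxder_cst.
    move=> i j; under eq_fun do rewrite mxE !ord1 eqxx mulr1n.
    rewrite !mxE !ord1 eqxx mulr1n; exact: cder_cexp.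
  exact: (mxderMl _ dG0).
- move=> x; have -> : H *m (invmx P *m G0 x) = invmx P *m (H1 *m G0 x).
    by rewrite /H1 !mulmxA mulVmx // mul1mx.
  have ce : cexp ((x + 1)%:C * l 0%N) = la * cexp (x%:C * l 0%N).
    by rewrite raddfD mulrDl mul1r cexpD mulrC.
  suff -> : G0 (x + 1) = (H1 : 'M[C]_(1 + n)) *m G0 x by [].
  rewrite H1E /G0 mulmx_block !(mulmx0, mul0mx, addr0, add0r) GH wH /sc /e ce.
  by rewrite -scalar_mxM mul_mx_scalar.
- move=> x i j ij.
  have -> : Gi0 x *m P *m (invmx P *m D0 x) = Gi0 x *m D0 x.
    by rewrite mulmxA -[_ *m P *m _]mulmxA mulmxV // mulmx1.
  rewrite mulmx_block !(mulmx0, mul0mx, addr0, add0r).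
  have [a ia|a ia] := @split_ordP 1 n i; have [b jb|b jb] := @split_ordP 1 n j;
    rewrite ia jb in ij *.
  + apply: (etrans (@block_mxEul C 1 n 1 n _ _ _ _ a b)); rewrite !ord1 eqxx /sc scale_scalar_mx -scalar_mxM mulrCA.
    by rewrite [ei x * _]mulrC eei !mxE eqxx mulr1.
  + apply: (etrans (@block_mxEur C 1 n 1 n _ _ _ _ a b)).
    by rewrite mxE -val_eqE /= ord1.
  + by move: ij; rewrite /= !ord1.
  + apply: (etrans (@block_mxEdr C 1 n 1 n _ _ _ _ a b)).
    by rewrite GD // -!val_eqE.
Qed.

End ExponentialGauge.

(** * Vanishing of BCS along triangular paths *)

Section TriangularPath.
Context {R : realType}.
Local Notation C := R[i].

(* d = 0: lower triangular; d = 1: strictly lower triangular. *)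
Definition low {n} (d : nat) (A : 'M[C]_n) : Prop :=
  forall i j : 'I_n, (i < j + d)%N -> A i j = 0.

Lemma low0 n d : low d (0 : 'M[C]_n).
Proof. by move=> i j _; rewrite mxE. Qed.

Lemma low1 n : low 0 (1%:M : 'M[C]_n).
Proof. by move=> i j; rewrite addn0 mxE -val_eqE; case: ltngtP. Qed.

Lemma lowS n d e (A : 'M[C]_n) : (e <= d)%N -> low d A -> low e A.
Proof. by move=> ed lA i j ij; apply: lA; apply: leq_trans ij _; rewrite leq_add2l. Qed.

Lemma lowD n d (A B : 'M[C]_n) : low d A -> low d B -> low d (A + B).
Proof. by move=> lA lB i j ij; rewrite mxE lA // lB // addr0. Qed.

Lemma lowZ n d c (A : 'M[C]_n) : low d A -> low d (c *: A).
Proof. by move=> lA i j ij; rewrite mxE lA // mulr0. Qed.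

Lemma lowN n d (A : 'M[C]_n) : low d A -> low d (- A).
Proof. by rewrite -scaleN1r; exact: lowZ. Qed.

Lemma low_sum n d I (r : seq I) (P : pred I) (F : I -> 'M[C]_n) :
  (forall i, P i -> low d (F i)) -> low d (\sum_(i <- r | P i) F i).
Proof.
move=> lF i j ij; rewrite summxE big1 // => k Pk; exact: lF.
Qed.

(** [low d] is the filtration by distance below the diagonal, and distances add along products. *)
Lemma lowM n d e (A B : 'M[C]_n) : low d A -> low e B -> low (d + e) (A *m B).
Proof.
move=> lA lB i j ij; rewrite mxE big1 // => k _.
have [ik|ki] := ltnP i (k + d); first by rewrite lA ?mul0r.
by rewrite lB ?mulr0 // -(ltn_add2r d) (leq_ltn_trans ki) // -addnA [(e + d)%N]addnC.
Qed.

(** An entry that vanishes identically is sent to the image of the zero function; this treats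
    integrals, derivatives and limits at once. *)
Lemma low_lift n d (T : Type) (L : (T -> R) -> R) (F : T -> 'M[C]_n) :
  L (fun=> 0) = 0 -> (forall x, low d (F x)) -> low d (mxlift L F).
Proof.
move=> L0 lF i j ij; rewrite mxE /clift.
under eq_fun do rewrite (lF _ _ _ ij) /=.
by under [in X in _ +i* X]eq_fun do rewrite (lF _ _ _ ij) /=; rewrite L0.
Qed.

Lemma low_mxint n d a b (F : R -> 'M[C]_n) :
  (forall x, low d (F x)) -> low d (mxint a b F).
Proof. by apply: low_lift; rewrite Rintegral_cst ?mul0r. Qed.

Lemma low_mxderiv n d (F : R -> 'M[C]_n) x :
  (forall x, low d (F x)) -> low d (mxderiv F x).
Proof. by apply: low_lift; rewrite derive1E derive_cst. Qed.

Lemma low_mxlim n d (F : nat -> 'M[C]_n) :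
  (forall k, low d (F k)) -> low d (mxlim F).
Proof. by apply: low_lift; rewrite lim_cst. Qed.

Lemma low_trace n (A : 'M[C]_n) : low 1 A -> \tr A = 0.
Proof. by move=> lA; rewrite /mxtrace big1 // => i _; rewrite lA // addn1. Qed.

Definition lowf {T n} d (al : seq T -> 'M[C]_n) := forall vs, low d (al vs).

Lemma lowf_wedge T n d e (al be : seq T -> 'M[C]_n) :
  lowf d al -> lowf e be -> lowf (d + e) (wedge al be).
Proof.
move=> lal lbe vs; elim: vs al be lal lbe => [|v vs IH] al be lal lbe /=.
  by apply: lowM; [exact: lal|exact: lbe].
apply: lowD; apply: IH => us //.
by apply: lowZ; exact: lal.
Qed.

Lemma lowf_form0 T n (A : 'M[C]_n) : low 0 A -> lowf 0 (@form0 R n T A).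
Proof. by move=> lA [|v vs] //=; exact: low0. Qed.

Lemma lowf_big T n (I : Type) (r : seq I) (P : pred I) (d : I -> nat)
    (F : I -> seq T -> 'M[C]_n) :
  (forall i, P i -> lowf (d i) (F i)) ->
  lowf (\sum_(i <- r | P i) d i) (\big[wedge/form0 1%:M]_(i <- r | P i) F i).
Proof.
move=> lF; elim: r => [|i r IH].
  by rewrite !big_nil; apply: lowf_form0; exact: low1.
rewrite !big_cons; case: ifP => // Pi; exact: lowf_wedge (lF i Pi) IH.
Qed.

Lemma low_simplex n d k a b (F : seq R -> 'M[C]_n) :
  (forall ts, low d (F ts)) -> low d (simplex_int k a b F).
Proof.
elim: k a F => [|k IH] a F lF /=; first exact: lF.
by apply: low_mxint => t; apply: IH => ts; exact: lF.
Qed.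

Lemma lowf_form1 n d (a : R -> 'M[C]_n) x : low d (a x) -> lowf d (form1 a x).
Proof. by move=> la [|u [|v vs]] //=; [exact: low0|exact: lowZ|exact: low0]. Qed.

Lemma lowf_curv n (a : R -> 'M[C]_n) x : (forall x, low 0 (a x)) -> lowf 0 (curv a x).
Proof.
move=> la us; apply: lowD; last first.
  by apply: (@lowf_wedge _ _ 0 0); exact: lowf_form1.
case: us => [|u [|v [|w us]]]; [exact: low0|exact: low0| |exact: low0].
rewrite /dform1; apply: lowD; first by apply: lowZ; apply: low_mxderiv => y; exact: lowf_form1.
by apply: lowN; apply: lowZ; apply: low_mxderiv => y; exact: lowf_form1.
Qed.

(* Each term contains one factor A', which is strictly triangular. *)
Lemma triangular_BCS (E : vbundle R) (a : R -> conn E) :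
  (forall (i j : vb_idx E) x, low 0 (vb_g i j x)) -> (forall s i x, low 0 (cn_A (a s) i x)) ->
  (forall s i x, low 1 (mxderiv (fun s => cn_A (a s) i x) s)) ->
  is_BCS a (fun _ _ => 0).
Proof.
move=> lg lA lA' p i g vs _ _ _; rewrite /BCS_local; case: ifP => // _.
apply/esym/low_trace/low_mxint => s; apply: low_mxlim => N.
apply: low_sum => nn _; apply: low_sum => J _; apply: low_sum => qm.
rewrite inE => /andP[qmJ qmS].
(* The boolean serves as weight: as [qm] is outside [J], the factor there is A', of weight 1, and
   all other factors have weight 0. *)
have lX rj t : lowf (rj == qm) (BCS_X a i s J qm rj t g).
  rewrite /BCS_X; case: ifP => [rjJ us|_].
    by have /negPf-> : rj != qm by [apply: contraNneq qmJ => <-]; exact: lowf_curv.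
  case: eqP => _ us; first exact: lowf_form1.
  exact: lowf_form1.
have lI r : lowf (\sum_(j < N | (j < nn r)%N) ((r, j) == qm)) (BCS_I a i s nn J qm r g).
  move=> us; apply: low_simplex => ts.
  by apply: (lowf_big (d := fun j => nat_of_bool ((r, j) == qm))) => j _; exact: lX.
have := @lowf_big _ _ _ (index_enum 'I_p.+1) xpredT
  (fun r => 0 + \sum_(j < N | (j < nn r)%N) ((r, j) == qm))%N
  (fun r => wedge (form0 (vb_g (i (ord_pred r)) (i r) (g (r%:R / p.+1%:R))))
          (BCS_I a i s nn J qm r g)) _ vs.
move=> /(_ _)/(lowS _); apply; last first.
  by move=> r _; apply: lowf_wedge; [apply: lowf_form0|].
(* The total weight is at least 1, because [qm] lies in [Sset nn] and its position is thus among
   those summed over. *)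
rewrite (bigD1 qm.1) //= (bigD1 qm.2) /=; last by move: qmS; rewrite inE.
by rewrite -surjective_pairing eqxx.
Qed.

Lemma dexact_0 : dexact (fun _ _ => 0 : C).
Proof.
have ldir0 m : iter m ldir (fun _ _ => 0 : C) = (fun _ _ => 0) :> lform R.
  elim: m => //= m ->; apply/funext => g; apply/funext => -[|h vs] //=.
  by rewrite cderiv_cst.
have dform0 : dform (fun _ _ => 0 : C) = (fun _ _ => 0) :> lform R.
  apply/funext => g; apply/funext => vs; rewrite /dform big1 // => r _.
  by rewrite -[ldir _]/(iter 1 ldir _) ldir0 mulr0.
exists (fun _ _ => 0); split=> //; last first.
- by move=> g vs _ _; rewrite dform0 /iota_form addr0.
- by move=> g vs _ _; rewrite /iota_form !dform0 addr0.
split=> //.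
  by move=> *; rewrite mulr0 addr0.
move=> m g vs _ _; rewrite ldir0; split=> [h _|e e0].
  by split; exact: derivable_cst.
exists 0%N, 1; split=> // *; rewrite subrr normr0.
by rewrite ltcR.
Qed.

End TriangularPath.

(** * Reduction to a constant diagonal connection *)

Section Diagonalization.
Context {R : realType}.
Local Notation C := R[i].

Lemma smooth_snd (f : R -> R) (U : set (R * R)) : smooth setT f ->
  smooth U (fun p => f p.2).
Proof.
move=> sf vs x _; have [cf df] := sf (map snd vs) x.2 I.
have E : Defs.iterD vs (fun p : R * R => f p.2) = (fun p => Defs.iterD (map snd vs) f p.2).
  elim: vs f {sf cf df} => //= v vs IH f; exact: IH.
rewrite E; split=> [|v]; last exact: (df v.2).
by apply: continuous_comp; [exact: cvg_snd|exact: cf].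
Qed.

Lemma smooth_fst (f : R -> R) (U : set (R * R)) : smooth setT f ->
  smooth U (fun p => f p.1).
Proof.
move=> sf vs x _; have [cf df] := sf (map fst vs) x.1 I.
have E : Defs.iterD vs (fun p : R * R => f p.1) = (fun p => Defs.iterD (map fst vs) f p.1).
  elim: vs f {sf cf df} => //= v vs IH f; exact: IH.
rewrite E; split=> [|v]; last exact: (df v.1).
by apply: continuous_comp; [exact: cvg_fst|exact: cf].
Qed.

Program Definition trivial_vb_conn n (B : R -> 'M[C]_n) (sB : mxsmooth setT B)
    (pB : forall x, B (x + 1) = B x) : conn (trivial_vb R n) := {|
  cn_A := fun _ => B |}.
Next Obligation. by move=> n B sB pB _ x _. Qed.
Next Obligation. by []. Qed.
Next Obligation.
move=> n B sB pB i j x _ _ /=.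
by rewrite (mxder_derivE (mxder_cst _ _)) mulmx0 addr0 (invmx_uniq (mulmx1 1%:M)) mul1mx mulmx1.
Qed.

Definition dmx n (l : nat -> C) : 'M[C]_n := diag_mx (\row_i l i).

Definition dconn n (l : nat -> C) : conn (trivial_vb R n) :=
  @trivial_vb_conn n (fun=> dmx n l) (mxsmooth_cst _ _) (fun=> erefl).

Lemma monodromy_dconn n l : monodromy (dconn n l) (dmx n (cexp \o l)).
Proof.
(* The sign [c = -1] gives the flat frame, and [c = 1] its dual. *)
have dexp c x : mxder (fun x => dmx n (fun k => cexp (x%:C * (c * l k))))
    (c *: dmx n l *m dmx n (fun k => cexp (x%:C * (c * l k)))) x.
  move=> i j; rewrite -scalemxAl mulmx_diag.
  under eq_fun do rewrite !mxE.
  rewrite !mxE; case: eqP => _; last by rewrite mulr0; exact: cder_cst.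
  by rewrite !mulr1n mulrA; exact: cder_cexp.
exists (fun _ x => dmx n (fun k => cexp (x%:C * (-1 * l k)))),
  (fun _ x => dmx n (fun k => cexp (x%:C * (1 * l k)))); split.
- split.
  + by move=> i x _ _ /=; have := dexp (-1) x; rewrite scaleN1r mulNmx.
  + by move=> i x _ _ /=; have := dexp 1 x; rewrite scale1r diag_mxC.
  + move=> i x _ _; rewrite mulmx_diag; apply/matrixP => k j; rewrite !mxE.
    by rewrite mul1r mulN1r mulrN mulrC cexpN.
  + by move=> i j x _ _ _; rewrite mul1mx.
- move=> i; apply: mxep_smooth => k j.
  apply: ep_eq (epM (ep_cst (k == j)%:R) (ep_cexp (-1 * l k))) => x.
  by rewrite !mxE mulr_natl.
- move=> i x _; rewrite mulmx_diag; apply/matrixP => k j.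
  have E : cexp ((x + 1)%:C * (-1 * l k)) * cexp (l k) = cexp (x%:C * (-1 * l k)).
    have -> : (x + 1)%:C = x%:C + 1 by exact: (raddfD (real_complex R)).
    rewrite mulrDl mul1r cexpD mulN1r -mulrA.
    have -> := cexpN (l k).
    by rewrite mulr1.
  by rewrite !mxE E.
Qed.

Lemma dmx_expr_trace n (l : nat -> C) k : \tr (dmx n l ^+ k) = \sum_(i < n) l i ^+ k.
Proof.
have -> : dmx n l ^+ k = dmx n (fun i => l i ^+ k).
  elim: k => [|k IH]; first by apply/matrixP => i j; rewrite !mxE.
  rewrite exprS IH -mulmxE mulmx_diag; apply/matrixP => i j; rewrite !mxE.
  by rewrite exprS.
by rewrite mxtrace_diag; apply: eq_bigr => i _; rewrite mxE.
Qed.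

Lemma triangular_equiv n (l : nat -> C) (B : R -> 'M[C]_n) (sB : mxsmooth setT B)
    (pB : forall x, B (x + 1) = B x) :
  (forall x (i j : 'I_n), (i <= j)%N -> B x i j = l i *+ (i == j)) ->
  BCS_equiv (trivial_vb_conn sB pB) (dconn n l).
Proof.
move=> lB; pose P (s x : R) := dmx n l + (1 - s)%:C *: (B x - dmx n l).
have lBd x : low 1 (B x - dmx n l).
  by move=> i j; rewrite addn1 ltnS => ij; rewrite !mxE lB // subrr.
have ld : low 0 (dmx n l).
  by move=> i j; rewrite addn0 !mxE -val_eqE; case: ltngtP.
have sBd s : mxsmooth setT (P s).
  apply: (mxsmoothD openT (mxsmooth_cst _ _)).
  apply: (mxsmoothZ openT (csmooth_cst _ _)).
  exact: (mxsmoothD openT sB (mxsmooth_cst _ _)).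
have pBd s x : P s (x + 1) = P s x by rewrite /P pB.
have c1 x : cder (fun s : R => (1 - s)%:C) (-1) x.
  have := cderD (cder_cst 1 x) (cderM (cder_cst (-1) x) (cder_id x)).
  rewrite add0r mul0r add0r mulr1.
  by under eq_fun do rewrite mulN1r -raddfN -raddfD.
exists (fun s => trivial_vb_conn (sBd s) (pBd s)), (fun _ _ => 0); split.
- exists [:: 1]; split=> [|//|k kn]; first by rewrite /= ltr01.
  exists (fun _ p => P p.1 p.2); split=> [i|//]; rewrite /=.
  have oT : open [set p : R * R | setT p.2] by rewrite (_ : [set p | _] = setT) //; exact: openT.
  apply: (mxsmoothD oT (mxsmooth_cst _ _)).
  apply: (mxsmoothZ oT).
    have [] : csmooth setT (fun s : R => (1 - s)%:C).
      apply: ep_csmooth; apply: ep_eq (ep_atom (1 - 'X) 0) => x.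
      by rewrite mulr0 cexp0 mulr1 !hornerE raddfB.
    by move=> sr si; split; [exact: (smooth_fst sr)|exact: (smooth_fst si)].
  have sB2 : mxsmooth [set p : R * R | setT p.2] (fun p => B p.2).
    by move=> k1 k2; have [sr si] := sB k1 k2; split; [exact: (smooth_snd sr)|exact: (smooth_snd si)].
  exact: (mxsmoothD oT sB2 (mxsmooth_cst _ _)).
- by move=> i x _ /=; rewrite /P subr0 scale1r addrC subrK.
- by move=> i x _ /=; rewrite /P subrr scale0r addr0.
- apply: triangular_BCS => [i j x|s i x|s i x] /=.
  + exact: low1.
  + by apply: lowD => //; apply: lowZ; exact: lowS (lBd x).
  + have := mxderD (mxder_cst (dmx n l) s) (mxderZ (c1 s) (mxder_cst (B x - dmx n l) s)).
    move=> /mxder_derivE ->; rewrite add0r scaler0 addr0.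
    by apply: lowZ; exact: lBd.
- exact: dexact_0.
Qed.

(** Over one period [W] is multiplied on the right by [H^-1] and [G] on the left by [H], so [W G] is
    periodic and defines an isomorphism from the trivial bundle. Since [W] is flat, it pulls the
    connection back to [Gi D]. *)
Lemma monodromy_equiv (E : vbundle R) (a : conn E) H (l : nat -> C) :
  monodromy a H -> char_poly H = \prod_(i < vb_rank E) ('X - (cexp (l i))%:P) ->
  vbc_equiv (existT _ E a) (existT _ _ (dconn (vb_rank E) l)).
Proof.
move=> [W [V [fW sW WH]]] /exp_gauge[_ [G [Gi [D [[eG eGi eD] GGi dG GH GD]]]]].
have [dW dV VW gW] := fW.
have GiG x : Gi x *m G x = 1%:M by exact: mulmx1C.
pose B x := Gi x *m D x.
have sB : mxsmooth setT B by apply: mxep_smooth; exact: mxepM.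
have pB x : B (x + 1) = B x.
  have -> : B (x + 1) = Gi (x + 1) *m (H *m D x).
    rewrite /B; congr (_ *m _).
    have /mxder_derivE <- := mxder_shift (dG (x + 1)).
    by rewrite (_ : (fun y => _) = (fun y => H *m G y)) ?(mxder_derivE (mxderMl H (dG x))) //;
      apply/funext => y; rewrite GH.
  rewrite mulmxA; congr (_ *m _).
  by rewrite -[LHS]mulmx1 -(GGi x) -mulmxA [H *m _]mulmxA -GH mulmxA GiG mul1mx.
apply: (Relation_Operators.rst_trans _ _ _ (existT _ _ (trivial_vb_conn sB pB))); last first.
  apply: Relation_Operators.rst_step; apply: Step_BCS; exact: triangular_equiv.
apply: Relation_Operators.rst_step; apply: Step_iso => /=.
exists (fun i _ x => W i x *m G x), (fun i _ x => Gi x *m V i x); split.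
- by move=> i _ x [Ui _]; rewrite GH mulmxA WH.
- move=> i _; have oU : open (vb_U i) by have [] := vb_open i.
  apply: (@mxsmooth_sub _ _ _ _ (vb_U i)) => [x []//|].
  apply: (mxsmooth_mul oU (sW i)).
  by apply: (@mxsmooth_sub _ _ _ _ setT) => //; exact: mxep_smooth.
- move=> i _ x Ui _; have VW1 := VW i x I Ui; have WV := mulmx1C VW1; split.
    by rewrite mulmxA -[W i x *m _ *m _]mulmxA GGi mulmx1.
  by rewrite mulmxA -[Gi x *m _ *m _]mulmxA VW1 mulmx1.
- by move=> i k j l' x Ui Uk _ _; rewrite mulmx1 (gW i k x I Ui Uk) mulmxA.
- move=> i _ x Ui _; rewrite /= /B (mxder_derivE (mxderM (dW i x I Ui) (dG x))).
  rewrite mulmxDr !mulNmx mulmxN !mulmxA addrA subrr add0r.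
  by rewrite -[Gi x *m V i x *m W i x]mulmxA (VW i x I Ui) mulmx1.
Qed.

End Diagonalization.

(** * The eigenvalues of the monodromy as a complete invariant *)

(** By linearity the power sums determine the sum of any polynomial over the entries. In
    characteristic 0 an equality of multiples of a nonzero value then gives an equality of
    multiplicities. *)
Lemma power_sums_perm (F : numDomainType) (s t : seq F) :
  (forall k, \sum_(x <- s) x ^+ k = \sum_(x <- t) x ^+ k) -> perm_eq s t.
Proof.
move=> st.
have pst (p : {poly F}) : \sum_(x <- s) p.[x] = \sum_(x <- t) p.[x].
  under eq_bigr do rewrite horner_coef.
  under [RHS]eq_bigr do rewrite horner_coef.
  rewrite exchange_big [RHS]exchange_big; apply: eq_bigr => k _.
  by rewrite -!mulr_sumr st.
(* A polynomial that vanishes at all entries except c detects the multiplicity of c. *)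
apply/allP => c _ /=; apply/eqP.
pose p := \prod_(y <- s ++ t | y != c) ('X - y%:P).
have pc : p.[c] != 0.
  rewrite horner_prod prodf_seq_neq0; apply/allP => y _; apply/implyP => yc.
  by rewrite !hornerE subr_eq0 eq_sym.
have cnt u : {subset u <= s ++ t} -> \sum_(x <- u) p.[x] = p.[c] *+ count_mem c u.
  move=> us; transitivity (\sum_(x <- u) p.[c] *+ (x == c)).
    apply: eq_big_seq => x /us xu; case: eqVneq => [->//|xc].
    apply/eqP; rewrite mulr0n horner_prod prodf_seq_eq0; apply/hasP; exists x => //.
    by rewrite xc !hornerE subrr eqxx.
  elim: (u) => [|x v IH]; first by rewrite big_nil.
  by rewrite big_cons IH /= mulrnDr.
have := pst p; rewrite !cnt => [|x xt|x xs]; rewrite ?mem_cat ?xs ?xt ?orbT //.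
by move/eqP; rewrite -mulr_natr -[X in _ == X]mulr_natr (inj_eq (mulfI pc)) eqr_nat => /eqP.
Qed.

Section Spectrum.
Context {R : realType}.
Local Notation C := R[i].
Implicit Types (E F : vbc R) (s t : seq C).

(* s lists the eigenvalues of the monodromy, through their power sums. *)
Definition spectrum E s : Prop :=
  exists2 H, monodromy (projT2 E) H & forall k, \tr (H ^+ k) = \sum_(x <- s) x ^+ k.

Lemma vbc_step_trace E F H K k : vbc_step E F ->
  monodromy (projT2 E) H -> monodromy (projT2 F) K -> \tr (H ^+ k) = \tr (K ^+ k).
Proof.
move=> EF; case: E F / EF H K => [[E a] [F b] EF|E a b ab] H K /=.
  exact: monodromy_iso.
exact: BCS_equiv_trace.
Qed.

Lemma vbc_equiv_trace E F H K k : vbc_equiv E F ->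
  monodromy (projT2 E) H -> monodromy (projT2 F) K -> \tr (H ^+ k) = \tr (K ^+ k).
Proof.
move=> EF; elim: EF H K => {E F} [E F EF|E|E F _ IH|E F G _ IH1 _ IH2] H K mH mK.
- exact: vbc_step_trace EF mH mK.
- exact: monodromy_trace_uniq mH mK.
- exact/esym/IH.
- have [L mL] := monodromy_exists (projT2 F).
  by rewrite (IH1 H L) // (IH2 L K).
Qed.

Lemma spectrum_equiv E F s : vbc_equiv E F -> spectrum E s -> spectrum F s.
Proof.
move=> EF [H mH Hs]; have [K mK] := monodromy_exists (projT2 F).
by exists K => // k; rewrite -Hs (vbc_equiv_trace k EF mH mK).
Qed.

Lemma spectrum_uniq E s t : spectrum E s -> spectrum E t -> perm_eq s t.
Proof.
move=> [H mH Hs] [K mK Kt]; apply: power_sums_perm => k.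
by rewrite -Hs -Kt (monodromy_trace_uniq k mH mK).
Qed.

Definition dvbc (l : seq C) : vbc R := existT _ _ (dconn (size l) (nth 0 l)).

Lemma spectrum_dvbc l : spectrum (dvbc l) (map cexp l).
Proof.
exists (dmx (size l) (cexp \o nth 0 l)); first exact: monodromy_dconn.
by move=> k; rewrite dmx_expr_trace big_map (big_nth 0) big_mkord.
Qed.

Lemma spectrum_add E F s t : spectrum E s -> spectrum F t -> spectrum (vbc_add E F) (s ++ t).
Proof.
move=> [H mH Hs] [K mK Kt]; exists (block_mx H 0 0 K); first exact: monodromy_dsum.
by move=> k; rewrite block_expr mxtrace_block big_cat Hs Kt.
Qed.

Lemma spectrum_mul E F s t : spectrum E s -> spectrum F t ->
  spectrum (vbc_mul E F) [seq x * y | x <- s, y <- t].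
Proof.
move=> [H mH Hs] [K mK Kt]; exists (H *t K); first exact: monodromy_tens.
move=> k; rewrite tens_expr mxtrace_tens big_allpairs_dep Hs Kt big_distrl /=.
apply: eq_bigr => x _; rewrite big_distrr /=.
by apply: eq_bigr => y _; rewrite exprMn.
Qed.

Lemma monodromy_unit (E : vbundle R) (a : conn E) H : monodromy a H -> H \in unitmx.
Proof.
move=> [W [V [[dW dV VW gW] sW WH]]]; have [i Ui] := vb_cover E 0.
by have := VW i 0 I Ui; rewrite -(WH i 0 Ui) mulmxA => /mulmx1_unit[].
Qed.

(** The characteristic polynomial splits over C, and its roots are nonzero because [H] is
    invertible, so each of them is an exponential. *)
Lemma char_poly_cexp n (H : 'M[C]_n) : H \in unitmx ->
  exists2 l : seq C, size l = n & char_poly H = \prod_(c <- l) ('X - (cexp c)%:P).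
Proof.
move=> uH; have [r] := closed_field_poly_normal (char_poly H).
rewrite (monicP (char_poly_monic H)) scale1r => Hr.
have r0 z : z \in r -> z != 0.
  move=> zr; apply/eqP => z0.
  have : eigenvalue H 0 by rewrite eigenvalue_root_char Hr root_prod_XsubC -z0.
  move=> /eigenvalueP[v vH]; rewrite -[v]mulmx1 -(mulmxV uH) mulmxA vH scale0r.
  by rewrite mul0mx eqxx.
have /choice[log logE] : forall z : C, exists w, z != 0 -> cexp w = z.
  move=> z; have [->|/cexp_surj[w wz]] := eqVneq z 0; first by exists 0.
  by exists w.
exists (map log r); last by rewrite Hr big_map; apply: eq_big_seq => z /r0 /logE ->.
by rewrite size_map; have := size_char_poly H; rewrite Hr size_prod_XsubC => -[].
Qed.

Lemma monodromy_equiv_seq (E : vbundle R) (a : conn E) H (l : seq C) :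
  monodromy a H -> size l = vb_rank E -> char_poly H = \prod_(c <- l) ('X - (cexp c)%:P) ->
  vbc_equiv (existT _ E a) (dvbc l).
Proof.
move=> mH sl Hl; have : vbc_equiv (existT _ E a) (existT _ _ (dconn (vb_rank E) (nth 0 l))).
  by apply: monodromy_equiv mH _; rewrite Hl -sl (big_nth 0) big_mkord.
by rewrite -sl.
Qed.

Lemma vbc_log E : exists l, vbc_equiv E (dvbc l).
Proof.
case: E => E a; have [H mH] := monodromy_exists a.
have [l sl Hl] := char_poly_cexp (monodromy_unit mH).
by exists l; exact: monodromy_equiv_seq mH sl Hl.
Qed.

(** The characteristic polynomial of the monodromy of [dvbc l] is also the product over [l'], so the
    reduction to diagonal form can be carried out with the logarithms [l']. This absorbs both the
    order and the branches. *)
Lemma dvbc_equiv l l' : perm_eq (map cexp l) (map cexp l') ->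
  vbc_equiv (dvbc l) (dvbc l').
Proof.
move=> ll'; have sl : size l' = size l by have := perm_size ll'; rewrite !size_map.
rewrite {1}/dvbc; apply: (monodromy_equiv_seq (@monodromy_dconn R (size l) (nth 0 l))) => //.
rewrite (_ : char_poly _ = \prod_(i < size l) ('X - (cexp l`_i)%:P)); last first.
  rewrite char_poly_trig; last exact: diag_mx_is_trig.
  by apply: eq_bigr => i _; rewrite !mxE eqxx.
rewrite -(big_mkord xpredT (fun i => 'X - (cexp l`_i)%:P)) -(big_nth 0 xpredT (fun c => 'X - (cexp c)%:P)).
by rewrite -(big_map cexp xpredT (fun c => 'X - c%:P)) (perm_big _ ll') big_map.
Qed.

(** Both bundles are joined to diagonal ones, whose exponentials agree up to order by
    [spectrum_uniq]. *)
Lemma equiv_spectrum E F s : spectrum E s -> spectrum F s -> vbc_equiv E F.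
Proof.
move=> Es Fs; have [l El] := vbc_log E; have [l' Fl] := vbc_log F.
apply: (Relation_Operators.rst_trans _ _ _ (dvbc l)) => //.
apply: (Relation_Operators.rst_trans _ _ _ (dvbc l')); last first.
  exact: Relation_Operators.rst_sym.
apply: dvbc_equiv; apply: perm_trans (spectrum_uniq (spectrum_dvbc l) (spectrum_equiv El Es)) _.
exact: (spectrum_uniq (spectrum_equiv Fl Fs) (spectrum_dvbc l')).
Qed.

End Spectrum.

(** * The bijection and its compatibility with sums and products *)

Section Classification.
Context {R : realType}.
Local Notation C := R[i].
Local Open Scope quotient_scope.

Lemma spectrum_perm (E : vbc R) s t : perm_eq s t -> spectrum E s -> spectrum E t.
Proof.
by move=> st [H mH Hs]; exists H => // k; rewrite Hs (perm_big _ st).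
Qed.

Lemma vbc_class_eq (E F : vbc R) : vbc_equiv E F -> vbc_class E = vbc_class F.
Proof.
move=> EF; apply/seteqP; split=> G; apply: Relation_Operators.rst_trans => //.
exact: Relation_Operators.rst_sym.
Qed.

(** Because the spectrum is complete, an operation whose effect on spectra is known respects the
    classes; its well-definedness and its value are obtained together. *)
Lemma class_opE (op : vbc R -> vbc R -> vbc R) (f : seq C -> seq C -> seq C) E F G s t :
  (forall E F s t, spectrum E s -> spectrum F t -> spectrum (op E F) (f s t)) ->
  spectrum E s -> spectrum F t -> spectrum G (f s t) ->
  vbc_class G = class_op op (vbc_class E) (vbc_class F).
Proof.
move=> opf Es Ft Gst; have refl (K : vbc R) : vbc_equiv K K by exact: Relation_Operators.rst_refl.
apply/seteqP; split=> [K GK|K [E' [F' [EE' FF' opK]]]].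
  exists E, F; split; [exact: refl|exact: refl|].
  by apply: Relation_Operators.rst_trans GK; exact: equiv_spectrum (opf _ _ _ _ Es Ft) Gst.
apply: Relation_Operators.rst_trans opK; apply: equiv_spectrum Gst _.
by apply: opf; [exact: spectrum_equiv EE' Es|exact: spectrum_equiv FF' Ft].
Qed.

(** The exponential on C / Z; the choice of the representative is harmless by [cexp_eq]. *)
Definition qexp (x : CmodZ R) : C := cexp (repr x).

Lemma cexp_eq z w : cexp z = cexp w <-> \pi_(CmodZ R) z = \pi_(CmodZ R) w.
Proof.
have -> : cexp z = cexp w <-> cexp (z - w) = 1.
  rewrite cexpD; split=> [->|e]; first by rewrite mulrC cexpN.
  by rewrite -[LHS]mulr1 -(cexpN w) mulrA e mul1r.
by rewrite cexp_eq1 Quotient.idealrBE; split=> /eqP.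
Qed.

Lemma qexp_pi z : qexp (\pi_(CmodZ R) z) = cexp z.
Proof. by apply/cexp_eq; rewrite reprK. Qed.

Lemma qexp_inj : injective qexp.
Proof. by move=> x y /cexp_eq; rewrite !reprK. Qed.

Lemma qexpD x y : qexp (x + y) = qexp x * qexp y.
Proof.
rewrite -[x]reprK -[y]reprK !qexp_pi -cexpD -qexp_pi; congr qexp.
by rewrite !piE.
Qed.

Lemma qexp0 : qexp 0 = 1.
Proof. by rewrite -cexp0 -qexp_pi; congr qexp; rewrite !piE. Qed.

(** Two choices are made, an ordering of the tuple and a logarithm for each entry; the spectrum sees
    neither. *)
Definition vbc_of (u : utuples R) : vbc R := dvbc (map repr (repr u)).

Lemma spectrum_vbc_of s : spectrum (vbc_of (utuple s)) (map qexp s).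
Proof.
apply: spectrum_perm (spectrum_dvbc _); rewrite -map_comp; apply: perm_map.
have /eqmodP : repr (utuple s) = s %[mod utuples R] by rewrite reprK.
by [].
Qed.

Lemma spectrum_trivial n : spectrum (existT _ _ (trivial_conn R n)) (nseq n 1).
Proof.
exists (dmx n (fun=> cexp 0)).
  apply: monodromy_conn_eq (monodromy_dconn n (fun=> 0)) => i x _ /=.
  by apply/matrixP => j k; rewrite !mxE mul0rn.
move=> k; rewrite dmx_expr_trace cexp0 big_nseq sumr_const card_ord expr1n.
by rewrite iter_addr_0.
Qed.

Definition MS1_of (E : vbc R) : MS1 R := exist _ (vbc_class E) (ex_intro _ E erefl).

Lemma MS1_of_eq E F : MS1_of E = MS1_of F <-> vbc_equiv E F.
Proof.
split=> [/(congr1 sval) /= EF|EF]; last exact/eq_exist/vbc_class_eq.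
have : vbc_class F F by exact: Relation_Operators.rst_refl.
by rewrite -EF.
Qed.

Lemma MS1_of_vbc_of_bij : bijective (fun u => MS1_of (vbc_of u)).
Proof.
have inj u v : MS1_of (vbc_of u) = MS1_of (vbc_of v) -> u = v.
  rewrite -[u]reprK -[v]reprK => /MS1_of_eq uv.
  have := spectrum_uniq (spectrum_equiv uv (spectrum_vbc_of (repr u))) (spectrum_vbc_of (repr v)).
  by move=> /(perm_map_inj qexp_inj) ruv; apply/eqmodP.
have /choice[g gK] (P : MS1 R) : exists u, MS1_of (vbc_of u) = P.
  case: P => P [E PE]; have [l El] := vbc_log E.
  exists (utuple (map \pi_(CmodZ R) l)); apply: eq_exist => /=; rewrite PE.
  apply: vbc_class_eq; apply: equiv_spectrum (spectrum_vbc_of _) _.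
  rewrite -map_comp (eq_map qexp_pi).
  by apply: spectrum_equiv (spectrum_dvbc l); exact: Relation_Operators.rst_sym.
by exists g => // u; apply: inj; rewrite gK.
Qed.

End Classification.

Theorem corollary8p6 (R : realType) :
  exists Phi : utuples R -> MS1 R,
    [/\ bijective Phi,
        sval (Phi (utuple [::])) = class0 R,
        sval (Phi (utuple [:: 0])) = class1 R,
        forall s t : seq (CmodZ R),
          sval (Phi (utuple (s ++ t))) =
            class_add (sval (Phi (utuple s))) (sval (Phi (utuple t)))
      & forall s t : seq (CmodZ R),
          sval (Phi (utuple [seq x + y | x <- s, y <- t])) =
            class_mul (sval (Phi (utuple s))) (sval (Phi (utuple t)))].
Proof.
exists (fun u => MS1_of (vbc_of u)); split=> [||| s t | s t] /=.
- exact: MS1_of_vbc_of_bij.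
- by apply/vbc_class_eq/equiv_spectrum; [exact: spectrum_vbc_of|exact: spectrum_trivial 0%N].
- apply/vbc_class_eq/equiv_spectrum; [exact: spectrum_vbc_of|].
  by rewrite /= qexp0; exact: spectrum_trivial 1%N.
- apply: class_opE (@spectrum_add R) (spectrum_vbc_of s) (spectrum_vbc_of t) _.
  by rewrite -map_cat; exact: spectrum_vbc_of.
- apply: class_opE (@spectrum_mul R) (spectrum_vbc_of s) (spectrum_vbc_of t) _.
  have -> : [seq x * y | x <- map qexp s, y <- map qexp t] =
      map qexp [seq x + y | x <- s, y <- t].
    by rewrite map_allpairs allpairs_mapl allpairs_mapr; apply: eq_allpairs => x y; rewrite qexpD.
  exact: spectrum_vbc_of.
Qed.
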